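(* Let $d\ge 1$ and let $h_1,h_2,\dots,h_s\in\mathbb{R}^d$ be such that they span a dense additive subgroup of $\mathbb{R}^d$, i.e. $h_1\mathbb{Z}+\cdots+h_s\mathbb{Z}$ is dense in $\mathbb{R}^d$. Let $f$ be a (complex-valued) distribution on $\mathbb{R}^d$ such that there exist natural numbers $n_1,\dots,n_s$ satisfying $$\dim \operatorname{span}\{f,\tau_{h_i}(f),\dots,(\tau_{h_i})^{n_i}(f)\}\le n_i,\qquad i=1,\dots,s.$$ Then $f$ is, in the distributional sense, a continuous exponential polynomial. In particular, $f$ is an ordinary function which is equal almost everywhere, with respect to Lebesgue measure, to an exponential polynomial.
   Context: For $h\in\mathbb{R}^d$, $\tau_h$ denotes the translation operator: $\tau_h(f)(x)=f(x+h)$ for functions $f$ on $\mathbb{R}^d$, extended to distributions by duality, $\langle \tau_h(f),\varphi\rangle=\langle f,\tau_{-h}(\varphi)\rangle$ for test functions $\varphi\in C_c^\infty(\mathbb{R}^d)$; $(\tau_h)^k$ denotes its $k$-th iterate, so $(\tau_h)^k=\tau_{kh}$. The span is the complex linear span in the space of distributions. A (continuous) exponential polynomial on $\mathbb{R}^d$ is a finite complex linear combination of exponential monomials $x^{\alpha}e^{\langle x,\lambda\rangle}$, where $\alpha\in\mathbb{N}^d$ (with $0\in\mathbb{N}$), $\lambda\in\mathbb{C}^d$ and $\langle x,\lambda\rangle=\sum_{j=1}^d x_j\lambda_j$. That a distribution is an exponential polynomial in the distributional sense means that it equals the distribution defined by integration against an exponential polynomial. *)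

(* Defs.v *)
From HB Require Import structures.
From mathcomp Require Import all_boot all_order all_algebra.
From mathcomp Require Import all_classical all_reals all_analysis.
From mathcomp.real_closed Require Import complex.
Set Implicit Arguments.
Unset Strict Implicit.
Unset Printing Implicit Defensive.
Import Order.TTheory GRing.Theory Num.Theory.
Import numFieldNormedType.Exports.

Local Open Scope classical_set_scope.
Local Open Scope complex_scope.
Local Open Scope ring_scope.

(* The library has no R-topology on R[i]: limits, derivatives and integrals of
   complex-valued functions are taken on real and imaginary parts. *)
Notation RE := (@complex.Re _).
Notation IM := (@complex.Im _).

Section Smooth.
Context {R : realType} {d : nat}.
Implicit Types (f g : 'rV[R]_d -> R[i]) (s : seq 'I_d).

Definition basis_vec (i : 'I_d) : 'rV[R]_d := delta_mx 0 i.

Definition partial (i : 'I_d) f : 'rV[R]_d -> R[i] := fun x =>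
  'D_(basis_vec i) (RE \o f) x +i* 'D_(basis_vec i) (IM \o f) x.

(* [:: i1; ...; ik] stands for d_i1 ... d_ik, of order k; every multi-index
   derivative is of this form. *)
Definition partials s f := foldr partial f s.

Definition C1 (u : 'rV[R]_d -> R) :=
  continuous u /\ forall i x, derivable u x (basis_vec i).

Definition smooth f := forall s,
  C1 (RE \o partials s f) /\ C1 (IM \o partials s f).

Definition supp f : set 'rV[R]_d := closure [set x | f x != 0].

Definition is_test f := smooth f /\ compact (supp f).

Definition shift_fun (h : 'rV[R]_d) f : 'rV[R]_d -> R[i] := fun x => f (x + h).

Definition lin (a : R[i]) f g : 'rV[R]_d -> R[i] := fun x => a * f x + g x.

Lemma Re_lin (a : R[i]) f g : RE \o lin a f g =
  (RE a \*: (RE \o f) + (- IM a) \*: (IM \o f)) + (RE \o g).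
Proof.
apply/funext => x /=; rewrite /lin !fctE /=.
case: a (f x) (g x) => [? ?] [? ?] [? ?] /=.
by rewrite /GRing.scale /= mulNr.
Qed.

Lemma Im_lin (a : R[i]) f g : IM \o lin a f g =
  (RE a \*: (IM \o f) + IM a \*: (RE \o f)) + (IM \o g).
Proof.
apply/funext => x /=; rewrite /lin !fctE /=.
by case: a (f x) (g x) => [? ?] [? ?] [? ?] /=.
Qed.

Lemma C1_lin (a b : R) u v w : C1 u -> C1 v -> C1 w ->
  C1 ((a \*: u + b \*: v) + w).
Proof.
move=> [cu du] [cv dv] [cw dw]; split=> [x|i x].
  have zcu : {for x, continuous (a \*: u)} by exact: (@continuousZr R R _ u a x (cu x)).
  have zcv : {for x, continuous (b \*: v)} by exact: (@continuousZr R R _ v b x (cv x)).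
  apply: (@continuousD R R _ (a \*: u + b \*: v) w x) (cw x).
  exact: (@continuousD R R _ _ _ x zcu zcv).
have zu := @derivableZ R _ R u a x (basis_vec i) (du i x).
have zv := @derivableZ R _ R v b x (basis_vec i) (dv i x).
exact: (@derivableD R _ R _ _ _ _ (@derivableD R _ R _ _ _ _ zu zv) (dw i x)).
Qed.

Lemma derive_lin (a b : R) u v w i x : C1 u -> C1 v -> C1 w ->
  'D_(basis_vec i) ((a \*: u + b \*: v) + w) x =
  a * 'D_(basis_vec i) u x + b * 'D_(basis_vec i) v x + 'D_(basis_vec i) w x.
Proof.
move=> [cu du] [cv dv] [cw dw].
have zu := @derivableZ R _ R u a x (basis_vec i) (du i x).
have zv := @derivableZ R _ R v b x (basis_vec i) (dv i x).
have zuv := @derivableD R _ R _ _ x (basis_vec i) zu zv.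
rewrite (@deriveD R _ R _ _ x (basis_vec i) zuv (dw i x)).
rewrite (@deriveD R _ R _ _ x (basis_vec i) zu zv).
by rewrite (@deriveZ R _ R _ _ _ _ (du i x)) (@deriveZ R _ R _ _ _ _ (dv i x)).
Qed.

Lemma partials_lin a s f g : smooth f -> smooth g ->
  partials s (lin a f g) = lin a (partials s f) (partials s g).
Proof.
move=> sf sg; elim: s => //= i s IH; rewrite /partial IH Re_lin Im_lin.
have [fr fi] := sf s; have [gr gi] := sg s.
apply/funext => x; rewrite !derive_lin // /lin.
by case: a {IH} => ar ai /=; rewrite mulNr.
Qed.

Lemma smooth_lin a f g : smooth f -> smooth g -> smooth (lin a f g).
Proof.
move=> sf sg s; rewrite partials_lin // Re_lin Im_lin.
have [fr fi] := sf s; have [gr gi] := sg s.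
by split; apply: C1_lin.
Qed.

Lemma supp_lin a f g K : closed K -> supp f `<=` K -> supp g `<=` K ->
  supp (lin a f g) `<=` K.
Proof.
move=> cK sf sg; rewrite [X in _ `<=` X]((closure_id K).1 cK).
apply: closureS => x /=; apply: contraPP => Kx.
have f0 : f x = 0.
  by apply/eqP; apply: contra_notT Kx => fx; apply/sf/subset_closure.
have g0 : g x = 0.
  by apply/eqP; apply: contra_notT Kx => gx; apply/sg/subset_closure.
by rewrite /lin f0 g0 mulr0 addr0 eqxx.
Qed.

Lemma closed_supp f : closed (supp f).
Proof. exact: closed_closure. Qed.

Lemma test_lin a f g : is_test f -> is_test g -> is_test (lin a f g).
Proof.
move=> [sf cf] [sg cg]; split; first exact: smooth_lin.
apply: (@subclosed_compact _ _ (supp f `|` supp g)).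
- exact: closed_supp.
- exact: compactU.
- by apply: supp_lin; [apply: closedU; exact: closed_supp|left|right].
Qed.

Lemma test0 : is_test (cst 0).
Proof.
have p0 s : partials s (cst 0) = cst 0.
  elim: s => //= i s ->; apply/funext => x.
  transitivity (('D_(basis_vec i) (cst (0 : R)) x)
             +i* ('D_(basis_vec i) (cst (0 : R)) x)) => //.
  by rewrite (@derive_cst R _ R 0 x (basis_vec i)).
have C10 : C1 (cst 0 : 'rV[R]_d -> R).
  split=> [x|i x]; first exact: cst_continuous.
  exact: (@derivable_cst R _ R 0 x (basis_vec i)).
split=> [s|]; first by rewrite p0.
rewrite /supp (_ : [set x | _] = set0) ?closure0 //; first exact: compact0.
by apply/seteqP; split=> x //=; rewrite eqxx.
Qed.

Lemma continuous_addr (h x : 'rV[R]_d) :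
  {for x, continuous (fun y : 'rV[R]_d => y + h)}.
Proof. exact: (cvgD (@cvg_id _ (nbhs x)) (@cvg_cst _ h _ _ _)). Qed.

Lemma C1_shift h u : C1 u -> C1 (fun x => u (x + h)).
Proof.
move=> [cu du]; split=> [x|i x].
  have := @continuous_comp _ _ _ (fun y : 'rV[R]_d => y + h) u x.
  by apply; [exact: continuous_addr|exact: cu].
have := du i (x + h); rewrite /derivable /=.
by under eq_fun do rewrite addrA.
Qed.

Lemma derive_shiftE (h : 'rV[R]_d) (u : 'rV[R]_d -> R) i x :
  'D_(basis_vec i) (fun y => u (y + h)) x = 'D_(basis_vec i) u (x + h).
Proof. by rewrite /derive /=; under eq_fun do rewrite -addrA. Qed.

Lemma partials_shift h f s :
  partials s (shift_fun h f) = shift_fun h (partials s f).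
Proof.
elim: s => //= i s ->; apply/funext => x.
by rewrite /partial /shift_fun -!derive_shiftE.
Qed.

Lemma supp_shift h f : supp (shift_fun h f) `<=` [set x | supp f (x + h)].
Proof.
rewrite /supp closureE; apply: smallest_sub => [|x /= fx]; last first.
  exact: subset_closure.
apply: (@preimage_closed _ _ (fun y : 'rV[R]_d => y + h)); last exact: closed_closure.
by move=> x _; exact: continuous_addr.
Qed.

Lemma compact_shift (h : 'rV[R]_d) (K : set 'rV[R]_d) : compact K ->
  compact [set x | K (x + h)].
Proof.
move=> cK; rewrite (_ : [set x | _] = (fun x => x - h) @` K).
  apply: continuous_compact => //.
  by apply: continuous_subspaceT => x; exact: continuous_addr.
by apply/seteqP; split=> [x Kx|_ [x Kx <-]] /=; [exists (x + h)=> //; rewrite addrK|rewrite subrK].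
Qed.

Lemma test_shift h f : is_test f -> is_test (shift_fun h f).
Proof.
move=> [sf cf]; split=> [s|].
  rewrite partials_shift; have [fr fi] := sf s.
  by split; [exact: (C1_shift h fr)|exact: (C1_shift h fi)].
apply: (subclosed_compact _ _ (@supp_shift h f)); first exact: closed_supp.
exact: compact_shift.
Qed.

End Smooth.

Definition is_test_pred (R : realType) (d : nat) :
  {pred 'rV[R]_d -> R[i]^o} := fun f => `[< is_test f >].

Record testfun (R : realType) (d : nat) := TestFun {
  testfun_val :> 'rV[R]_d -> R[i]^o ;
  testfun_valP : is_test_pred testfun_val }.

Section TestfunLmod.
Context {R : realType} {d : nat}.

HB.instance Definition _ := [isSub of testfun R d for @testfun_val R d].
HB.instance Definition _ := [Choice of testfun R d by <:].

Lemma is_test_submod : submod_closed (@is_test_pred R d).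
Proof.
split; first by apply/asboolP; exact: test0.
move=> a f g /asboolP tf /asboolP tg; apply/asboolP.
exact: (test_lin a tf tg).
Qed.

HB.instance Definition _ :=
  GRing.isSubmodClosed.Build _ _ (@is_test_pred R d) is_test_submod.
HB.instance Definition _ := [SubChoice_isSubLmodule of testfun R d by <:].

Definition shift_test (h : 'rV[R]_d) (phi : testfun R d) : testfun R d :=
  TestFun (asboolT (test_shift h (asboolW (testfun_valP phi)))).

End TestfunLmod.

Section Distributions.
Context {R : realType} {d : nat}.
Local Notation testfun := (testfun R d).

(* |u phi| <= C * max over the derivatives of order <= N of their sup norm, for
   phi supported in K; the sup norm is given through its upper bounds M. *)
Definition distr_bound (K : set 'rV[R]_d) (C : R) (N : nat)
    (u : testfun -> R[i]) :=
  forall (phi : testfun) (M : R), supp phi `<=` K ->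
    (forall s x, (size s <= N)%N -> `|partials s phi x| <= M%:C) ->
    `|u phi| <= (C * M)%:C.

(* Continuity for the usual (inductive limit) topology of test functions. *)
Definition is_distr (u : testfun -> R[i]^o) :=
  linear u /\ forall K, compact K -> exists C N, distr_bound K C N u.
End Distributions.

Definition is_distr_pred (R : realType) (d : nat) :
  {pred testfun R d -> R[i]^o} := fun u => `[< is_distr u >].

Record distr (R : realType) (d : nat) := Distr {
  distr_val :> testfun R d -> R[i]^o ;
  distr_valP : is_distr_pred distr_val }.

Section DistrLmod.
Context {R : realType} {d : nat}.
Implicit Types (u v : testfun R d -> R[i]^o).

Lemma is_distr0 : @is_distr R d (0 : testfun R d -> R[i]^o).
Proof.
split=> [a f g|K _]; first by rewrite /= scaler0 addr0.
by exists 0, 0%N => phi M _ _; rewrite normr0 mul0r.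
Qed.

Lemma is_distr_lin (a : R[i]) u v :
  is_distr u -> is_distr v -> is_distr (a *: u + v).
Proof.
move=> [lu bu] [lv bv]; split=> [b f g|K cK].
  rewrite !fctE lu lv !scalerDr !scalerA (mulrC a b).
  by rewrite !addrA; congr (_ + _); rewrite -!addrA; congr (_ + _); rewrite addrC.
have [C1 [N1 b1]] := bu K cK; have [C2 [N2 b2]] := bv K cK.
set ra := Num.sqrt (RE a ^+ 2 + IM a ^+ 2).
exists (ra * C1 + C2), (maxn N1 N2) => phi M sK pM.
rewrite !fctE; apply: (le_trans (ler_normD _ _)).
rewrite mulrDl rmorphD /=; apply: lerD.
  rewrite -mulrA rmorphM /= normrM; apply: ler_pM => //; last first.
    by apply: b1 => // s x sN; apply: pM; rewrite (leq_trans sN)// leq_maxl.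
  by rewrite normc_def.
by apply: b2 => // s x sN; apply: pM; rewrite (leq_trans sN)// leq_maxr.
Qed.

HB.instance Definition _ := [isSub of distr R d for @distr_val R d].
HB.instance Definition _ := [Choice of distr R d by <:].

Lemma is_distr_submod : submod_closed (@is_distr_pred R d).
Proof.
split; first by apply/asboolP; exact: is_distr0.
move=> a u v /asboolP du /asboolP dv; apply/asboolP.
exact: (is_distr_lin a du dv).
Qed.

HB.instance Definition _ :=
  GRing.isSubmodClosed.Build _ _ (@is_distr_pred R d) is_distr_submod.
HB.instance Definition _ := [SubChoice_isSubLmodule of distr R d by <:].

Lemma is_distr_translate (h : 'rV[R]_d) u :
  is_distr u -> is_distr (fun phi => u (shift_test (- h) phi)).
Proof.
move=> [lu bu]; split=> [a f g|K cK].
  by rewrite -lu; congr (u _); apply: val_inj.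
have [C [N b]] := bu _ (@compact_shift _ _ (- h) K cK).
exists C, N => phi M sK pM; apply: b => [x /supp_shift /sK //|s x sN].
by rewrite /= partials_shift; exact: pM.
Qed.

Definition translate (h : 'rV[R]_d) (u : distr R d) : distr R d :=
  Distr (asboolT (is_distr_translate h (asboolW (distr_valP u)))).

End DistrLmod.

Section Dim.
Context {K : fieldType} {V : lmodType K}.

Definition lspan m (b : 'I_m -> V) : set V :=
  [set v | exists c : 'I_m -> K, v = \sum_i c i *: b i].

Definition lfree m (b : 'I_m -> V) :=
  forall c : 'I_m -> K, \sum_i c i *: b i = 0 -> forall i, c i = 0.

Definition has_dim (W : set V) (m : nat) :=
  exists b : 'I_m -> V, lfree b /\ lspan b = W.

Definition dim_le (W : set V) (n : nat) := exists2 m, (m <= n)%N & has_dim W m.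

End Dim.

(* e^(x + iy) = e^x (cos y + i sin y) *)
Definition Cexp {R : realType} (z : R[i]) : R[i] :=
  (expR (RE z) * cos (IM z)) +i* (expR (RE z) * sin (IM z)).

Section ExpPoly.
Context {R : realType} {d : nat}.

Definition exp_monomial (alpha : 'I_d -> nat) (lambda : 'I_d -> R[i])
    (x : 'rV[R]_d) : R[i] :=
  (\prod_j (x 0 j)%:C ^+ alpha j) * Cexp (\sum_j (x 0 j)%:C * lambda j).

Definition exp_polynomial (p : 'rV[R]_d -> R[i]) :=
  exists (m : nat) (c : 'I_m -> R[i]) (alpha : 'I_m -> 'I_d -> nat)
    (lambda : 'I_m -> 'I_d -> R[i]),
  forall x, p x = \sum_k c k * exp_monomial (alpha k) (lambda k) x.
End ExpPoly.

Definition rV_display : measure_display. Proof. exact: default_measure_display. Qed.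

Section MeasurableRV.
Context {R : realType} (n : nat).

Definition rV_coord (i : 'I_n) (x : 'rV[R]_n) : measurableTypeR R := x 0 i.

(* The product sigma-algebra, i.e. the Borel sets of R^n. *)
Definition rV_measurable : set (set 'rV[R]_n) := g_sigma_preimage rV_coord.

Let rV_set0 : rV_measurable set0.
Proof. exact: sigma_algebra0. Qed.

Let rV_setC A : rV_measurable A -> rV_measurable (~` A).
Proof. exact: sigma_algebraC. Qed.

Let rV_bigcup (F : (set 'rV[R]_n)^nat) : (forall i, rV_measurable (F i)) ->
  rV_measurable (\bigcup_i (F i)).
Proof. exact: sigma_algebra_bigcup. Qed.

HB.instance Definition _ := @isMeasurable.Build rV_display
  'rV[R]_n rV_measurable rV_set0 rV_setC rV_bigcup.

End MeasurableRV.

Section Lebesgue.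
Context {R : realType}.

Definition rV_cons n (p : measurableTypeR R * 'rV[R]_n) : 'rV[R]_n.+1 :=
  \row_i (if unlift ord0 i is Some j then p.2 0 j else p.1).

Lemma measurable_coord n (i : 'I_n) :
  measurable_fun [set: 'rV[R]_n] (rV_coord i).
Proof.
move=> _ Y mY; rewrite setTI; apply: sub_sigma_algebra => /=.
rewrite -bigcup_seq/=; exists i => /=; first by rewrite mem_index_enum.
by exists Y => //; rewrite setTI.
Qed.

Lemma measurable_fun_coordP d (T : measurableType d) n (f : T -> 'rV[R]_n) :
  (forall i, measurable_fun setT (rV_coord i \o f)) -> measurable_fun setT f.
Proof.
move=> mf; apply: (measurability _ (erefl : @measurable _ 'rV[R]_n = _)).
move=> _ [B + <-]; rewrite -bigcup_seq => -[i _ [C mC <-]].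
by rewrite !setTI; have := mf i measurableT C mC; rewrite setTI.
Qed.

Lemma rV_cons0 n (p : measurableTypeR R * 'rV[R]_n) :
  rV_cons p 0 ord0 = p.1.
Proof. by rewrite mxE unlift_none. Qed.

Lemma rV_consS n (p : measurableTypeR R * 'rV[R]_n) j :
  rV_cons p 0 (lift ord0 j) = p.2 0 j.
Proof. by rewrite mxE liftK. Qed.

Lemma measurable_rV_cons n : measurable_fun setT (@rV_cons n).
Proof.
apply: measurable_fun_coordP => i; case: (unliftP ord0 i) => [j|] ->.
  rewrite (_ : _ \o _ = rV_coord j \o snd); last first.
    by apply/funext => p; exact: rV_consS.
  by apply: measurableT_comp => //; exact: measurable_coord.
rewrite (_ : _ \o _ = fst) //.
by apply/funext => p; exact: rV_cons0.
Qed.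

Definition rV_uncons n (x : 'rV[R]_n.+1) : measurableTypeR R * 'rV[R]_n :=
  (x 0 ord0, \row_j x 0 (lift ord0 j)).

Lemma rV_consK n : cancel (@rV_cons n) (@rV_uncons n).
Proof.
move=> p; rewrite /rV_uncons rV_cons0; case: p => x v; congr pair.
by apply/rowP => j; rewrite mxE rV_consS.
Qed.

Lemma measurable_rV_uncons n : measurable_fun setT (@rV_uncons n).
Proof.
apply: measurable_fun_pair; first exact: (@measurable_coord n.+1 ord0).
apply: measurable_fun_coordP => i.
rewrite (_ : _ \o _ = rV_coord (lift ord0 i)); first exact: measurable_coord.
by apply/funext => x; rewrite /rV_coord /= mxE.
Qed.

Section Step.
Variables (n : nat) (m : {sigma_finite_measure set 'rV[R]_n -> \bar R}).

Definition measure_cons : set 'rV[R]_n.+1 -> \bar R :=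
  pushforward (@lebesgue_measure R \x m)%E (@rV_cons n).

Let cons0 : measure_cons set0 = 0%E.
Proof. by rewrite /measure_cons /pushforward preimage_set0 measure0. Qed.

Let cons_ge0 A : (0 <= measure_cons A)%E.
Proof. by rewrite /measure_cons /pushforward; exact: measure_ge0. Qed.

Let cons_sigma_additive : semi_sigma_additive measure_cons.
Proof.
move=> F mF tF mUF; rewrite /measure_cons /pushforward preimage_bigcup.
have mc k : measurable (@rV_cons n @^-1` F k).
  by rewrite -[X in measurable X]setTI; exact: measurable_rV_cons.
apply: measure_sigma_additive => //.
apply/trivIsetP => /= i j _ _ ij; rewrite -preimage_setI.
by move/trivIsetP : tF => /(_ _ _ _ _ ij) ->//; rewrite preimage_set0.
Qed.

HB.instance Definition _ := isMeasure.Build _ _ _ measure_cons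
  cons0 cons_ge0 cons_sigma_additive.

Let cons_sigma_finite : sigma_finite setT measure_cons.
Proof.
have /sigma_finiteP[F [TF ndF Foo]] := sigma_finiteT (@lebesgue_measure R).
have /sigma_finiteP[G [TG ndG Goo]] := sigma_finiteT m.
exists (fun k => @rV_uncons n @^-1` (F k `*` G k)).
  rewrite -preimage_bigcup (_ : \bigcup_k _ = setT) ?preimage_setT //.
  apply/seteqP; split=> // -[x y] _.
  have [i _ Fx] : (\bigcup_k F k) x by rewrite -TF.
  have [j _ Gy] : (\bigcup_k G k) y by rewrite -TG.
  exists (maxn i j) => //; split.
    by move: x Fx; exact/subsetPset/ndF/leq_maxl.
  by move: y Gy; exact/subsetPset/ndG/leq_maxr.
move=> k; have [mF ?] := Foo k; have [mG ?] := Goo k; split.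
  by rewrite -[X in measurable X]setTI; apply: measurable_rV_uncons => //; exact: measurableX.
rewrite /measure_cons /pushforward -comp_preimage.
rewrite (_ : _ \o _ = id) ?funeqE => [|p]; last exact: rV_consK.
by rewrite preimage_id product_measure1E// lte_mul_pinfty// ge0_fin_numE.
Qed.

HB.instance Definition _ := Measure_isSigmaFinite.Build _ _ _ measure_cons
  cons_sigma_finite.

End Step.

(* The n-fold product of the Lebesgue measure of R; lebesgue_rV_box below
   characterises it. *)
Fixpoint lebesgue_rV n : {sigma_finite_measure set 'rV[R]_n -> \bar R} :=
  if n is n'.+1 then measure_cons (lebesgue_rV n') else dirac (0 : 'rV[R]_0).


Lemma lebesgue_rV_box n (A : 'I_n -> set (measurableTypeR R)) :
  (forall i, measurable (A i)) ->
  lebesgue_rV n [set x | forall i, A i (x 0 i)] =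
  (\prod_i lebesgue_measure (A i))%E.
Proof.
elim: n A => [|n IHn] A mA /=.
  rewrite big_ord0 diracE (_ : _ \in _ = true) //.
  by apply/mem_set => -[].
have mB : measurable [set v : 'rV[R]_n | forall i, A (lift ord0 i) (v 0 i)].
  rewrite (_ : [set v | _] =
    \bigcap_(i in [set: 'I_n]) (rV_coord i @^-1` A (lift ord0 i))); last first.
    by apply/seteqP; split=> [v Av i _|v Av i]; [exact: Av|exact: (Av i I)].
  apply: fin_bigcap_measurable => // i _.
  by rewrite -[X in measurable X]setTI; exact: measurable_coord.
rewrite big_ord_recl -IHn // -product_measure1E // /measure_cons /pushforward.
congr (_ _); apply/seteqP; split=> [p Ap|p [Ap1 Ap2] i].
  split=> [|i]; first by have := Ap ord0; rewrite rV_cons0.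
  by have := Ap (lift ord0 i); rewrite rV_consS.
case: (unliftP ord0 i) => [j|] ->; last by rewrite rV_cons0.
by rewrite rV_consS; exact: Ap2.
Qed.

Definition Cintegral n (g : 'rV[R]_n -> R[i]) : R[i] :=
  (\int[lebesgue_rV n]_x RE (g x)) +i* (\int[lebesgue_rV n]_x IM (g x)).

Definition loc_integrable n (g : 'rV[R]_n -> R[i]) :=
  [/\ measurable_fun setT (RE \o g), measurable_fun setT (IM \o g) &
   forall K, compact K ->
    (lebesgue_rV n).-integrable K (EFin \o (RE \o g)) /\
    (lebesgue_rV n).-integrable K (EFin \o (IM \o g))].

(* f is the distribution phi |-> \int g phi. *)
Definition is_function n (f : distr R n) (g : 'rV[R]_n -> R[i]) :=
  loc_integrable g /\
  forall phi : testfun R n, f phi = Cintegral (fun x => g x * phi x).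

End Lebesgue.

Definition zspan {V : zmodType} s (h : 'I_s -> V) : set V :=
  [set \sum_i h i *~ k i | k in [set: 'I_s -> int]].

(* Main.v *)
(* Some nonzero polynomial in each translation tau_(h_i) kills f, so the
   translates of f by the dense group G generated by the h_i span a
   finite-dimensional space.  Let b be a basis of it made of such translates and
   phi a dual family of test functions, b_i (phi_k) = delta_ik.  The matrix
   A x = (tau_x b_i (phi_j)) is continuous in x and satisfies
   tau_x b = A x *m b for x in G, hence for all x by density; so A is a
   continuous morphism from R^d to matrices.

   Convolution of test functions is commutative, which after exchanging the
   distribution with the integral reads  A(rho) b(psi) = A(psi) b(rho),  where
   A(rho) is the integral of rho A.  If rho is a bump of small support A(rho) is
   invertible, and b(psi) = A(rho)^-1 A(psi) b(rho) shows that b, hence f, is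
   integration against a linear combination of the entries of A.  The identity
   A x *m A(rho) = (rho * A)(x), for rho even, makes A differentiable; along each
   axis A solves A' = B A, and Cayley-Hamilton splits this system into scalar
   equations y' = l y + q whose solutions are exponential polynomials. *)

Require Import Defs.
From mathcomp Require Import all_boot all_order all_algebra.
From mathcomp Require Import all_classical all_reals all_analysis.
From mathcomp Require Import measurable_realfun.
From mathcomp.real_closed Require Import complex.
From mathcomp Require Import ring lra.
Set Implicit Arguments.
Unset Strict Implicit.
Unset Printing Implicit Defensive.
Import Order.TTheory GRing.Theory Num.Theory.
Import numFieldNormedType.Exports.

Local Open Scope classical_set_scope.
Local Open Scope complex_scope.
Local Open Scope ring_scope.

(** * Boxes and the Borel structure of R^d *)

(** The identity [A(rho) b(psi) = A(psi) b(rho)] is exact, so the regularity of [f] requires neither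
    a limit of mollifiers nor a differential equation solved in the sense of distributions. Its
    price is the exchange of a distribution with an integral: a distribution is controlled by
    finitely many derivatives on a compact set, so Riemann sums of translates of a test function
    must converge together with their derivatives. Hence nodes and weights that depend on the mesh
    alone and not on the integrand. Finite dimension comes from running the recurrence given by each
    hypothesis in both directions: all integer multiples of [h_i] reduce to a bounded window, and
    since translations commute the windows of the different [h_i] multiply. Choosing the basis among
    the translates themselves makes its span stable under the group. For the almost-everywhere
    claim, two representing functions are compared on bumps that tend to indicators of boxes, and
    boxes generate the Borel sets. *)

Section Boxes.
Context {R : realType} {d : nat}.
Implicit Types (a b : 'I_d -> R) (x y : 'rV[R]_d).
Local Notation mu := (@lebesgue_rV R d).

Definition obox a b : set 'rV[R]_d := [set x | forall i, a i < x 0 i < b i].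

Lemma oboxE a b : obox a b = [set x | forall i, `]a i, b i[%classic (x 0 i)].
Proof. by apply/seteqP; split=> x /= xab i; have := xab i; rewrite /= in_itv. Qed.

Lemma measurable_rect (A : 'I_d -> set (measurableTypeR R)) :
  (forall i, measurable (A i)) -> measurable [set x : 'rV[R]_d | forall i, A i (x 0 i)].
Proof.
move=> mA; rewrite (_ : [set x | _] =
    \bigcap_(i in [set: 'I_d]) (rV_coord i @^-1` A i)); last first.
  by apply/seteqP; split=> [v Av i _|v Av i]; [exact: Av|exact: (Av i I)].
apply: fin_bigcap_measurable => // i _.
by rewrite -[X in measurable X]setTI; exact: measurable_coord.
Qed.

Lemma measurable_obox a b : measurable (obox a b).
Proof. by rewrite oboxE; apply: (@measurable_rect (fun i => `]a i, b i[%classic)) => i. Qed.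

Lemma lebesgue_obox a b :
  mu (obox a b) = (\prod_i @lebesgue_measure R `]a i, b i[)%E.
Proof. by rewrite oboxE (lebesgue_rV_box (A := fun i => `]a i, b i[%classic)). Qed.

Lemma prode_lty (I : finType) (F : I -> \bar R) :
  (forall i, F i \is a fin_num) -> (\prod_i F i)%E \is a fin_num.
Proof.
by move=> h; elim/big_ind: _ => // x y; exact: fin_numM.
Qed.

Lemma lebesgue_obox_fin a b : mu (obox a b) \is a fin_num.
Proof.
rewrite lebesgue_obox; apply: prode_lty => i.
by rewrite lebesgue_measure_itv/=; case: ifP.
Qed.

Lemma ball_obox x (e : R) : 0 < e ->
  ball x e = obox (fun i => x 0 i - e) (fun i => x 0 i + e).
Proof.
move=> e0; apply/seteqP; split => y.
  move=> [_ xy] i; have := xy 0 i; rewrite -ball_normE/= ltr_norml; lra.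
move=> /= xy; split=> // i j; rewrite ord1 -ball_normE/= ltr_norml.
by have := xy j; lra.
Qed.

Lemma open_obox a b : open (obox a b).
Proof.
rewrite openE => x xab; change (nbhs x [set y : 'rV[R]_d | forall i, a i < y 0 i < b i]).
apply: (@filter_forall _ _ (fun i (y : 'rV[R]_d) => a i < y 0 i < b i) (nbhs x) _) => i.
apply: open_nbhs_nbhs; split; last exact: xab.
rewrite (_ : (fun _ => _) = (fun y : 'rV[R]_d => y 0 i) @^-1` `]a i, b i[%classic); last first.
  by apply/seteqP; split=> y /=; rewrite in_itv.
by apply: open_comp; [move=> y _; exact: coord_continuous|exact: interval_open].
Qed.

(** The sigma-algebra is the product one and is defined without the topology. The two meet here: an
    open set is the union of the boxes with rational corners that it contains, and there are
    countably many of those. *)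
Lemma open_measurable_rV (U : set 'rV[R]_d) : open U -> measurable U.
Proof.
move=> oU.
pose B (qr : 'rV[rat]_d * 'rV[rat]_d) : set 'rV[R]_d :=
  obox (fun i => ratr (qr.1 0 i)) (fun i => ratr (qr.2 0 i)).
pose P := [set qr | B qr `<=` U].
rewrite (_ : U = \bigcup_(qr in P) B qr); last first.
  apply/seteqP; split => [x Ux|x [qr /= Pqr Bx]]; last exact: Pqr.
  have /nbhs_ballP[e /= e0 eU] : nbhs x U by exact: open_nbhs_nbhs.
  have h1 i : exists q : rat, ratr q \in `]x 0 i - e, x 0 i[.
    by apply: rat_in_itvoo; rewrite ltrBlDr ltrDl.
  have h2 i : exists q : rat, ratr q \in `]x 0 i, x 0 i + e[.
    by apply: rat_in_itvoo; rewrite ltrDl.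
  have [f1 f1P] := choice h1; have [f2 f2P] := choice h2.
  exists (\row_i f1 i, \row_i f2 i) => /=.
    move=> y /= By; apply: eU; rewrite ball_obox// => i.
    have := By i; have := f1P i; have := f2P i; rewrite !in_itv/= !mxE; lra.
  by move=> i; have := f1P i; have := f2P i; rewrite !in_itv/= !mxE; lra.
rewrite bigcup_mkcond; apply: countable_bigcupT_measurable => // qr.
by case: ifP => // _; exact: measurable_obox.
Qed.

Lemma continuous_measurable_rV (f : 'rV[R]_d -> R) :
  continuous f -> measurable_fun setT f.
Proof.
move=> /continuousP cf; apply: (measurability _ (RGenOpens.measurableE R)).
move=> _ [_ [x [y ->]] <-]; rewrite setTI; apply: open_measurable_rV.
exact/cf/interval_open.
Qed.

Definition oboxes : set (set 'rV[R]_d) := [set A | exists a b, A = obox a b].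

Lemma oboxI a b a' b' : obox a b `&` obox a' b' =
  obox (fun i => Num.max (a i) (a' i)) (fun i => Num.min (b i) (b' i)).
Proof.
apply/seteqP; split=> [x [xa xb] i|x xab]; last split=> i.
- by rewrite gt_max lt_min; have /andP[-> ->] := xa i; have /andP[-> ->] := xb i.
- by have := xab i; rewrite gt_max lt_min => /andP[/andP[-> _] /andP[-> _]].
- by have := xab i; rewrite gt_max lt_min => /andP[/andP[_ ->] /andP[_ ->]].
Qed.

Lemma oboxes_setI : setI_closed oboxes.
Proof.
by move=> _ _ [a [b ->]] [a' [b' ->]]; rewrite oboxI; eexists; eexists.
Qed.

Definition cube (r : R) : set 'rV[R]_d := obox (fun=> - r) (fun=> r).

Lemma rV_coord_bound x : exists n : nat, forall i, `|x 0 i| < n%:R.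
Proof.
exists (Num.trunc (\sum_i `|x 0 i|)).+1 => i.
apply: (@le_lt_trans _ _ (\sum_i `|x 0 i|)); last exact: truncnS_gt.
by rewrite (bigD1 i)//= lerDl sumr_ge0.
Qed.

Lemma bigcup_cube : \bigcup_n cube n%:R = setT.
Proof.
apply/seteqP; split=> // x _; have [n xn] := rV_coord_bound x.
by exists n => // i; rewrite -ltr_norml.
Qed.

(** Only half-spaces need work: [r < x 0 i] is the union over [n] of boxes bounded below by [r] in
    direction [i] and by [n] or [- n] on all other sides. With [oboxes_setI], boxes become a
    pi-system generating the Borel sets. *)
Lemma measurable_oboxesE : @measurable _ 'rV[R]_d = <<s oboxes >>.
Proof.
apply/seteqP; split; last first.
  apply: smallest_sub; first exact: sigma_algebra_measurable.
  by move=> _ [a [b ->]]; exact: measurable_obox.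
apply: smallest_sub; first exact: smallest_sigma_algebra.
have mc i : measurable_fun (setT : set (g_sigma_algebraType oboxes)) (rV_coord i).
  apply: (measurability _ (RGenOInfty.measurableE R)).
  move=> _ [_ [r ->] <-]; rewrite setTI.
  rewrite (_ : _ @^-1` _ = \bigcup_n
     obox (fun j => if j == i then r else - n%:R) (fun=> n%:R)).
    apply: bigcup_measurable => n _; apply: sub_sigma_algebra.
    by eexists; eexists.
  apply/seteqP; split=> x /=; rewrite /rV_coord in_itv/= andbT; last first.
    by move=> [n _] /(_ i); rewrite eqxx => /andP[].
  move=> rx; have [n xn] := rV_coord_bound x; exists n => // j.
  by have := xn j; rewrite ltr_norml; case: eqVneq => [->|_] // /andP[_ ->]; rewrite rx.
move=> A; rewrite -bigcup_seq => -[i _ [C mC <-]].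
exact: (mc i measurableT C mC).
Qed.

Lemma measure_unique_obox (m1 m2 : {measure set 'rV[R]_d -> \bar R}) :
  (forall a b, m1 (obox a b) = m2 (obox a b)) ->
  (forall n : nat, (m1 (cube n%:R) < +oo)%E) ->
  forall A, measurable A -> m1 A = m2 A.
Proof.
move=> m12 m1oo; apply: (measure_unique oboxes (fun n => cube n%:R)) => //.
- exact: measurable_oboxesE.
- exact: oboxes_setI.
- by move=> i; eexists; eexists.
- exact: bigcup_cube.
- by move=> _ [a [b ->]].
Qed.

Lemma continuous_reflect y : continuous (fun x : 'rV[R]_d => y - x).
Proof. by move=> x; apply: (@cvgB _ _ _ (nbhs x) _ (cst y) id); [exact: cvg_cst|exact: cvg_id]. Qed.

Lemma measurable_reflect y : measurable_fun setT (fun x : 'rV[R]_d => y - x).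
Proof.
move=> _ Y mY; rewrite setTI.
suff: forall Y, <<s oboxes >> Y -> measurable ((fun x : 'rV[R]_d => y - x) @^-1` Y).
  by apply; rewrite -measurable_oboxesE.
apply: smallest_sub.
  split=> [|A mA|F mF]; first by rewrite preimage_set0.
    by rewrite setTD -preimage_setC; apply: measurableC.
  by rewrite preimage_bigcup; apply: bigcup_measurable.
move=> _ [a [b ->]]; apply: open_measurable_rV; apply: open_comp; last exact: open_obox.
by move=> x _; exact: continuous_reflect.
Qed.

(** The preimage of a box is a box with the same side lengths, and [measure_unique_obox] does the
    rest. This is the one change of variables proved for the measure: it yields commutativity of
    convolution directly and, applied twice, invariance under shifts. *)
Lemma lebesgue_reflect y A : measurable A ->
  mu ((fun x : 'rV[R]_d => y - x) @^-1` A) = mu A.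
Proof.
move=> mA.
apply: (@measure_unique_obox (pushforward mu (fun x : 'rV[R]_d => y - x)) mu) => //.
- exact: measurable_reflect.
- move=> Hy a b; transitivity (mu ((fun x : 'rV[R]_d => y - x) @^-1` obox a b)) => //.
  rewrite (_ : _ @^-1` _ = obox (fun i => y 0 i - b i) (fun i => y 0 i - a i)).
    rewrite lebesgue_obox; apply: etrans (esym (lebesgue_obox a b)).
    apply: eq_bigr => i _; rewrite !lebesgue_measure_itv/= !lte_fin.
    have -> : (y 0 i - b i < y 0 i - a i) = (a i < b i) by rewrite ltrD2l ltrN2.
    by case: ifP => // _; rewrite -!EFinB; congr (_%:E); ring.
  by apply/seteqP; split=> x xab i; have := xab i; rewrite /= !mxE; lra.
move=> Hy n; change (mu ((fun x : 'rV[R]_d => (y - x)%R) @^-1` cube n%:R) < +oo)%E.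
rewrite (_ : _ @^-1` _ = obox (fun i => y 0 i - n%:R) (fun i => y 0 i + n%:R)).
  by rewrite ltey_eq lebesgue_obox_fin.
by apply/seteqP; split=> x xab i; have := xab i; rewrite /= !mxE; lra.
Qed.

End Boxes.

(** The modulus as an element of [R], where the epsilon estimates take place; the norm of a complex
    number lies in [R[i]]. *)
Notation cmod := Normc.normc.

(** * Complex-valued functions and their integrals *)

Section ComplexParts.
Context {R : realType}.
Implicit Types (z w : R[i]).

Lemma complex_eta z : z = RE z +i* IM z. Proof. by case: z. Qed.
Lemma Re_add z w : RE (z + w) = RE z + RE w. Proof. by case: z w => [? ?] []. Qed.
Lemma Im_add z w : IM (z + w) = IM z + IM w. Proof. by case: z w => [? ?] []. Qed.
Lemma Re_sub z w : RE (z - w) = RE z - RE w. Proof. by case: z w => [? ?] []. Qed.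
Lemma Im_sub z w : IM (z - w) = IM z - IM w. Proof. by case: z w => [? ?] []. Qed.
Lemma Re_mul z w : RE (z * w) = RE z * RE w - IM z * IM w.
Proof. by case: z w => [? ?] []. Qed.
Lemma Im_mul z w : IM (z * w) = RE z * IM w + IM z * RE w.
Proof. by case: z w => [? ?] []. Qed.
Lemma Re_sum I (r : seq I) (P : pred I) (F : I -> R[i]) :
  RE (\sum_(i <- r | P i) F i) = \sum_(i <- r | P i) RE (F i).
Proof. by rewrite (big_morph (@complex.Re R) Re_add (erefl : RE 0 = 0)). Qed.
Lemma Im_sum I (r : seq I) (P : pred I) (F : I -> R[i]) :
  IM (\sum_(i <- r | P i) F i) = \sum_(i <- r | P i) IM (F i).
Proof. by rewrite (big_morph (@complex.Im R) Im_add (erefl : IM 0 = 0)). Qed.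

Lemma complex_ext z w : RE z = RE w -> IM z = IM w -> z = w.
Proof. by case: z w => [? ?] [? ?] /= -> ->. Qed.

Lemma cmodE z : `|z| = (cmod z)%:C.
Proof. by rewrite normc_def; case: z. Qed.

Lemma cmod_ge0 z : 0 <= cmod z.
Proof. by case: z => a b /=; exact: sqrtr_ge0. Qed.

Lemma cmod0 : cmod (0 : R[i]) = 0. Proof. exact: Normc.normc0. Qed.

Lemma cmodM z w : cmod (z * w) = cmod z * cmod w.
Proof. exact: Normc.normcM. Qed.

Lemma cmodD z w : cmod (z + w) <= cmod z + cmod w.
Proof. exact: (@le_normcD R z w). Qed.

Lemma cmodN z : cmod (- z) = cmod z.
Proof. by case: z => a b /=; rewrite !sqrrN. Qed.

Lemma cmodB z w : cmod (z - w) <= cmod z + cmod w.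
Proof. by rewrite -(cmodN w); exact: cmodD. Qed.

Lemma cmod_distC z w : cmod (z - w) = cmod (w - z).
Proof. by rewrite -cmodN opprB. Qed.

Lemma cmod_real (r : R) : cmod (r%:C) = `|r|.
Proof. by rewrite /= expr0n addr0 sqrtr_sqr. Qed.

Lemma cmod_eq0 z : cmod z = 0 -> z = 0.
Proof. exact: Normc.eq0_normc. Qed.

Lemma cmod_sum I (r : seq I) (P : pred I) (F : I -> R[i]) :
  cmod (\sum_(i <- r | P i) F i) <= \sum_(i <- r | P i) cmod (F i).
Proof.
elim/big_ind2: _ => [|x1 x2 y1 y2 h1 h2|//]; first by rewrite cmod0.
exact: le_trans (cmodD _ _) (lerD h1 h2).
Qed.

Lemma Re_le_cmod z : `|RE z| <= cmod z.
Proof.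
case: z => a b /=; rewrite -sqrtr_sqr ler_sqrt ?addr_ge0 ?sqr_ge0//.
by rewrite lerDl sqr_ge0.
Qed.

Lemma Im_le_cmod z : `|IM z| <= cmod z.
Proof.
case: z => a b /=; rewrite -sqrtr_sqr ler_sqrt ?addr_ge0 ?sqr_ge0//.
by rewrite lerDr sqr_ge0.
Qed.

Lemma cmod_le z : cmod z <= `|RE z| + `|IM z|.
Proof.
case: z => a b /=; have ab : 0 <= `|a| + `|b| by rewrite addr_ge0.
rewrite -[leRHS]ger0_norm// -sqrtr_sqr ler_sqrt ?sqr_ge0//.
rewrite sqrrD -[a ^+ 2]real_normK ?num_real// -[b ^+ 2]real_normK ?num_real//.
by rewrite lerD2r lerDl mulrn_wge0// mulr_ge0.
Qed.

Lemma cmod_small z : (forall e : R, 0 < e -> cmod z <= e) -> z = 0.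
Proof.
move=> h; apply: cmod_eq0; apply/eqP; rewrite eq_le cmod_ge0 andbT.
by apply/ler_addgt0Pr => e e0; rewrite add0r; exact: h.
Qed.

End ComplexParts.

(** * Continuity of complex functions and vanishing outside a cube *)

Section ContinuousComplex.
Context {R : realType} {d : nat}.
Implicit Types (F G : 'rV[R]_d -> R[i]) (f g : 'rV[R]_d -> R).

Definition ccont F := continuous (RE \o F) /\ continuous (IM \o F).

(** A pointwise stand-in for a support contained in a cube: products, sums, shifts and reflections
    respect it up to a change of radius, with no closure to handle. *)
Definition vanish_out (r : R) F := forall x, ~ cube r x -> F x = 0.

Lemma cont_mul f g : continuous f -> continuous g -> continuous (fun x => f x * g x).
Proof. by move=> cf cg x; apply: (@continuousM R _ f g); [exact: cf|exact: cg]. Qed.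

Lemma cont_add f g : continuous f -> continuous g -> continuous (fun x => f x + g x).
Proof. by move=> cf cg x; apply: (@continuousD R _ _ f g); [exact: cf|exact: cg]. Qed.

Lemma cont_sub f g : continuous f -> continuous g -> continuous (fun x => f x - g x).
Proof. by move=> cf cg x; apply: (@continuousB R _ _ f g); [exact: cf|exact: cg]. Qed.

Lemma ccontM F G : ccont F -> ccont G -> ccont (fun x => F x * G x).
Proof.
move=> [rF iF] [rG iG]; split.
  rewrite (_ : _ \o _ = fun x => (RE \o F) x * (RE \o G) x - (IM \o F) x * (IM \o G) x).
    by apply: cont_sub; apply: cont_mul.
  by apply/funext => x /=; rewrite Re_mul.
rewrite (_ : _ \o _ = fun x => (RE \o F) x * (IM \o G) x + (IM \o F) x * (RE \o G) x).
  by apply: cont_add; apply: cont_mul.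
by apply/funext => x /=; rewrite Im_mul.
Qed.

Lemma ccontD F G : ccont F -> ccont G -> ccont (fun x => F x + G x).
Proof.
move=> [rF iF] [rG iG]; split.
  rewrite (_ : _ \o _ = fun x => (RE \o F) x + (RE \o G) x); first exact: cont_add.
  by apply/funext => x /=; rewrite Re_add.
rewrite (_ : _ \o _ = fun x => (IM \o F) x + (IM \o G) x); first exact: cont_add.
by apply/funext => x /=; rewrite Im_add.
Qed.

Lemma ccont_cst (c : R[i]) : ccont (fun=> c).
Proof. by split; exact: cst_continuous. Qed.

Lemma ccontB F G : ccont F -> ccont G -> ccont (fun x => F x - G x).
Proof.
move=> cF cG; rewrite (_ : (fun _ => _) = fun x => F x + (- 1) * G x).
  by apply: ccontD => //; apply: ccontM => //; exact: ccont_cst.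
by apply/funext => x; rewrite mulN1r.
Qed.

Lemma ccont_sum (I : Type) (r : seq I) (Fs : I -> 'rV[R]_d -> R[i]) :
  (forall i, ccont (Fs i)) -> ccont (fun x => \sum_(i <- r) Fs i x).
Proof.
move=> h; elim: r => [|i r IH].
  by under eq_fun do rewrite big_nil; exact: ccont_cst.
by under eq_fun do rewrite big_cons; exact: ccontD.
Qed.

Lemma ccont_comp (h : 'rV[R]_d -> 'rV[R]_d) F : continuous h -> ccont F -> ccont (F \o h).
Proof.
move=> ch [rF iF]; split=> x.
  by apply: (@continuous_comp _ _ _ h (RE \o F)); [exact: ch|exact: rF].
by apply: (@continuous_comp _ _ _ h (IM \o F)); [exact: ch|exact: iF].
Qed.

Lemma ccontP F : ccont F <-> forall x (e : R), 0 < e ->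
  \forall y \near x, cmod (F y - F x) <= e.
Proof.
split=> [[rF iF] x e e0|h].
  have e20 : 0 < e / 2 by lra.
  have /cvgrPdist_le/(_ _ e20) h1 := rF x; have /cvgrPdist_le/(_ _ e20) h2 := iF x.
  near=> y; apply: (le_trans (cmod_le _)); rewrite Re_sub Im_sub.
  have : `|RE (F x) - RE (F y)| <= e / 2 by near: y.
  have : `|IM (F x) - IM (F y)| <= e / 2 by near: y.
  by rewrite distrC [`|RE _ - _|]distrC; lra.
split=> x; apply/(@cvgrPdist_le _ _ _ (nbhs x) _) => e e0; have := h x e e0; apply: filterS => y /=.
  by move=> hy; apply: le_trans hy; rewrite distrC -Re_sub; exact: Re_le_cmod.
by move=> hy; apply: le_trans hy; rewrite distrC -Im_sub; exact: Im_le_cmod.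
Unshelve. all: by end_near. Qed.

Definition ccube (r : R) : set 'rV[R]_d := [set x | forall i, `[- r, r]%classic (x 0 i)].

Lemma compact_ccube r : compact (ccube r).
Proof. by apply: (@rV_compact _ _ (fun=> `[- r, r]%classic)) => i; exact: segment_compact. Qed.

Lemma cube_ccube r : cube r `<=` ccube r.
Proof. by move=> x xr i; rewrite /= in_itv/=; have /andP[/ltW -> /ltW ->] := xr i. Qed.

Lemma compact_cube (K : set 'rV[R]_d) : compact K -> exists2 r, 0 < r & K `<=` cube r.
Proof.
move=> /compact_bounded[M [Mr hM]]; exists (`|M| + 1); first by rewrite ltr_pwDr.
move=> x Kx i; rewrite -ltr_norml.
have : `|x| <= `|M| + 2^-1 by apply: hM => //; have := ler_norm M; lra.
rewrite /Num.Def.normr/= mx_normrE => h.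
apply: (@le_lt_trans _ _ (`|M| + 2^-1)); last by rewrite ltrD2l invf_lt1 ?ltr1n.
by apply: le_trans h; apply: (le_bigmax _ (fun i : 'I_1 * 'I_d => `|x i.1 i.2|) (0, i)).
Qed.

Lemma ccont_bounded F (K : set 'rV[R]_d) : ccont F -> compact K ->
  exists2 M : R, 0 < M & forall x, K x -> cmod (F x) <= M.
Proof.
move=> [rF iF] cK.
have bd f : continuous f -> exists2 M : R, 0 < M & forall x, K x -> `|f x| <= M.
  move=> cf; have /compact_bounded[M [Mr hM]] : compact (f @` K).
    by apply: continuous_compact => //; apply: continuous_subspaceT.
  exists (`|M| + 1); first by rewrite ltr_pwDr.
  move=> x Kx; apply: hM; last by exists x.
  by have := ler_norm M; lra.
have [M1 M10 h1] := bd _ rF; have [M2 M20 h2] := bd _ iF.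
exists (M1 + M2); first by lra.
by move=> x Kx; apply: (le_trans (cmod_le _)); apply: lerD; [exact: h1|exact: h2].
Qed.

Lemma ccont_vanish_bounded r F : ccont F -> vanish_out r F ->
  exists2 M : R, 0 < M & forall x, cmod (F x) <= M.
Proof.
move=> cF vF; have [M M0 hM] := ccont_bounded cF (compact_ccube (r := r)).
exists M => // x; have [xr|xr] := pselect (cube r x); first exact/hM/cube_ccube.
by rewrite vF// cmod0 ltW.
Qed.

(** Heine-Cantor on the compact cube, made global: the estimate obtained there has [x] in the cube
    and [y] anywhere near [x]. By symmetry it is enough that one of the two points lies in the cube,
    and otherwise both values vanish. *)
Lemma ccont_unif r F : ccont F -> vanish_out r F -> forall e : R, 0 < e ->
  exists2 de : R, 0 < de & forall x y, ball x de y -> cmod (F x - F y) <= e.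
Proof.
move=> cF vF e e0.
have /compact_near_coveringP nc := compact_ccube (r := r).
have : \forall de \near 0^'+, ccube r `<=` [set x | forall y, ball x de y -> cmod (F x - F y) <= e].
  apply: (nc R (0^'+) (fun de x => forall y, ball x de y -> cmod (F x - F y) <= e)).
  move=> x _; have e20 : 0 < e / 2 by lra.
  have /nbhs_ballP[eta /= eta0 heta] := (ccontP F).1 cF x (e / 2) e20.
  have eta20 : 0 < eta / 2 by lra.
  near=> x' de => /=.
  have de1 : de <= eta / 2 by near: de; exact: nbhs_right_le.
  move=> y xy.
  have xx' : ball x (eta / 2) x' by near: x'; exact: nbhsx_ballx.
  have h1 : cmod (F x' - F x) <= e / 2.
    by apply: heta; apply: le_ball xx'; lra.
  have h2 : cmod (F y - F x) <= e / 2.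
    apply: heta; rewrite /= (splitr eta); apply: ball_triangle xx' _.
    exact: le_ball xy.
  rewrite (_ : F x' - F y = (F x' - F x) - (F y - F x)); last by ring.
  by apply: (le_trans (cmodB _ _)); lra.
move=> H; have [de de0 hde] : exists2 de : R, 0 < de &
    ccube r `<=` [set x | forall y, ball x de y -> cmod (F x - F y) <= e].
  near (0 : R)^'+ => de; exists de; last by near: de; exact: H.
  by near: de; exact: nbhs_right_gt.
exists de => // x y xy.
have [xr|xr] := pselect (cube r x); first exact: (hde _ (cube_ccube xr)).
have [yr|yr] := pselect (cube r y).
  by rewrite cmod_distC; apply: (hde _ (cube_ccube yr)); exact: ball_sym.
by rewrite !vF// subr0 cmod0 ltW.
Unshelve. all: by end_near. Qed.

End ContinuousComplex.

(** * Linearity, bounds, change of variables and Riemann sums for the complex integral *)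

Section ComplexIntegral.
Context {R : realType} {d : nat}.
Implicit Types (F G : 'rV[R]_d -> R[i]) (f g : 'rV[R]_d -> R).
Local Notation mu := (@lebesgue_rV R d).

Definition Cintegrable F :=
  mu.-integrable setT (EFin \o (RE \o F)) /\ mu.-integrable setT (EFin \o (IM \o F)).

Lemma CintegralD F G : Cintegrable F -> Cintegrable G ->
  Cintegral (fun x => F x + G x) = Cintegral F + Cintegral G.
Proof.
move=> [rF iF] [rG iG]; rewrite /Cintegral; apply: complex_ext => /=.
  by under eq_Rintegral do rewrite Re_add; rewrite RintegralD.
by under eq_Rintegral do rewrite Im_add; rewrite RintegralD.
Qed.

Lemma integrable_lin2 (a b : R) f g : mu.-integrable setT (EFin \o f) ->
  mu.-integrable setT (EFin \o g) ->
  mu.-integrable setT (EFin \o (fun x => a * f x + b * g x)).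
Proof.
move=> hf hg.
rewrite (_ : _ \o _ = ((fun x => a%:E * (f x)%:E) \+ (fun x => b%:E * (g x)%:E))%E); last first.
  by apply/funext => x /=; rewrite EFinD !EFinM.
by apply: integrableD => //; [exact: (integrableZl _ _ hf)|exact: (integrableZl _ _ hg)].
Qed.

Lemma Rintegral_lin2 (a b : R) f g : mu.-integrable setT (EFin \o f) ->
  mu.-integrable setT (EFin \o g) ->
  \int[mu]_x (a * f x + b * g x) = a * (\int[mu]_x f x) + b * (\int[mu]_x g x).
Proof.
move=> hf hg; rewrite RintegralD//; first by rewrite !RintegralZl.
  rewrite (_ : _ \o _ = (fun x => a%:E * (f x)%:E)%E); last by apply/funext => x /=; rewrite EFinM.
  exact: (integrableZl _ _ hf).
rewrite (_ : _ \o _ = (fun x => b%:E * (g x)%:E)%E); last by apply/funext => x /=; rewrite EFinM.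
exact: (integrableZl _ _ hg).
Qed.

Lemma CintegrableD F G : Cintegrable F -> Cintegrable G ->
  Cintegrable (fun x => F x + G x).
Proof.
move=> [rF iF] [rG iG]; split.
  rewrite (_ : RE \o _ = fun x => 1 * (RE \o F) x + 1 * (RE \o G) x).
    exact: integrable_lin2.
  by apply/funext => x; rewrite !mul1r; exact: Re_add.
rewrite (_ : IM \o _ = fun x => 1 * (IM \o F) x + 1 * (IM \o G) x).
  exact: integrable_lin2.
by apply/funext => x; rewrite !mul1r; exact: Im_add.
Qed.

Lemma CintegrableZ (c : R[i]) F : Cintegrable F -> Cintegrable (fun x => c * F x).
Proof.
move=> [rF iF]; split.
  rewrite (_ : RE \o _ = fun x => RE c * (RE \o F) x + (- IM c) * (IM \o F) x).
    exact: integrable_lin2.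
  by apply/funext => x; rewrite mulNr; exact: Re_mul.
rewrite (_ : IM \o _ = fun x => RE c * (IM \o F) x + IM c * (RE \o F) x).
  exact: integrable_lin2.
by apply/funext => x; exact: Im_mul.
Qed.

Lemma CintegralZ (c : R[i]) F : Cintegrable F ->
  Cintegral (fun x => c * F x) = c * Cintegral F.
Proof.
move=> [rF iF]; apply: complex_ext; [rewrite [RHS]Re_mul -mulNr|rewrite [RHS]Im_mul].
  apply: etrans (Rintegral_lin2 _ _ rF iF).
  by apply: eq_Rintegral => x _; rewrite mulNr; exact: Re_mul.
apply: etrans (Rintegral_lin2 _ _ iF rF).
by apply: eq_Rintegral => x _; exact: Im_mul.
Qed.

Lemma CintegrableB F G : Cintegrable F -> Cintegrable G ->
  Cintegrable (fun x => F x - G x).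
Proof.
move=> hF hG; rewrite (_ : (fun _ => _) = fun x => F x + (- 1) * G x).
  by apply: CintegrableD => //; exact: CintegrableZ.
by apply/funext => x; rewrite mulN1r.
Qed.

Lemma CintegralB F G : Cintegrable F -> Cintegrable G ->
  Cintegral (fun x => F x - G x) = Cintegral F - Cintegral G.
Proof.
move=> hF hG; rewrite -mulN1r -CintegralZ// -CintegralD//; last exact: CintegrableZ.
by congr Cintegral; apply/funext => x; rewrite mulN1r.
Qed.

Lemma Cintegral0 : Cintegral (fun _ : 'rV[R]_d => 0) = 0.
Proof. by rewrite /Cintegral; apply: complex_ext => /=; rewrite Rintegral_cst// mul0r. Qed.

Lemma Cintegrable0 : Cintegrable (fun _ => 0).
Proof. by split; exact: (integrable0 mu setT). Qed.

Lemma Cintegrable_sum I (r : seq I) (Fs : I -> 'rV[R]_d -> R[i]) :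
  (forall i, Cintegrable (Fs i)) -> Cintegrable (fun x => \sum_(i <- r) Fs i x).
Proof.
move=> h; elim: r => [|i r IH].
  by under eq_fun do rewrite big_nil; exact: Cintegrable0.
by under eq_fun do rewrite big_cons; exact: CintegrableD.
Qed.

Lemma Cintegral_sum I (r : seq I) (Fs : I -> 'rV[R]_d -> R[i]) :
  (forall i, Cintegrable (Fs i)) ->
  Cintegral (fun x => \sum_(i <- r) Fs i x) = \sum_(i <- r) Cintegral (Fs i).
Proof.
move=> h; elim: r => [|i r IH].
  by under eq_fun do rewrite big_nil; rewrite Cintegral0 big_nil.
under eq_fun do rewrite big_cons; rewrite big_cons CintegralD ?IH//.
exact: Cintegrable_sum.
Qed.

Definition vol (r : R) : R := fine (mu (cube r)).

Lemma vol_ge0 r : 0 <= vol r. Proof. exact/fine_ge0/measure_ge0. Qed.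

Lemma cube_lty r : (mu (cube r) < +oo)%E.
Proof. by rewrite ltey_eq lebesgue_obox_fin. Qed.

Lemma bounded_integrable f (r M : R) : measurable_fun setT f ->
  (forall x, `|f x| <= M) -> (forall x, ~ cube r x -> f x = 0) ->
  mu.-integrable setT (EFin \o f).
Proof.
move=> mf fM f0.
have -> : EFin \o f = (EFin \o f) \_ (cube r).
  apply/funext => x; rewrite patchE; case: ifPn => // /negP xr /=.
  by rewrite f0// => h; apply: xr; rewrite inE.
apply: (integrable_mkcond _ (measurable_obox _ _)).1.
apply: measurable_bounded_integrable; [exact: measurable_obox|exact: cube_lty| |].
  exact: measurable_funTS.
exists M; split; first exact: num_real.
by move=> y My x _; apply: (le_trans (fM x)); exact: ltW.
Qed.

Lemma integrable_cst_fin (A : set 'rV[R]_d) (M : R) : measurable A ->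
  (mu A < +oo)%E -> mu.-integrable A (EFin \o (fun=> M)).
Proof.
move=> mA Aoo; apply: measurable_bounded_integrable => //.
exists `|M|; split; first exact: num_real.
by move=> y My x _ /=; exact: ltW.
Qed.

Lemma Rintegral_bound f (A : set 'rV[R]_d) (M : R) : measurable A ->
  (mu A < +oo)%E -> mu.-integrable A (EFin \o f) -> (forall x, A x -> `|f x| <= M) ->
  `|\int[mu]_(x in A) f x| <= M * fine (mu A).
Proof.
move=> mA Aoo fi fM; apply: (le_trans (le_normr_Rintegral mA fi)).
rewrite -Rintegral_cst//; apply: le_Rintegral => //.
  exact: (integrable_norm fi).
exact: integrable_cst_fin.
Qed.

Lemma Cintegrable_cont r F : ccont F -> vanish_out r F -> Cintegrable F.
Proof.
move=> cF vF; have [M M0 hM] := ccont_vanish_bounded cF vF.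
case: (cF) => rF iF; split.
  apply: (@bounded_integrable _ r M); first exact: continuous_measurable_rV.
    by move=> x; apply: le_trans (hM x); exact: Re_le_cmod.
  by move=> x xr /=; rewrite vF.
apply: (@bounded_integrable _ r M); first exact: continuous_measurable_rV.
  by move=> x; apply: le_trans (hM x); exact: Im_le_cmod.
by move=> x xr /=; rewrite vF.
Qed.

Lemma Rintegral_cube f r : (forall x, ~ cube r x -> f x = 0) ->
  \int[mu]_x f x = \int[mu]_(x in cube r) f x.
Proof.
move=> f0; rewrite [RHS]Rintegral_mkcond; apply: eq_Rintegral => x _.
rewrite patchE; case: ifPn => // /negP xr.
by rewrite f0// => h; apply: xr; rewrite inE.
Qed.

(** The factor 2 comes from bounding the real and the imaginary part separately. *)
Lemma Cintegral_bound F r (M : R) : Cintegrable F -> vanish_out r F ->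
  (forall x, cmod (F x) <= M) -> cmod (Cintegral F) <= 2 * M * vol r.
Proof.
move=> [rF iF] vF FM; apply: (le_trans (cmod_le _)) => /=.
have mc : measurable (cube r : set 'rV[R]_d) by exact: measurable_obox.
have h g : mu.-integrable setT (EFin \o g) -> (forall x, ~ cube r x -> g x = 0) ->
    (forall x, `|g x| <= M) -> `|\int[mu]_x g x| <= M * vol r.
  move=> gi g0 gM; rewrite (Rintegral_cube g0); apply: Rintegral_bound => //.
    exact: cube_lty.
  exact: integrableS gi.
have := h _ rF; have := h _ iF => /=.
have -> : 2 * M * vol r = M * vol r + M * vol r by ring.
move=> h1 h2; apply: lerD.
  apply: h2 => x; first by move=> xr; rewrite vF.
  by apply: le_trans (FM x); exact: Re_le_cmod.
apply: h1 => x; first by move=> xr; rewrite vF.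
by apply: le_trans (FM x); exact: Im_le_cmod.
Qed.

Lemma vanish_out_reflect r F y : vanish_out r F -> vanish_out (r + `|y|) (fun x => F (y - x)).
Proof.
move=> vF x xr; apply: vF => yx; apply: xr => i.
have := yx i; rewrite !mxE.
have : `|y 0 i| <= `|y|.
  rewrite /Num.Def.normr/= mx_normrE.
  by apply: (le_bigmax _ (fun i : 'I_1 * 'I_d => `|y i.1 i.2|) (0, i)).
by rewrite ler_norml; lra.
Qed.

Lemma Cintegral_reflect F r y : ccont F -> vanish_out r F ->
  Cintegral (fun x => F (y - x)) = Cintegral F.
Proof.
move=> cF vF.
have [i1 i2] : Cintegrable (fun x => F (y - x)).
  apply: (@Cintegrable_cont (r + `|y|)); last exact: vanish_out_reflect.
  by apply: ccont_comp (cF); exact: continuous_reflect.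
have h g : measurable_fun setT g ->
    mu.-integrable setT (EFin \o (fun x => g (y - x))) ->
    \int[mu]_x g (y - x) = \int[mu]_x g x.
  move=> mg gi; rewrite /Rintegral; congr fine.
  rewrite -[RHS](@eq_measure_integral _ _ _ setT _ (pushforward mu (fun x : 'rV[R]_d => y - x))).
- exact: measurable_reflect.
- by move=> hr; rewrite integral_pushforward//; exact/measurable_EFinP.
- by move=> hr A mA _; exact: lebesgue_reflect.
case: cF => rF iF; rewrite /Cintegral; congr Complex.
  by apply: (h (RE \o F)) => //; exact: continuous_measurable_rV.
by apply: (h (IM \o F)) => //; exact: continuous_measurable_rV.
Qed.

(** A shift is the composite of the two reflections [x |-> y - x] and [x |-> - x]. *)
Lemma Cintegral_shift F r y : ccont F -> vanish_out r F ->
  Cintegral (fun x => F (x + y)) = Cintegral F.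
Proof.
move=> cF vF; rewrite -(Cintegral_reflect y cF vF).
rewrite -(@Cintegral_reflect (fun x => F (y - x)) (r + `|y|) 0).
- by congr Cintegral; apply/funext => x; rewrite sub0r opprK addrC.
- by apply: ccont_comp cF; exact: continuous_reflect.
- exact: vanish_out_reflect.
Qed.

(* [L] is fixed before [f]: one and the same Riemann sum then approximates all
   the derivatives of a convolution, uniformly in the point of evaluation. *)
Lemma riemann_cells (de : R) (l : seq 'rV[R]_d) (A : set 'rV[R]_d) :
  0 < de -> measurable A -> (mu A < +oo)%E ->
  A `<=` [set x | exists2 c, c \in l & ball c de x] ->
  exists L : seq ('rV[R]_d * R), forall f (e : R), mu.-integrable A (EFin \o f) ->
    (forall x y, ball x de y -> `|f x - f y| <= e) ->
    `|\int[mu]_(x in A) f x - \sum_(p <- L) p.2 * f p.1| <= e * fine (mu A).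
Proof.
move=> de0; elim: l A => [|c l IH] A mA Aoo Al.
  exists [::] => f e fi fe; have -> : A = set0.
    by apply/seteqP; split=> // x /Al[c]; rewrite in_nil.
  by rewrite Rintegral_set0 big_nil measure0 mulr0 subr0 normr0.
have mB : measurable (ball c de) by rewrite ball_obox//; exact: measurable_obox.
have mAB : measurable (A `&` ball c de) by exact: measurableI.
have mAB' : measurable (A `\` ball c de) by exact: measurableD.
have ABoo : (mu (A `&` ball c de) < +oo)%E.
  by apply: le_lt_trans Aoo; apply: le_measure; rewrite ?inE//; exact: subIsetl.
have AB'oo : (mu (A `\` ball c de) < +oo)%E.
  by apply: le_lt_trans Aoo; apply: le_measure; rewrite ?inE//; exact: subDsetl.
have [] := IH (A `\` ball c de) => //.
  by move=> x [/Al[c']]; rewrite in_cons => /predU1P[->//|c'l xc' _]; exists c'.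
(* The part of [A] in the ball around [c] becomes one cell, with node [c] weighted by the measure of
   the cell. The node may lie outside [A], which is harmless because the oscillation bound on [f] is
   global. *)
move=> L hL; exists ((c, fine (mu (A `&` ball c de))) :: L) => f e fi fe.
have fi1 : mu.-integrable (A `&` ball c de) (EFin \o f).
  by apply: integrableS fi => //; exact: subIsetl.
have fi2 : mu.-integrable (A `\` ball c de) (EFin \o f).
  by apply: integrableS fi => //; exact: subDsetl.
have AE : A = (A `&` ball c de) `|` (A `\` ball c de).
  by rewrite setUIDK.
have eA : mu A = (mu (A `&` ball c de) + mu (A `\` ball c de))%E.
  by rewrite addeC -measureDI.
have -> : \int[mu]_(x in A) f x =
    \int[mu]_(x in A `&` ball c de) f x + \int[mu]_(x in A `\` ball c de) f x.
  rewrite {1}AE Rintegral_setU// -?AE//.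
  by apply/disj_setPS => x [[_ h1] [_ h2]].
rewrite eA fineD ?ge0_fin_numE// big_cons mulrDr /=.
have -> (a b u v : R) : a + b - (u + v) = (a - u) + (b - v) by ring.
apply: (le_trans (ler_normD _ _)); apply: lerD; last exact: hL.
rewrite mulrC -(Rintegral_cst mu mAB) -RintegralB//; last exact: integrable_cst_fin.
apply: Rintegral_bound => //.
  rewrite (_ : _ \o _ = ((EFin \o f) \- (EFin \o cst (f c)))%E)//.
  by apply: integrableB => //; exact: integrable_cst_fin.
by move=> x [_ xc]; rewrite distrC; exact: fe.
Qed.

(** The cells are cut out of a finite cover of the compact closed cube by balls of radius [de]. Real
    and imaginary parts share the same list, whence the factor 2. *)
Lemma riemann_sums (r de : R) : 0 < de ->
  exists L : seq ('rV[R]_d * R), forall F (e : R), ccont F -> vanish_out r F ->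
    (forall x y, ball x de y -> cmod (F x - F y) <= e) ->
    cmod (Cintegral F - \sum_(p <- L) (p.2)%:C * F p.1) <= 2 * e * vol r.
Proof.
move=> de0.
have : cover_compact (ccube r : set 'rV[R]_d) by rewrite -compact_cover; exact: compact_ccube.
move=> /(_ 'rV[R]_d setT (fun c => ball c de)) [].
- by move=> c _; rewrite ball_obox//; exact: open_obox.
- by move=> x _; exists x => //; exact: ballxx.
move=> D _ cD.
have [] := @riemann_cells de (finmap.enum_fset D) (cube r) de0.
- exact: measurable_obox.
- exact: cube_lty.
- by move=> x /cube_ccube/cD[c /= cD' xc]; exists c.
move=> L hL; exists L => F e cF vF Fe.
have [ri ii] := Cintegrable_cont cF vF.
have mc : measurable (cube r : set 'rV[R]_d) by exact: measurable_obox.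
have hf f : mu.-integrable setT (EFin \o f) -> (forall x, ~ cube r x -> f x = 0) ->
    (forall x y, ball x de y -> `|f x - f y| <= e) ->
    `|\int[mu]_x f x - \sum_(p <- L) p.2 * f p.1| <= e * vol r.
  move=> fi f0 fe; rewrite (Rintegral_cube f0); apply: hL => //.
  exact: integrableS fi.
apply: (le_trans (cmod_le _)); rewrite Re_sub Im_sub Re_sum Im_sum.
have -> : 2 * e * vol r = e * vol r + e * vol r by ring.
apply: lerD.
  under eq_bigr do rewrite Re_mul mul0r subr0.
  apply: (hf (RE \o F)) => //; first by move=> x xr /=; rewrite vF.
  by move=> x y xy; rewrite -Re_sub; apply: le_trans (Fe x y xy); exact: Re_le_cmod.
under eq_bigr do rewrite Im_mul mul0r addr0.
apply: (hf (IM \o F)) => //; first by move=> x xr /=; rewrite vF.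
by move=> x y xy; rewrite -Im_sub; apply: le_trans (Fe x y xy); exact: Im_le_cmod.
Qed.

End ComplexIntegral.

(** * Partial derivatives and test functions *)

Section RealDerivative.
Context {R : realType} {V : normedModType R}.

(** A division-free form of the derivative: [t = 0] is no exception, and estimates of this shape can
    be restricted to lines, rescaled and combined into complex ones. *)
Lemma is_derive_epsP (f : V -> R) (x v : V) (l : R) : is_derive x v f l <->
  forall e : R, 0 < e -> exists2 de : R, 0 < de &
    forall t, `|t| < de -> `|f (x + t *: v) - f x - t * l| <= e * `|t|.
Proof.
have quot t : t != 0 -> `|l - t^-1 *: ((f \o shift x) (t *: v) - f x)| =
    `|f (x + t *: v) - f x - t * l| / `|t|.
  move=> t0; rewrite -normfV -normrM /= [t *: v + x]addrC -normrN /GRing.scale /=.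
  by congr `|_|; field.
split=> [[dv vl] e e0|h].
  have /cvgrPdist_le/(_ _ e0) : h^-1 *: ((f \o shift x) (h *: v) - f x) @[h --> 0^'] --> l.
    by rewrite -vl; exact: dv.
  rewrite near_withinE => /nbhs_ballP[de /= de0 hde]; exists de => // t tde.
  have [->|t0] := eqVneq t 0; first by rewrite scale0r addr0 subrr mul0r subr0 !normr0 mulr0.
  have := hde t; rewrite -ball_normE /= sub0r normrN => /(_ tde t0).
  by rewrite quot// ler_pdivrMr// normr_gt0.
have cv : h^-1 *: ((f \o shift x) (h *: v) - f x) @[h --> 0^'] --> l.
  apply/cvgrPdist_le => e /h[de de0 hde]; rewrite near_withinE.
  apply/nbhs_ballP; exists de => // t; rewrite -ball_normE /= sub0r normrN => tde t0.
  by rewrite quot// ler_pdivrMr ?normr_gt0//; exact: hde.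
by split; [apply/cvg_ex; exists l|apply: cvg_lim => //].
Qed.

End RealDerivative.

Section RealLine.
Context {R : realType} {V : normedModType R}.

Lemma is_derive_line (f : V -> R) (x v : V) (s : R) l :
  is_derive (x + s *: v) v f l -> is_derive s (1 : R) (fun s => f (x + s *: v)) l.
Proof.
move=> /is_derive_epsP h; apply/is_derive_epsP => e /h[de de0 hde].
exists de => // t /hde; rewrite [t *: 1]mulr1.
by rewrite scalerDl addrA.
Qed.

Lemma mvt_line (f : V -> R) (x v : V) (t : R) :
  (forall s, derivable f (x + s *: v) v) ->
  exists2 th : R, `|th| <= `|t| & f (x + t *: v) - f x = t * 'D_v f (x + th *: v).
Proof.
move=> df.
have dl s : is_derive s (1 : R) (fun s => f (x + s *: v)) ('D_v f (x + s *: v)).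
  by apply: is_derive_line; exact: DeriveDef.
have cl a b : {within `[a, b], continuous (fun s => f (x + s *: v))}.
  by apply: derivable_within_continuous => s _; case: (dl s).
have [t0|t0|->] := ltgtP t 0.
- have [c] := @MVT R _ (fun s => 'D_v f (x + s *: v)) t 0 t0 (fun s _ => dl s) (cl _ _).
  rewrite in_itv/= => /andP[tc c0] /eqP; rewrite scale0r addr0 => /eqP e.
  exists c; first by rewrite (ler0_norm (ltW c0)) (ler0_norm (ltW t0)) lerN2 ltW.
  by rewrite -opprB e; ring.
- have [c] := @MVT R _ (fun s => 'D_v f (x + s *: v)) 0 t t0 (fun s _ => dl s) (cl _ _).
  rewrite in_itv/= => /andP[c0 ct] /eqP; rewrite scale0r addr0 => /eqP e.
  exists c; first by rewrite !gtr0_norm// ltW.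
  by rewrite e; ring.
by exists 0 => //; rewrite scale0r addr0 subrr mul0r.
Qed.

End RealLine.

Section Tests.
Context {R : realType} {d : nat}.
Implicit Types (F G : 'rV[R]_d -> R[i]).
Local Notation e_ := (@basis_vec R d).

Definition cderiv F (i : 'I_d) x (l : R[i]) :=
  forall e : R, 0 < e -> exists2 de : R, 0 < de &
    forall t, `|t| < de -> cmod (F (x + t *: e_ i) - F x - t%:C * l) <= e * `|t|.

Lemma cderivP F i x l : cderiv F i x l <->
  is_derive x (e_ i) (RE \o F) (RE l) /\ is_derive x (e_ i) (IM \o F) (IM l).
Proof.
have reE t : RE (F (x + t *: e_ i) - F x - t%:C * l) =
    (RE \o F) (x + t *: e_ i) - (RE \o F) x - t * RE l.
  by rewrite !Re_sub Re_mul mul0r subr0.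
have imE t : IM (F (x + t *: e_ i) - F x - t%:C * l) =
    (IM \o F) (x + t *: e_ i) - (IM \o F) x - t * IM l.
  by rewrite !Im_sub Im_mul mul0r addr0.
split=> [h|[/is_derive_epsP h1 /is_derive_epsP h2] e e0].
  split; apply/is_derive_epsP => e /h[de de0 hde]; exists de => // t /hde.
    by apply: le_trans; rewrite -reE; exact: Re_le_cmod.
  by apply: le_trans; rewrite -imE; exact: Im_le_cmod.
have e20 : 0 < e / 2 by lra.
have [d1 d10 hd1] := h1 _ e20; have [d2 d20 hd2] := h2 _ e20.
exists (Num.min d1 d2); first by rewrite lt_min d10.
move=> t; rewrite lt_min => /andP[/hd1 + /hd2].
by move=> t1 t2; apply: (le_trans (cmod_le _)); rewrite reE imE; lra.
Qed.

Lemma cderiv_partial F i x l : cderiv F i x l -> partial i F x = l.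
Proof. by move=> /cderivP[[_ h1] [_ h2]]; rewrite /partial h1 h2 -complex_eta. Qed.

Lemma C1_parts F (D : 'I_d -> 'rV[R]_d -> R[i]) :
  ccont F -> (forall i x, cderiv F i x (D i x)) ->
  C1 (RE \o F) /\ C1 (IM \o F) /\ forall i, partial i F = D i.
Proof.
move=> [rF iF] hD; split; [|split].
- by split=> // i x; have /cderivP[[]] := hD i x.
- by split=> // i x; have /cderivP[_ []] := hD i x.
- by move=> i; apply/funext => x; apply: cderiv_partial.
Qed.

Lemma partials_rcons s i F : partials (rcons s i) F = partials s (partial i F).
Proof. by rewrite /partials foldr_rcons. Qed.

Lemma smooth_partial i F : smooth F -> smooth (partial i F).
Proof. by move=> sF s; rewrite -partials_rcons; exact: sF. Qed.

Lemma smooth_ccont F : smooth F -> ccont F.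
Proof. by move=> /(_ [::])[[? _] [? _]]. Qed.

(** The induction peels off the innermost derivative, the last one of the list, because it is
    applied to a member of [S] and gives a member of [S] again. Convolutions and bump functions are
    both shown smooth by exhibiting a class closed under derivation. *)
Lemma smooth_coind (S : set ('rV[R]_d -> R[i])) :
  (forall F, S F -> ccont F) ->
  (forall F i, S F -> exists2 G, S G & forall x, cderiv F i x (G x)) ->
  forall F, S F -> smooth F.
Proof.
move=> Sc Sd F SF s; elim/last_ind: s F SF => [|s i IH] F SF.
  have [D hD] := choice (fun i => ((fun x => let: ex_intro2 G a b := x in
     ex_intro (fun G => S G /\ forall x, cderiv F i x (G x)) G (conj a b)) (Sd F i SF))).
  have [h1 [h2 _]] := C1_parts (Sc F SF) (fun i => (hD i).2).
  by split.
rewrite partials_rcons; have [G SG hG] := Sd F i SF.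
suff -> : partial i F = G by exact: IH.
by apply/funext => x; exact: cderiv_partial.
Qed.

Lemma supp_partial i F : supp (partial i F) `<=` supp F.
Proof.
rewrite [X in _ `<=` X](closure_id _).1; last exact: closed_supp.
apply: closureS => x /=; apply: contraPP => Fx.
have : \forall y \near x, F y = 0.
  have : nbhs x (~` supp F).
    by apply: open_nbhs_nbhs; split=> //; apply: closed_openC; exact: closed_supp.
  apply: filterS => y Fy; apply/eqP; apply: contra_notT Fy => Fy.
  exact: subset_closure.
move=> near0; apply/negP; rewrite negbK /partial.
rewrite (@near_eq_derive _ _ _ _ (cst 0)); last by apply: filterS near0 => y /= ->.
rewrite (@near_eq_derive _ _ _ _ (cst 0) _ (e_ i)); last by apply: filterS near0 => y /= ->.
by rewrite !derive_cst.
Qed.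

Lemma test_partial i F : is_test F -> is_test (partial i F).
Proof.
move=> [sF cF]; split; first exact: smooth_partial.
by apply: (subclosed_compact _ cF); [exact: closed_supp|exact: supp_partial].
Qed.

Lemma test_ccont F : is_test F -> ccont F.
Proof. by move=> [/smooth_ccont]. Qed.

Lemma supp_partials s F : supp (partials s F) `<=` supp F.
Proof. by elim: s => //= i s IH; exact: subset_trans (@supp_partial _ _) IH. Qed.

Lemma test_partials s F : is_test F -> is_test (partials s F).
Proof. by move=> tF; elim: s => //= i s; exact: test_partial. Qed.

Lemma vanish_supp r F : supp F `<=` cube r -> vanish_out r F.
Proof.
move=> Fr x xr; apply/eqP; apply: contra_notT xr => Fx.
by apply: Fr; exact: subset_closure.
Qed.

Lemma test_vanish F : is_test F -> exists2 r : R, 0 < r & forall s, vanish_out r (partials s F).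
Proof.
move=> [_ /compact_cube[r r0 hr]]; exists r => // s; apply: vanish_supp.
by move=> x /supp_partials/hr.
Qed.

Lemma vanish_out_le r r' F : r <= r' -> vanish_out r F -> vanish_out r' F.
Proof.
move=> rr' vF x xr; apply: vF => xr'; apply: xr => i.
by have := xr' i; lra.
Qed.

Lemma supp_vanish r F : vanish_out r F -> supp F `<=` ccube r.
Proof.
move=> vF; have cc : closed (ccube r : set 'rV[R]_d).
  by apply: compact_closed; [exact: norm_hausdorff|exact: compact_ccube].
rewrite [X in _ `<=` X](closure_id _).1//; apply: closureS => x /=.
by apply: contraPP => xr; rewrite vF ?eqxx// => /cube_ccube.
Qed.

Lemma vanish_test r F : smooth F -> vanish_out r F -> is_test F.
Proof.
move=> sF vF; split=> //.
by apply: (subclosed_compact _ (compact_ccube (r := r))); [exact: closed_supp|exact: supp_vanish].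
Qed.

Lemma norm_basis_vec (t : R) i (x : 'rV[R]_d) (de : R) : `|t| < de -> ball x de (x + t *: e_ i).
Proof.
move=> tde; have de0 : 0 < de by apply: le_lt_trans tde.
rewrite ball_obox// => j; rewrite !mxE eqxx /=.
by move: tde; rewrite ltr_norml; case: (j == i) => /=; rewrite ?mulr1 ?mulr0; lra.
Qed.

(** By the mean value theorem the difference quotient is a value of the derivative at a nearby
    point, and uniform continuity of the compactly supported derivative gives one [de] for all [x].
    The real and imaginary parts have different intermediate points, each of which is allowed
    [e / 2]. *)
Lemma unif_diff_quot F i : is_test F -> forall e : R, 0 < e ->
  exists2 de : R, 0 < de & forall t x, `|t| < de ->
    cmod (F (x + t *: e_ i) - F x - t%:C * partial i F x) <= e * `|t|.
Proof.
move=> tF e e0; have [r r0 vr] := test_vanish tF.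
have e20 : 0 < e / 2 by lra.
have [de de0 hde] := ccont_unif (test_ccont (test_partial i tF)) (vr [:: i]) e20.
exists de => // t x tde.
have [[_ dR] [_ dI]] := tF.1 [::].
have [th1 th1t e1] := mvt_line t (fun s => dR i (x + s *: e_ i)).
have [th2 th2t e2] := mvt_line t (fun s => dI i (x + s *: e_ i)).
apply: (le_trans (cmod_le _)).
rewrite !Re_sub !Im_sub Re_mul Im_mul mul0r mul0r subr0 addr0.
move: e1 e2 => /= -> ->; rewrite -!mulrBr !normrM.
have h1 : `|'D_(e_ i) (RE \o F) (x + th1 *: e_ i) - RE (partial i F x)| <= e / 2.
  rewrite distrC -[X in _ - X]/(RE (partial i F (x + th1 *: e_ i))) -Re_sub.
  apply: (le_trans (Re_le_cmod _)); apply: hde; apply: norm_basis_vec.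
  exact: le_lt_trans tde.
have h2 : `|'D_(e_ i) (IM \o F) (x + th2 *: e_ i) - IM (partial i F x)| <= e / 2.
  rewrite distrC -[X in _ - X]/(IM (partial i F (x + th2 *: e_ i))) -Im_sub.
  apply: (le_trans (Im_le_cmod _)); apply: hde; apply: norm_basis_vec.
  exact: le_lt_trans tde.
have t0 : 0 <= `|t| by [].
have -> : e * `|t| = `|t| * (e / 2) + `|t| * (e / 2) by field.
by apply: lerD; apply: ler_wpM2l.
Qed.

End Tests.

(** * Convolution *)

Section Convolution.
Context {R : realType} {d : nat}.
Implicit Types (F G phi psi : 'rV[R]_d -> R[i]).
Local Notation e_ := (@basis_vec R d).

Definition convol phi G x := Cintegral (fun y => phi (x - y) * G y).

Lemma norm_coord (x : 'rV[R]_d) i : `|x 0 i| <= `|x|.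
Proof.
rewrite /Num.Def.normr/= mx_normrE.
by apply: (le_bigmax _ (fun i : 'I_1 * 'I_d => `|x i.1 i.2|) (0, i)).
Qed.

Lemma conv_integrand_ccont phi G x : ccont phi -> ccont G ->
  ccont (fun y => phi (x - y) * G y).
Proof.
move=> cp cG; apply: ccontM => //.
by apply: ccont_comp cp; exact: continuous_reflect.
Qed.

Lemma conv_integrand_vanish r phi G x : vanish_out r phi ->
  vanish_out (r + `|x|) (fun y => phi (x - y) * G y).
Proof. by move=> vp y yr; rewrite (vanish_out_reflect vp yr) mul0r. Qed.

Lemma conv_integrable r phi G x : ccont phi -> vanish_out r phi -> ccont G ->
  Cintegrable (fun y => phi (x - y) * G y).
Proof.
move=> cp vp cG; apply: (@Cintegrable_cont _ _ (r + `|x|)).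
  exact: conv_integrand_ccont.
exact: conv_integrand_vanish.
Qed.

(** [G] is bounded only on the cube that the support of [phi] can reach from [x]: later [G] is an
    entry of the cocycle, which may grow exponentially. *)
Lemma conv_bound r b (eta M : R) phi G x : 0 <= eta -> 0 <= M -> ccont phi -> vanish_out r phi ->
  ccont G -> `|x| <= b -> (forall z, cmod (phi z) <= eta) ->
  (forall y, cube (r + b) y -> cmod (G y) <= M) ->
  cmod (convol phi G x) <= 2 * (eta * M) * @vol R d (r + b).
Proof.
move=> eta0 M0 cp vp cG xb pe GM; have vi : vanish_out (r + b) (fun y => phi (x - y) * G y).
  by apply: vanish_out_le (conv_integrand_vanish (x := x) G vp); rewrite lerD2l.
apply: Cintegral_bound => //; first exact: (conv_integrable x cp vp cG).
move=> y; have [yr|yr] := pselect (cube (r + b) y); last first.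
  by rewrite vi// cmod0 mulr_ge0.
rewrite cmodM; apply: ler_pM => //; first exact: cmod_ge0.
  exact: cmod_ge0.
exact: GM.
Qed.

Lemma ccont_shift h phi : ccont phi -> ccont (shift_fun h phi).
Proof. by apply: ccont_comp => x; exact: continuous_addr. Qed.

Lemma vanish_shift r h phi : vanish_out r phi -> vanish_out (r + `|h|) (shift_fun h phi).
Proof.
move=> vp x xr; apply: vp => xh; apply: xr => i.
have := xh i; rewrite !mxE; have := norm_coord h i.
by rewrite ler_norml; lra.
Qed.

Lemma vanishB r phi psi : vanish_out r phi -> vanish_out r psi ->
  vanish_out r (fun x => phi x - psi x).
Proof. by move=> h1 h2 x xr; rewrite h1// h2// subr0. Qed.

Lemma vanishZ r (c : R[i]) psi : vanish_out r psi -> vanish_out r (fun x => c * psi x).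
Proof. by move=> h x xr; rewrite h// mulr0. Qed.

Lemma ccontZ (c : R[i]) psi : ccont psi -> ccont (fun x => c * psi x).
Proof. by apply: ccontM; exact: ccont_cst. Qed.

Lemma convB r r' phi psi G x : ccont phi -> vanish_out r phi -> ccont psi ->
  vanish_out r' psi -> ccont G ->
  convol (fun z => phi z - psi z) G x = convol phi G x - convol psi G x.
Proof.
move=> cp vp cq vq cG; rewrite /convol -CintegralB.
- by congr Cintegral; apply/funext => y; rewrite mulrBl.
- exact: (conv_integrable x cp vp cG).
- exact: (conv_integrable x cq vq cG).
Qed.

Lemma convZ r (c : R[i]) phi G x : ccont phi -> vanish_out r phi -> ccont G ->
  convol (fun z => c * phi z) G x = c * convol phi G x.
Proof.
move=> cp vp cG; rewrite /convol -CintegralZ; last exact: (conv_integrable x cp vp cG).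
by congr Cintegral; apply/funext => y; rewrite mulrA.
Qed.

Lemma conv_shift h phi G x : convol (shift_fun h phi) G x = convol phi G (x + h).
Proof. by congr Cintegral; apply/funext => y; rewrite /shift_fun addrAC. Qed.

Lemma conv_ccont r phi G : ccont phi -> vanish_out r phi -> ccont G -> ccont (convol phi G).
Proof.
move=> cp vp cG; apply/ccontP => x e e0.
have [M M0 hM] := ccont_bounded cG (compact_ccube (r := r + 1 + `|x|)).
pose v : R := @vol R d (r + 1 + `|x|).
have v0 : 0 <= v by exact: vol_ge0.
(* Chosen so that [conv_bound] returns [e * (v / (v + 1))]; [v + 1] keeps the denominator positive,
   as [v] is only known to be nonnegative. The radius [r + 1] below leaves room for shifts of [phi]
   of length at most 1. *)
pose eta := e / (2 * M * (v + 1)).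
have c0 : 0 < 2 * M * (v + 1) by rewrite !mulr_gt0// ltr_pwDr.
have eta0 : 0 < eta by rewrite divr_gt0.
have [de de0 hde] := ccont_unif cp vp eta0.
near=> x'.
have x'1 : `|x' - x| <= 1.
  have : ball x 1 x' by near: x'; exact: nbhsx_ballx.
  by rewrite -ball_normE /= distrC => /ltW.
have x'd : ball 0 de (x' - x).
  have : ball x de x' by near: x'; exact: nbhsx_ballx.
  by rewrite -!ball_normE /= sub0r normrN distrC.
have -> : convol phi G x' - convol phi G x =
    convol (fun z => shift_fun (x' - x) phi z - phi z) G x.
  rewrite (@convB (r + `|x' - x|) r)//; last 2 first.
  - exact: ccont_shift.
  - exact: vanish_shift.
  by rewrite conv_shift [x + _]addrC subrK.
have h := @conv_bound (r + 1) `|x| eta M (fun z => shift_fun (x' - x) phi z - phi z) G x.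
apply: (le_trans (h _ _ _ _ _ _ _ _)) => //.
- exact: ltW.
- exact: ltW.
- by apply: ccontB => //; exact: ccont_shift.
- apply: vanishB; last by apply: vanish_out_le vp; lra.
  by apply: vanish_out_le (vanish_shift (h := x' - x) vp); rewrite lerD2l.
- move=> z; apply: hde; rewrite /shift_fun -ball_normE /=.
  by move: x'd; rewrite -ball_normE /= sub0r normrN addrAC subrr add0r.
- by move=> y yr; apply: hM; exact: cube_ccube.
rewrite -/v (_ : 2 * (eta * M) * v = e * (v / (v + 1))); last first.
  by rewrite /eta; field; rewrite !gt_eqF// ltr_pwDr.
apply: ler_piMr; first exact: ltW.
by rewrite ler_pdivrMr ?ltr_pwDr// mul1r lerDl.
Unshelve. all: by end_near. Qed.

(** By linearity the first-order error of the convolution is the convolution of the first-order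
    error of [phi], which [unif_diff_quot] makes uniformly small; so continuity of [G] suffices. *)
Lemma conv_cderiv phi G i x : is_test phi -> ccont G ->
  cderiv (convol phi G) i x (convol (partial i phi) G x).
Proof.
move=> tp cG e e0; have [r r0 vr] := test_vanish tp.
have [M M0 hM] := ccont_bounded cG (compact_ccube (r := r + 1 + `|x|)).
pose v : R := @vol R d (r + 1 + `|x|).
have v0 : 0 <= v by exact: vol_ge0.
pose eta := e / (2 * M * (v + 1)).
have c0 : 0 < 2 * M * (v + 1) by rewrite !mulr_gt0// ltr_pwDr.
have eta0 : 0 < eta by rewrite divr_gt0.
have [de de0 hde] := unif_diff_quot i tp eta0.
exists (Num.min de 1); first by rewrite lt_min de0/=.
move=> t; rewrite lt_min => /andP[td t1].
have cp := test_ccont tp; have cdp := test_ccont (test_partial i tp).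
have vp : vanish_out r phi := vr [::].
have vdp : vanish_out r (partial i phi) := vr [:: i].
have te1 : `|t *: e_ i| <= 1.
  have := norm_basis_vec i 0 t1; rewrite -ball_normE /= !add0r normrN.
  exact: ltW.
have cs : ccont (fun z => shift_fun (t *: e_ i) phi z - phi z).
  by apply: ccontB => //; exact: ccont_shift.
have vs : vanish_out (r + 1) (fun z => shift_fun (t *: e_ i) phi z - phi z).
  apply: vanishB; last by apply: vanish_out_le vp; lra.
  by apply: vanish_out_le (vanish_shift (h := t *: e_ i) vp); rewrite lerD2l.
have -> : convol phi G (x + t *: e_ i) - convol phi G x - t%:C * convol (partial i phi) G x =
    convol (fun z => shift_fun (t *: e_ i) phi z - phi z - t%:C * partial i phi z) G x.
  rewrite (@convB (r + 1) r)//; last 2 first.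
  - exact: ccontZ.
  - exact: vanishZ.
  rewrite (@convZ r)//; congr (_ - _).
  rewrite (@convB (r + `|t *: e_ i|) r)//; last 2 first.
  - exact: ccont_shift.
  - exact: vanish_shift.
  by rewrite conv_shift.
have h := @conv_bound (r + 1) `|x| (eta * `|t|) M
  (fun z => shift_fun (t *: e_ i) phi z - phi z - t%:C * partial i phi z) G x.
apply: (le_trans (h _ _ _ _ _ _ _ _)) => //.
- by rewrite mulr_ge0// ltW.
- exact: ltW.
- by apply: ccontB => //; exact: ccontZ.
- apply: vanishB => //; apply: vanishZ.
  by apply: vanish_out_le vdp; lra.
- by move=> z; exact: hde.
- by move=> y yr; apply: hM; exact: cube_ccube.
rewrite -/v (_ : 2 * (eta * `|t| * M) * v = e * `|t| * (v / (v + 1))); last first.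
  by rewrite /eta; field; rewrite !gt_eqF// ltr_pwDr.
apply: ler_piMr; first by rewrite mulr_ge0// ltW.
by rewrite ler_pdivrMr ?ltr_pwDr// mul1r lerDl.
Qed.

(* The derivatives all fall on the left factor, and by [conv_comm] either factor
   may be the left one, so that equality of mixed partials is never needed. *)
Lemma conv_partials s phi G : is_test phi -> ccont G ->
  partials s (convol phi G) = convol (partials s phi) G.
Proof.
move=> tp cG; elim: s => //= i s ->; apply/funext => x.
by apply: cderiv_partial; apply: conv_cderiv => //; exact: test_partials.
Qed.

Lemma conv_smooth phi G : is_test phi -> ccont G -> smooth (convol phi G).
Proof.
move=> tp cG; apply: (@smooth_coind _ _ [set convol psi G | psi in is_test]).
- move=> _ [psi tpsi <-]; have [r _ vr] := test_vanish tpsi.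
  by apply: (conv_ccont (test_ccont tpsi) (vr [::])).
- move=> _ i [psi tpsi <-]; exists (convol (partial i psi) G).
    by exists (partial i psi) => //; exact: test_partial.
  by move=> x; exact: conv_cderiv.
by exists phi.
Qed.

Lemma conv_vanish r r' phi G : vanish_out r phi -> vanish_out r' G ->
  vanish_out (r + r') (convol phi G).
Proof.
move=> vp vG x xr; rewrite /convol -[RHS](@Cintegral0 R d); congr Cintegral.
apply/funext => y; have [yr|yr] := pselect (cube r' y); last by rewrite vG// mulr0.
rewrite vp ?mul0r// => xy; apply: xr => i.
by have := yr i; have := xy i; rewrite !mxE; lra.
Qed.

Lemma conv_test phi G : is_test phi -> is_test G -> is_test (convol phi G).
Proof.
move=> tp tG; have [r _ vr] := test_vanish tp; have [r' _ vr'] := test_vanish tG.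
apply: (@vanish_test _ _ (r + r')); first by apply: conv_smooth => //; exact: test_ccont.
exact: conv_vanish (vr [::]) (vr' [::]).
Qed.

Lemma conv_comm r phi G : ccont phi -> vanish_out r phi -> ccont G -> convol phi G = convol G phi.
Proof.
move=> cp vp cG; apply/funext => x.
rewrite /convol -(@Cintegral_reflect _ _ _ (r + `|x|) x).
- by congr Cintegral; apply/funext => y; rewrite subKr mulrC.
- exact: conv_integrand_ccont.
- exact: conv_integrand_vanish.
Qed.

End Convolution.

(** * Continuity of distributions *)

Section DistributionConvergence.
Context {R : realType} {d : nat}.
Local Notation test := (testfun R d).
Implicit Types (u : distr R d) (phi psi rho : test).

Lemma testP phi : is_test phi. Proof. exact: asboolW (testfun_valP phi). Qed.

Lemma testZD (a : R[i]) phi psi : (a *: phi + psi : test) = lin a phi psi :> ('rV[R]_d -> R[i]).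
Proof. by []. Qed.

Lemma testZ (a : R[i]) phi x : (a *: phi : test) x = a * phi x. Proof. by []. Qed.

Lemma distr_lin u (a : R[i]) phi psi : u (a *: phi + psi) = a * u phi + u psi.
Proof. by have [lu _] := asboolW (distr_valP u); exact: lu. Qed.

Lemma distr0 u : u 0 = 0.
Proof. by have := distr_lin u (-1) 0 0; rewrite scaler0 addr0 mulN1r addNr. Qed.

Lemma distrZ u (a : R[i]) phi : u (a *: phi) = a * u phi.
Proof. by rewrite -[a *: phi]addr0 distr_lin distr0 addr0. Qed.

Lemma distrD u phi psi : u (phi + psi) = u phi + u psi.
Proof. by rewrite -[phi]scale1r distr_lin mul1r scale1r. Qed.

Lemma distrB u phi psi : u (phi - psi) = u phi - u psi.
Proof. by rewrite -scaleN1r addrC distr_lin mulN1r addrC. Qed.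

Lemma distr_sum u I (r : seq I) (phi : I -> test) :
  u (\sum_(i <- r) phi i) = \sum_(i <- r) u (phi i).
Proof. exact: (big_morph u (distrD u) (distr0 u)). Qed.

Lemma test_sum I (r : seq I) (phi : I -> test) x :
  (\sum_(i <- r) phi i : test) x = \sum_(i <- r) phi i x.
Proof.
by elim: r => [|i r IH]; rewrite ?big_nil// !big_cons -IH.
Qed.

Lemma partials_testB s phi psi :
  partials s (phi - psi : test) = fun x => partials s phi x - partials s psi x.
Proof.
rewrite addrC -scaleN1r testZD partials_lin; [|exact: (testP _).1|exact: (testP _).1].
by apply/funext => x; rewrite /lin mulN1r addrC.
Qed.

Lemma partials_test_sum s I (r : seq I) (c : I -> R[i]) (phi : I -> test) x :
  partials s (\sum_(i <- r) c i *: phi i : test) x = \sum_(i <- r) c i * partials s (phi i) x.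
Proof.
elim: r => [|i r IH]; last first.
  rewrite !big_cons -IH testZD partials_lin//; exact: (testP _).1.
rewrite !big_nil.
have -> : (0 : test) = lin (-1) (0 : test) (0 : test) :> ('rV[R]_d -> R[i]).
  by apply/funext => y; rewrite /lin /= mulr0 addr0.
by rewrite partials_lin; [rewrite /lin mulN1r addNr|exact: (testP _).1|exact: (testP _).1].
Qed.

(** A filter is stable under finite intersections, and there are finitely many lists of length at
    most [N] over ['I_d]: they are enumerated as tuples, length by length. *)
Lemma near_seq_forall (T : Type) (F : set_system T) (P : seq 'I_d -> T -> Prop) (N : nat) :
  Filter F -> (forall s, \forall a \near F, P s a) ->
  \forall a \near F, forall s, (size s <= N)%N -> P s a.
Proof.
move=> FF h.
have : \forall a \near F, forall n : 'I_N.+1, forall t : n.-tuple 'I_d, P t a.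
  apply: filter_forall => n; apply: filter_forall => t; exact: h.
apply: filterS => a ha s sN.
exact: (ha (Ordinal (sN : size s < N.+1)%N) (in_tuple s)).
Qed.

(** On one fixed compact cube the bound defining a distribution involves finitely many derivatives,
    so smallness of each of them separately along [F] is enough. *)
Lemma distr_cvg0 u (T : Type) (F : set_system T) (psi : T -> test) (r : R) : Filter F ->
  (\forall a \near F, vanish_out r (psi a)) ->
  (forall s (e : R), 0 < e -> \forall a \near F, forall x, cmod (partials s (psi a) x) <= e) ->
  forall e : R, 0 < e -> \forall a \near F, cmod (u (psi a)) <= e.
Proof.
move=> FF vF small e e0; have [_ bu] := asboolW (distr_valP u).
have [C [N hC]] := bu _ (compact_ccube (r := r)).
(* The constant [C] of the bound carries no sign condition, so a positive majorant takes its place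
   in the division. *)
have C0 : 0 < `|C| + 1 by rewrite ltr_pwDr.
have eC0 : 0 < e / (`|C| + 1) by rewrite divr_gt0.
have := @near_seq_forall T F
  (fun s a => forall x, cmod (partials s (psi a) x) <= e / (`|C| + 1)) N FF
  (fun s => small s _ eC0).
apply: filterS2 vF => a va ha.
have := hC (psi a) (e / (`|C| + 1)) (supp_vanish va).
rewrite cmodE lecR => H; apply: le_trans (H _) _.
  by move=> s x sN; rewrite cmodE lecR; exact: ha.
rewrite mulrCA ler_piMr ?(ltW e0)//.
by rewrite ler_pdivrMr// mul1r; have := ler_norm C; lra.
Qed.

Lemma shift_testE h phi x : shift_test h phi x = phi (x + h). Proof. by []. Qed.

Lemma translateE h u phi : translate h u phi = u (shift_test (- h) phi). Proof. by []. Qed.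

(** For [y] within 1 of [x] the shifted test functions all live in one cube, and their derivatives
    converge uniformly because every derivative of [phi] is uniformly continuous. *)
Lemma translate_ccont u phi : ccont (fun x => u (shift_test (- x) phi)).
Proof.
apply/ccontP => x e e0.
suff: \forall y \near x, cmod (u (shift_test (- y) phi - shift_test (- x) phi)) <= e.
  by apply: filterS => y; rewrite distrB.
have [r r0 vr] := test_vanish (testP phi).
apply: (@distr_cvg0 u _ (nbhs x) _ (r + 1 + `|x|)) => //.
  near=> y; have yx : `|- y| <= 1 + `|x|.
    rewrite normrN -[y](subrK x); apply: le_trans (ler_normD _ _) _; rewrite lerD2r.
    have : ball x 1 y by near: y; exact: nbhsx_ballx.
    by rewrite -ball_normE /= distrC => /ltW.
  apply: vanishB.
    apply: vanish_out_le (vanish_shift (h := - y) (vr [::])).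
    by rewrite -addrA lerD2l.
  apply: vanish_out_le (vanish_shift (h := - x) (vr [::])).
  by rewrite normrN -addrA lerD2l lerDr.
move=> s eta eta0.
have [de de0 hde] := ccont_unif (test_ccont (test_partials s (testP phi))) (vr s) eta0.
near=> y => z; rewrite partials_testB !partials_shift; apply: hde.
have : ball x de y by near: y; exact: nbhsx_ballx.
rewrite -!ball_normE /shift_fun /=; congr (_ < _).
by congr `|_|; rewrite opprB [RHS]addrC addrA subrK.
Unshelve. all: by end_near. Qed.

Definition conv_testfun phi rho : test := TestFun (asboolT (conv_test (testP phi) (testP rho))).

Lemma conv_testfunE phi rho : conv_testfun phi rho = @convol R d phi rho :> ('rV[R]_d -> R[i]).
Proof. by []. Qed.

Lemma conv_testfunC phi rho : conv_testfun phi rho = conv_testfun rho phi.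
Proof.
apply: val_inj => /=; have [r _ vr] := test_vanish (testP phi).
exact: conv_comm (test_ccont (testP _)) (vr [::]) (test_ccont (testP _)).
Qed.

(** A Riemann sum of the integrand is [u] applied to a finite combination of translates of [phi].
    With the same nodes, these combinations converge to the convolution uniformly with each
    derivative, since the derivatives fall on [phi]. Both sides are thus limits of [u (psi de)] as
    [de] tends to 0 from the right. *)
Lemma distr_conv u phi rho :
  Cintegral (fun x => u (shift_test (- x) phi) * rho x) = u (conv_testfun phi rho).
Proof.
have [r1 r10 vr1] := test_vanish (testP phi).
have [r2 r20 vr2] := test_vanish (testP rho).
have vr10 : vanish_out r1 phi := vr1 [::].
have vr20 : vanish_out r2 rho := vr2 [::].
pose F x := u (shift_test (- x) phi) * rho x.
have cF : ccont F.
  by apply: ccontM; [exact: translate_ccont|exact/test_ccont/testP].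
have vF : vanish_out r2 F by move=> x xr; rewrite /F vr20// mulr0.
(* One list of nodes for each mesh [de], fixed before any integrand; the empty list is a filler for
   [de <= 0]. *)
have [L hL] := choice (fun de : R => match pselect (0 < de) with
  | left p => let: ex_intro l h := @riemann_sums R d r2 de p in
     ex_intro (fun l => 0 < de -> forall F (e : R), ccont F -> vanish_out r2 F ->
    (forall x y, ball x de y -> cmod (F x - F y) <= e) ->
    cmod (Cintegral F - \sum_(p <- l) (p.2)%:C * F p.1) <= 2 * e * vol r2) l (fun _ => h)
  | right p => ex_intro _ [::] (fun q => False_ind _ (p q)) end).
pose psi de : test := \sum_(p <- L de) ((p.2)%:C * rho p.1) *: shift_test (- p.1) phi.
pose v : R := @vol R d r2; have v0 : 0 <= v by exact: vol_ge0.
have v1 : 0 < 2 * (v + 1) by lra.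
have riem (e : R) : 0 < e -> exists2 eta : R, 0 < eta & 2 * eta * v <= e.
  move=> e0; exists (e / (2 * (v + 1))); first by rewrite divr_gt0.
  rewrite (_ : 2 * _ * _ = e * (v / (v + 1))); last by field; rewrite gt_eqF//; lra.
  apply: ler_piMr; first exact: ltW.
  by rewrite ler_pdivrMr ?mul1r; lra.
have upsi de : u (psi de) = \sum_(p <- L de) (p.2)%:C * F p.1.
  rewrite distr_sum; apply: eq_bigr => p _.
  by rewrite distrZ /F -mulrA [rho _ * _]mulrC.
apply/eqP; rewrite -subr_eq0; apply/eqP; apply: cmod_small => e e0.
have e20 : 0 < e / 2 by lra.
have h1 : \forall de \near 0^'+, cmod (Cintegral F - u (psi de)) <= e / 2.
  have [eta eta0 etae] := riem _ e20.
  have [de0 de00 hde0] := ccont_unif cF vF eta0.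
  near=> de; have de_gt0 : 0 < de by near: de; exact: nbhs_right_gt.
  have dele : de <= de0 by near: de; exact: nbhs_right_le.
  rewrite upsi; apply: le_trans etae; apply: hL => // x y xy.
  exact/hde0/(le_ball dele).
have h2 : \forall de \near 0^'+, cmod (u (psi de - conv_testfun phi rho)) <= e / 2.
  apply: (@distr_cvg0 u _ _ _ (r1 + r2)) => //.
    near=> de; apply: vanishB; last exact: conv_vanish vr10 vr20.
    move=> x xr; rewrite [LHS](_ : _ = testfun_val (psi de) x)//.
    rewrite /psi test_sum big1// => p _; rewrite testZ shift_testE.
    have [pr|pr] := pselect (cube r2 p.1); last by rewrite vr20// mulr0 mul0r.
    rewrite vr10 ?mulr0// => xp; apply: xr => i.
    by have := pr i; have := xp i; rewrite !mxE; lra.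
  move=> s a a0; have [eta eta0 etae] := riem _ a0.
  have tps := test_partials s (testP phi).
  have [M1 M10 hM1] := ccont_vanish_bounded (test_ccont tps) (vr1 s).
  have [M2 M20 hM2] := ccont_vanish_bounded (test_ccont (testP rho)) vr20.
  have M12 : 0 < M1 + M2 by lra.
  (* If each factor, bounded by [M1] and [M2] respectively, oscillates by at most [eta / (M1 + M2)],
     then the product oscillates by at most [eta]. *)
  have eM : 0 < eta / (M1 + M2) by rewrite divr_gt0.
  have [d1 d10 hd1] := ccont_unif (test_ccont tps) (vr1 s) eM.
  have [d2 d20 hd2] := ccont_unif (test_ccont (testP rho)) vr20 eM.
  near=> de => x; rewrite partials_testB.
  have de_gt0 : 0 < de by near: de; exact: nbhs_right_gt.
  have dele1 : de <= d1 by near: de; exact: nbhs_right_le.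
  have dele2 : de <= d2 by near: de; exact: nbhs_right_le.
  rewrite conv_testfunE conv_partials; [|exact: testP|exact/test_ccont/testP].
  rewrite partials_test_sum cmod_distC; apply: le_trans etae.
  under eq_bigr do rewrite partials_shift -mulrA [rho _ * _]mulrC.
  apply: (hL de de_gt0 (fun y => partials s phi (x - y) * rho y)).
  - exact: conv_integrand_ccont (test_ccont tps) (test_ccont (testP rho)).
  - by move=> y yr; rewrite vr20// mulr0.
  move=> y z yz.
  rewrite (_ : _ - _ = (partials s phi (x - y) - partials s phi (x - z)) * rho y +
     partials s phi (x - z) * (rho y - rho z)); last by ring.
  apply: le_trans (cmodD _ _) _; rewrite !cmodM.
  rewrite (_ : eta = eta / (M1 + M2) * M2 + M1 * (eta / (M1 + M2))); last first.
    by field; rewrite gt_eqF.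
  apply: lerD; apply: ler_pM; rewrite ?cmod_ge0//.
    apply: hd1; apply: le_ball dele1 _ _.
    move: yz; rewrite -!ball_normE /= [x - y - _](_ : _ = - (y - z)) ?normrN//.
    by rewrite !opprB addrC addrA subrK.
  by apply: hd2; apply: le_ball dele2 _ _.
near (0 : R)^'+ => de.
have k1 : cmod (Cintegral F - u (psi de)) <= e / 2 by near: de.
have k2 : cmod (u (psi de - conv_testfun phi rho)) <= e / 2 by near: de.
rewrite -/F -(subrKA (u (psi de))) -distrB.
by apply: le_trans (cmodD _ _) _; lra.
Unshelve. all: by end_near. Qed.

End DistributionConvergence.

(** * Bump functions *)

Section ComplexDerivativeRules.
Context {R : realType} {d : nat}.
Implicit Types (F G : 'rV[R]_d -> R[i]).
Local Notation e_ := (@basis_vec R d).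

Lemma cderiv_cst (c : R[i]) i (x : 'rV[R]_d) : cderiv (fun _ : 'rV[R]_d => c) i x 0.
Proof.
move=> e e0; exists 1 => // t _.
by rewrite subrr mulr0 subr0 cmod0 mulr_ge0// ltW.
Qed.

Lemma cderivD F G i x l k : cderiv F i x l -> cderiv G i x k ->
  cderiv (fun x => F x + G x) i x (l + k).
Proof.
move=> hF hG e e0; have e20 : 0 < e / 2 by lra.
have [d1 d10 h1] := hF _ e20; have [d2 d20 h2] := hG _ e20.
exists (Num.min d1 d2); first by rewrite lt_min d10.
move=> t; rewrite lt_min => /andP[/h1 t1 /h2 t2].
have -> : F (x + t *: e_ i) + G (x + t *: e_ i) - (F x + G x) - t%:C * (l + k) =
  (F (x + t *: e_ i) - F x - t%:C * l) + (G (x + t *: e_ i) - G x - t%:C * k) by ring.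
by apply: le_trans (cmodD _ _) _; lra.
Qed.

Lemma cderivM F G i x l k : cderiv F i x l -> cderiv G i x k ->
  cderiv (fun x => F x * G x) i x (F x * k + l * G x).
Proof.
move=> /cderivP[rF iF] /cderivP[rG iG]; apply/cderivP; split.
  rewrite (_ : RE \o _ = (RE \o F) * (RE \o G) - (IM \o F) * (IM \o G)); last first.
    by apply/funext => y; exact: Re_mul.
  apply: is_derive_eq.
    rewrite Re_add !Re_mul /GRing.scale /=.
  by move: (RE (F x)) (RE (G x)) (IM (F x)) (IM (G x)) => a b a' b'; ring.
rewrite (_ : IM \o _ = (RE \o F) * (IM \o G) + (IM \o F) * (RE \o G)); last first.
  by apply/funext => y; exact: Im_mul.
apply: is_derive_eq.
rewrite Im_add !Im_mul /GRing.scale /=.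
by move: (RE (F x)) (RE (G x)) (IM (F x)) (IM (G x)) => a b a' b'; ring.
Qed.

Lemma cderiv_sum I (r : seq I) (Fs : I -> 'rV[R]_d -> R[i]) (ls : I -> R[i]) i x :
  (forall k, cderiv (Fs k) i x (ls k)) ->
  cderiv (fun x => \sum_(k <- r) Fs k x) i x (\sum_(k <- r) ls k).
Proof.
move=> h; elim: r => [|k r IH].
  rewrite big_nil (_ : (fun _ => _) = (fun=> 0)); first exact: cderiv_cst.
  by apply/funext => y; rewrite big_nil.
rewrite big_cons (_ : (fun _ => _) = (fun y => Fs k y + \sum_(k <- r) Fs k y)).
  exact: cderivD.
by apply/funext => y; rewrite big_cons.
Qed.

Lemma cderiv_real (f : 'rV[R]_d -> R) i x (l : R) : is_derive x (e_ i) f l ->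
  cderiv (fun x => (f x)%:C) i x l%:C.
Proof.
move=> h; apply/cderivP; split; first exact: h.
exact: (is_derive_cst (0 : R) x (e_ i)).
Qed.

Lemma is_derive_coord (f : R -> R) (a b : R) (j i : 'I_d) (x : 'rV[R]_d) (l : R) :
  is_derive (a * x 0 j + b) 1 f l ->
  is_derive x (e_ i) (fun x : 'rV[R]_d => f (a * x 0 j + b)) (a * (j == i)%:R * l).
Proof.
move=> /is_derive_epsP h; apply/is_derive_epsP => e e0.
have a0 : 0 < `|a| + 1 by rewrite ltr_pwDr.
have ea0 : 0 < e / (`|a| + 1) by rewrite divr_gt0.
have [de de0 hde] := h _ ea0.
exists (de / (`|a| + 1)); first by rewrite divr_gt0.
move=> t; rewrite ltr_pdivlMr// => tde.
pose c : R := a * (j == i)%:R.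
have ca : `|c| <= `|a|.
  by rewrite /c normrM; case: (j == i); rewrite ?normr1 ?normr0 ?mulr1 ?mulr0.
have st : `|t * c| <= `|t| * (`|a| + 1).
  by rewrite normrM ler_wpM2l//; lra.
have := hde (t * c) (le_lt_trans st tde).
rewrite -/c !mxE eqxx /= [_ *: 1]mulr1.
have -> : a * (x 0 j + t * (j == i)%:R) + b = a * x 0 j + b + t * c by rewrite /c; ring.
rewrite -[t * c * l]mulrA => H; apply: le_trans H _.
rewrite mulrAC ler_pdivrMr// -mulrA; apply: ler_wpM2l; first exact: ltW.
exact: st.
Qed.

Inductive fun_alg (S : set ('rV[R]_d -> R[i])) : ('rV[R]_d -> R[i]) -> Prop :=
| fun_alg_gen F : S F -> fun_alg S F
| fun_alg_cst c : fun_alg S (fun=> c)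
| fun_algD F G : fun_alg S F -> fun_alg S G -> fun_alg S (fun x => F x + G x)
| fun_algM F G : fun_alg S F -> fun_alg S G -> fun_alg S (fun x => F x * G x).

(** By the Leibniz rule the algebra generated by [S] is closed under derivation as soon as the
    derivatives of the generators belong to it, and [smooth_coind] applies to it. *)
Lemma fun_alg_smooth (S : set ('rV[R]_d -> R[i])) :
  (forall F, S F -> ccont F) ->
  (forall F i, S F -> exists2 G, fun_alg S G & forall x, cderiv F i x (G x)) ->
  forall F, fun_alg S F -> smooth F.
Proof.
move=> Sc Sd; apply: smooth_coind.
  move=> F; elim => {F} [F|c|F G _ cF _ cG|F G _ cF _ cG].
  - exact: Sc.
  - exact: ccont_cst.
  - exact: ccontD.
  - exact: ccontM.
move=> F i; elim => {F} [F|c|F G _ [F' aF dF] _ [G' aG dG]|F G AF [F' aF dF] AG [G' aG dG]].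
- exact: Sd.
- by exists (fun=> 0); [exact: fun_alg_cst|move=> x; exact: cderiv_cst].
- by exists (fun x => F' x + G' x); [exact: fun_algD|move=> x; exact: cderivD].
- exists (fun x => F x * G' x + F' x * G x); last by move=> x; exact: cderivM.
  by apply: fun_algD; apply: fun_algM.
Qed.

Lemma fun_alg_prod (S : set ('rV[R]_d -> R[i])) I (r : seq I) (Fs : I -> 'rV[R]_d -> R[i]) :
  (forall i, fun_alg S (Fs i)) -> fun_alg S (fun x => \prod_(i <- r) Fs i x).
Proof.
move=> h; elim: r => [|i r IH].
  by under eq_fun do rewrite big_nil; exact: fun_alg_cst.
by under eq_fun do rewrite big_cons; exact: fun_algM.
Qed.

End ComplexDerivativeRules.

(** * The flat function [exp(-1/x)] and its derivatives *)

Section FlatFunction.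
Context {R : realType}.
Implicit Types (P : {poly R}) (x : R).

(** A polynomial factor in [1/x] is carried along so that the family is closed under derivation: [P]
    becomes [X^2 (P - P')]. *)
Definition flat P x : R := if 0 < x then P.[x^-1] * expR (- x^-1) else 0.

Lemma flat_le0 P x : x <= 0 -> flat P x = 0.
Proof. by rewrite leNgt /flat => /negbTE ->. Qed.

Lemma flat_gt0 P x : 0 < x -> flat P x = P.[x^-1] * expR (- x^-1).
Proof. by rewrite /flat => ->. Qed.

Lemma poly_growth P : exists2 C : R, 0 <= C &
  forall y, 1 <= y -> `|P.[y]| <= C * y ^+ size P.
Proof.
exists (\sum_(i < size P) `|P`_i|); first exact: sumr_ge0.
move=> y y1; have y0 : 0 <= y by lra.
rewrite horner_coef; apply: le_trans (ler_norm_sum _ _ _) _.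
rewrite mulr_suml; apply: ler_sum => i _.
rewrite normrM ler_wpM2l// ger0_norm ?exprn_ge0//.
by apply: ler_weXn2l => //; exact/ltnW/ltn_ord.
Qed.

(** [expR y] is the [k.+1]-th power of [expR (y / k.+1%:R)], which is at least [1 + y / k.+1%:R]. *)
Lemma expR_growth (k : nat) (y : R) : 0 <= y -> (y / k.+1%:R) ^+ k.+1 <= expR y.
Proof.
move=> y0; have k0 : (0 : R) < k.+1%:R by [].
rewrite -[leRHS](_ : expR (y / k.+1%:R) ^+ k.+1 = _); last first.
  by rewrite -expRM_natr; congr expR; field; rewrite gt_eqF.
apply: lerXn2r; rewrite ?nnegrE ?divr_ge0 ?expR_ge0//.
by apply: le_trans (expR_ge1Dx _); rewrite lerDr.
Qed.

(** The exponential contributes the power [k.+1 = size P + 2] of [x]; [size P] of it absorbs the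
    polynomial in [1/x]. The square that remains forces the derivative at the origin to be 0 in
    [is_derive_flat]. *)
Lemma flat_small P : exists2 C : R, 0 < C & forall x, 0 < x <= 1 -> `|flat P x| <= C * x ^+ 2.
Proof.
have [C C0 hC] := poly_growth P; pose k := (size P).+1.
exists ((C + 1) * k.+1%:R ^+ k.+1); first by rewrite mulr_gt0// ?exprn_gt0// ltr_pwDr.
move=> x /andP[x0 x1]; rewrite flat_gt0// normrM (ger0_norm (expR_ge0 _)).
have y1 : 1 <= x^-1 by rewrite invf_ge1.
have y0 : 0 < x^-1 by rewrite invr_gt0.
have E : expR (- x^-1) <= k.+1%:R ^+ k.+1 * x ^+ k.+1.
  rewrite expRN -exprMn -[leRHS]invrK lef_pV2 ?posrE ?expR_gt0//; last first.
    by rewrite invr_gt0 exprn_gt0// mulr_gt0.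
  have -> : ((k.+1%:R * x) ^+ k.+1)^-1 = (x^-1 / k.+1%:R) ^+ k.+1.
    by rewrite -exprVn invfM mulrC.
  exact/expR_growth/ltW.
apply: (@le_trans _ _ (((C + 1) * x^-1 ^+ size P) * (k.+1%:R ^+ k.+1 * x ^+ k.+1))).
  apply: ler_pM; rewrite ?expR_ge0//.
  apply: le_trans (hC _ y1) _; apply: ler_wpM2r; last by lra.
  by rewrite exprn_ge0// ltW.
have -> : x ^+ 2 = x^-1 ^+ size P * x ^+ k.+1.
  have -> : k.+1 = (size P + 2)%N by rewrite addn2.
  by rewrite exprD mulrA -exprMn mulVf ?gt_eqF// expr1n mul1r.
by move: (k.+1%:R ^+ _) => K; rewrite le_eqVlt mulrACA eqxx.
Qed.

Lemma is_derive_flat P x :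
  is_derive x 1 (flat P) (flat ('X^2 * (P - P^`())) x).
Proof.
have [x0|x0|->] := ltgtP x 0.
- rewrite [flat _ x]flat_le0 ?ltW//.
  apply: (@near_eq_is_derive _ _ _ (cst 0)).
  by near=> y; rewrite flat_le0// ltW//; near: y; exact: lt_nbhsl.
- have xn0 : x != 0 by rewrite gt_eqF.
  apply: (@near_eq_is_derive _ _ _
    ((horner P \o (fun y : R => y^-1)) * (expR \o (fun y : R => - y^-1)))).
    by near=> y; rewrite flat_gt0//; near: y; exact: lt_nbhsr.
  have dV : is_derive x (1 : R) (fun y : R => y^-1) (- x ^- 2).
    by apply: is_derive_eq; [exact: (@is_deriveV _ id)|rewrite /GRing.scale /= mulr1].
  have dP : is_derive x^-1 (1 : R) (horner P) P^`().[x^-1].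
    by apply: DeriveDef; [exact: derivable_horner|rewrite -derive1E -derivE].
  have d1 := is_derive1_comp dP dV.
  have d2 : is_derive x (1 : R) (expR \o (fun y : R => - y^-1)) (expR (- x^-1) * (x ^- 2)).
    apply: is_derive1_comp; rewrite -[x ^- 2]opprK; exact: is_deriveN.
  apply: is_derive_eq.
  rewrite flat_gt0// hornerM hornerXn hornerD hornerN /GRing.scale /= exprVn.
  by ring.
rewrite [flat _ 0]flat_le0//; apply/is_derive_epsP => e e0.
have [C C0 hC] := flat_small P.
exists (Num.min 1 (e / C)); first by rewrite lt_min divr_gt0// ltr01.
move=> t; rewrite lt_min => /andP[t1 te].
rewrite add0r [t *: 1]mulr1 mulr0 subr0 [flat P 0]flat_le0// subr0.
have [tn|tp] := leP t 0; first by rewrite flat_le0// normr0 mulr_ge0// ltW.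
rewrite (gtr0_norm tp) in t1 te *.
apply: le_trans (hC t _) _; first by rewrite tp ltW.
rewrite expr2 mulrA ler_wpM2r ?ltW// mulrC.
by move: te; rewrite ltr_pdivlMr// => /ltW.
Unshelve. all: by end_near. Qed.

End FlatFunction.

(** * Bump functions on boxes, and how they separate locally integrable functions *)

Section Bumps.
Context {R : realType} {d : nat}.
Implicit Types (a b : 'I_d -> R) (n : nat).
Local Notation mu := (@lebesgue_rV R d).

Definition flat_coords : set ('rV[R]_d -> R[i]) :=
  [set F | exists (P : {poly R}) (c e : R) (j : 'I_d),
     F = fun x : 'rV[R]_d => (flat P (c * x 0 j + e))%:C].

Lemma flat_coords_smooth F : fun_alg flat_coords F -> smooth F.
Proof.
apply: fun_alg_smooth.
  move=> _ [P [c [e [j ->]]]]; split; last exact: cst_continuous.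
  move=> x; apply: (@continuous_comp _ _ _ (fun x : 'rV[R]_d => c * x 0 j + e) (flat P)).
    apply: (@cont_add _ _ (fun y : 'rV[R]_d => c * y 0 j) (fun=> e)); last exact: cst_continuous.
    apply: (@cont_mul _ _ (fun=> c) (fun y : 'rV[R]_d => y 0 j)); first exact: cst_continuous.
    exact: coord_continuous.
  apply/differentiable_continuous/derivable1_diffP.
  by have [] := is_derive_flat P (c * x 0 j + e).
move=> _ i [P [c [e [j ->]]]].
exists (fun x : 'rV[R]_d => (c * (j == i)%:R)%:C * (flat ('X^2 * (P - P^`())) (c * x 0 j + e))%:C).
  apply: fun_algM; first exact: fun_alg_cst.
  by apply: fun_alg_gen; eexists; eexists; eexists; eexists.
move=> x; rewrite -rmorphM /=; apply: cderiv_real.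
exact/is_derive_coord/is_derive_flat.
Qed.

(** The scaling by [n] replaces [exp(-1/t)] by [exp(-1/(n t))], so that inside the box the bump
    tends to 1 as [n] grows, while it stays zero outside. *)
Definition box_bump a b n (x : 'rV[R]_d) : R :=
  \prod_i (flat 1 (n%:R * (x 0 i - a i)) * flat 1 (n%:R * (b i - x 0 i))).

Lemma flat1_ge0 (x : R) : 0 <= flat 1 x.
Proof. by rewrite /flat; case: ifP => // _; rewrite hornerC mul1r expR_ge0. Qed.

Lemma flat1_le1 (x : R) : flat 1 x <= 1.
Proof.
rewrite /flat; case: ifP => // x0; rewrite hornerC mul1r -expR0 ler_expR.
by rewrite oppr_le0 invr_ge0 ltW.
Qed.

Lemma bump_ge0 a b n x : 0 <= box_bump a b n x.
Proof. by apply: prodr_ge0 => i _; rewrite mulr_ge0 ?flat1_ge0. Qed.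

Lemma bump_le1 a b n x : box_bump a b n x <= 1.
Proof.
apply: (le_trans (ler_prod _ (E2 := fun=> 1) _)); last by rewrite big1.
by move=> i _; rewrite mulr_ge0 ?flat1_ge0// mulr_ile1 ?flat1_ge0 ?flat1_le1.
Qed.

Lemma bump_out a b n x : ~ obox a b x -> box_bump a b n x = 0.
Proof.
move=> /existsNP[i /negP]; rewrite negb_and -!leNgt => ab.
rewrite /box_bump (bigD1 i)//=; apply/eqP; rewrite mulf_eq0; apply/orP; left; apply/eqP.
case/orP: ab => h; [rewrite [X in X * _]flat_le0 ?mul0r//|rewrite [X in _ * X]flat_le0 ?mulr0//].
  by rewrite mulr_ge0_le0// subr_le0.
by rewrite mulr_ge0_le0// subr_le0.
Qed.

Lemma bump_cvg a b x : obox a b x -> box_bump a b n x @[n --> \oo] --> (1 : R).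
Proof.
move=> xab.
(* Inside the box the bump is exactly [exp(- K / n)] for positive [n]; the index [n.+1] avoids the
   degenerate [n = 0]. *)
pose K := \sum_i ((x 0 i - a i)^-1 + (b i - x 0 i)^-1).
have E n : box_bump a b n.+1 x = expR (- (K * n.+1%:R^-1)).
  rewrite /box_bump /K mulr_suml -sumrN expR_sum; apply: eq_bigr => i _.
  have /andP[xa xb] := xab i.
  rewrite !flat_gt0 ?mulr_gt0 ?subr_gt0// !hornerC !mul1r -expRD; congr expR.
  by rewrite !invfM; ring.
have h : expR (- (K * n.+1%:R^-1)) @[n --> \oo] --> expR (- (K * 0)).
  have ck : - (K * n.+1%:R^-1) @[n --> \oo] --> - (K * 0).
    by apply: cvgN; apply: cvgMr; exact: cvg_harmonic.
  exact: (cvg_comp _ _ ck (@continuous_expR R _)).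
rewrite mulr0 oppr0 expR0 in h; rewrite -cvg_shiftS; apply: cvg_trans h.
by apply: near_eq_cvg; apply: nearW => n; rewrite /= E.
Qed.

Lemma bump_cube a b : exists2 r : R, 0 < r & forall n x, ~ cube r x -> box_bump a b n x = 0.
Proof.
exists (1 + \sum_i (`|a i| + `|b i|)); first by rewrite ltr_pwDl// sumr_ge0.
move=> n x xr; apply: bump_out => xab; apply: xr => i.
have : `|a i| + `|b i| <= \sum_i (`|a i| + `|b i|).
  by rewrite (bigD1 i)//= lerDl sumr_ge0.
have := xab i; have := ler_norm (b i); have := ler_norm (- a i); rewrite normrN.
have := normr_ge0 (a i); have := normr_ge0 (b i); lra.
Qed.

Lemma bump_test a b n : is_test (fun x => (box_bump a b n x)%:C).
Proof.
have [r r0 hr] := bump_cube a b.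
apply: (@vanish_test _ _ r); last by move=> x xr; rewrite hr.
apply: flat_coords_smooth.
rewrite (_ : (fun _ => _) = fun x : 'rV[R]_d => \prod_i
   ((flat 1 (n%:R * x 0 i + - (n%:R * a i)))%:C *
    (flat 1 (- n%:R * x 0 i + n%:R * b i))%:C)); last first.
  apply/funext => x; rewrite rmorph_prod; apply: eq_bigr => i _.
  by rewrite rmorphM /=; congr (_%:C * _%:C); congr flat; ring.
apply: fun_alg_prod => i; apply: fun_algM; apply: fun_alg_gen;
  by eexists; eexists; eexists; eexists.
Qed.

Definition bump_testfun a b n : testfun R d := TestFun (asboolT (bump_test a b n)).

Lemma bump_measurable a b n : measurable_fun setT (box_bump a b n).
Proof. by apply: continuous_measurable_rV; have [[]] := (bump_test a b n).1 [::]. Qed.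

Lemma compact_measurable_rV (K : set 'rV[R]_d) : compact K -> measurable K.
Proof.
move=> cK; rewrite -[K]setCK; apply: measurableC; apply: open_measurable_rV.
by apply: closed_openC; apply: compact_closed => //; exact: norm_hausdorff.
Qed.

Definition loc_int_real (g : 'rV[R]_d -> R) := measurable_fun setT g /\
  forall K, compact K -> mu.-integrable K (EFin \o g).

Lemma loc_int_obox g a b : loc_int_real g -> mu.-integrable (obox a b) (EFin \o g).
Proof.
move=> [_ gi].
apply: (integrableS (E := [set x : 'rV[R]_d | forall i, `[a i, b i]%classic (x 0 i)])).
- apply: (@measurable_rect R d (fun i => `[a i, b i]%classic)) => i.
  exact: measurable_itv.
- exact: measurable_obox.
- by move=> x xab i; rewrite /= in_itv /=; have /andP[/ltW -> /ltW ->] := xab i.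
by apply: gi; apply: (@rV_compact _ _ (fun i => `[a i, b i]%classic)) => i; exact: segment_compact.
Qed.

Lemma bump_integral_cvg (g : 'rV[R]_d -> R) a b : loc_int_real g ->
  \int[mu]_x (g x * box_bump a b n x) @[n --> \oo] --> \int[mu]_(x in obox a b) g x.
Proof.
move=> lg; have gi := loc_int_obox a b lg; have [mg _] := lg.
have mB : measurable (obox a b) by exact: measurable_obox.
have E n : \int[mu]_x (g x * box_bump a b n x) = \int[mu]_(x in obox a b) (g x * box_bump a b n x).
  rewrite [RHS]Rintegral_mkcond; apply: eq_Rintegral => x _.
  rewrite patchE; case: ifPn => // /negP xr.
  by rewrite bump_out ?mulr0// => h; apply: xr; rewrite inE.
rewrite (funext E).
have [] := @dominated_convergence _ _ _ mu (obox a b) mB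
   (fun n x => (g x * box_bump a b n x)%:E) (EFin \o g) (fun x => `|(g x)%:E|%E).
- move=> n; apply/measurable_EFinP; apply: measurable_funTS.
  by apply: measurable_funM => //; exact: bump_measurable.
- by apply/measurable_EFinP; exact: measurable_funTS.
- apply: aeW => x xab; apply: cvg_EFin; first exact: nearW.
  rewrite -[X in _ --> X]mulr1; apply: cvgMr; exact: bump_cvg.
- exact: integrable_abse.
- apply: aeW => x n _; rewrite abse_EFin lee_fin normrM.
  by rewrite ler_piMr// ger0_norm ?bump_ge0// bump_le1.
move=> _ _ h; apply: (fine_cvg (a := \int[mu]_(x in obox a b) g x)).
rewrite /Rintegral fineK; first exact: h.
exact: integrable_fin_num.
Qed.

(** The sets whose intersection with a fixed cube contributes a zero integral form a Dynkin system
    containing the boxes, hence contain all Borel sets. A function integrating to zero over every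
    measurable subset of the cube vanishes there almost everywhere, and countably many cubes exhaust
    the space. *)
Lemma loc_int_zero_ae (g : 'rV[R]_d -> R) : loc_int_real g ->
  (forall a b, (\int[mu]_(x in obox a b) (g x)%:E = 0)%E) -> {ae mu, forall x, g x = 0}.
Proof.
move=> lg g0; have [mg _] := lg.
have mB n : measurable (cube n%:R : set 'rV[R]_d) by exact: measurable_obox.
have gB n : mu.-integrable (cube n%:R) (EFin \o g) by exact: loc_int_obox.
have key n A : measurable A -> (\int[mu]_(x in A `&` cube n%:R) (g x)%:E = 0)%E.
  rewrite measurable_oboxesE => sA.
  apply: (@dynkin_induction _ _ oboxes (fun A => (\int[mu]_(x in A `&` cube n%:R) (g x)%:E = 0)%E)
    measurable_oboxesE oboxes_setI) => //.
  - by rewrite setTI g0.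
  - by move=> _ [a [b ->]]; rewrite oboxI g0.
  - move=> S mS IS; have := g0 (fun=> - n%:R) (fun=> n%:R).
    rewrite -/(cube n%:R) -[X in integral _ X _](setUIDK (cube n%:R) S).
    rewrite integral_setU_EFin//=; first last.
    + by apply/disj_setPS => x [[_ h1] [_ h2]].
    + by apply: measurable_funTS.
    + exact: measurableD.
    + exact: measurableI.
    by rewrite setIC IS add0e setDE setIC.
  move=> F mF tF IF; rewrite setI_bigcupl integral_bigcup//.
  - by rewrite eseries0.
  - by apply: trivIset_setIr.
  - by move=> k; apply: measurableI.
  by apply: integrableS (gB n) => //; 
    [apply: bigcup_measurable => k _; exact: measurableI|apply: bigcup_sub => k _; exact: subIsetr].
have ae n : {ae mu, forall x, cube n%:R x -> (g x)%:E = 0%E}.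
  apply: (@integral_ae_eq _ _ _ mu (cube n%:R) (mB n) (cst 0%E) (EFin \o g) (gB n)) => //.
  move=> E EB mE; rewrite integral0 -(key n E mE); congr (integral _ _ _).
  by rewrite setIidl.
have := ae_foralln ae; apply: filterS => x hx.
have [n _ xn] : (\bigcup_n cube n%:R) x by rewrite bigcup_cube.
by have [] := hx n xn.
Qed.

(** Letting [n] grow turns equality against bumps into equality of the integrals over boxes, by
    dominated convergence. *)
Lemma bump_separates (g h : 'rV[R]_d -> R) : loc_int_real g -> loc_int_real h ->
  (forall a b n, \int[mu]_x (g x * box_bump a b n x) = \int[mu]_x (h x * box_bump a b n x)) ->
  {ae mu, forall x, g x = h x}.
Proof.
move=> lg lh gh.
have lgh : loc_int_real (fun x => g x - h x).
  have [mg gi] := lg; have [mh hi] := lh; split; first exact: measurable_funB.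
  move=> K cK; rewrite (_ : _ \o _ = ((EFin \o g) \- (EFin \o h))%E)//.
  apply: integrableB; [|exact: gi|exact: hi].
  exact: compact_measurable_rV.
have := @loc_int_zero_ae _ lgh; set P := (forall a b, _) => H.
have /H : P.
  move=> a b; have gi := loc_int_obox a b lg; have hi := loc_int_obox a b lh.
  have mB : measurable (obox a b) by exact: measurable_obox.
  have -> : (\int[mu]_(x in obox a b) (g x - h x)%:E =
     \int[mu]_(x in obox a b) ((g x)%:E - (h x)%:E))%E by [].
  rewrite integralB_EFin//.
  have e : \int[mu]_(x in obox a b) g x = \int[mu]_(x in obox a b) h x.
    rewrite -(cvg_lim (@norm_hausdorff _ _) (@bump_integral_cvg _ a b lg)).
    by rewrite -(cvg_lim (@norm_hausdorff _ _) (@bump_integral_cvg _ a b lh)) (funext (gh a b)).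
  have [fg fh] : (\int[mu]_(x in obox a b) (g x)%:E \is a fin_num)%E /\
    (\int[mu]_(x in obox a b) (h x)%:E \is a fin_num)%E.
    by split; exact: integrable_fin_num.
  by rewrite -(fineK fg) -(fineK fh) -EFinB; move: e; rewrite /Rintegral => ->; rewrite subrr.
by apply: filterS => x /eqP; rewrite subr_eq0 => /eqP.
Qed.

End Bumps.

(** * One-parameter matrix groups and exponential polynomials *)

Section ComplexExponential.
Context {R : realType}.
Implicit Types (z w l : R[i]) (y q : R -> R[i]) (t : R).

Lemma CexpD z w : Cexp (z + w) = Cexp z * Cexp w.
Proof.
apply: complex_ext; rewrite ?Re_mul ?Im_mul /Cexp /= ?Re_add ?Im_add expRD ?cosD ?sinD; ring.
Qed.

Lemma Cexp0 : Cexp (0 : R[i]) = 1.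
Proof. by apply: complex_ext; rewrite /Cexp /= expR0 ?cos0 ?sin0; ring. Qed.

Lemma CexpNK z : Cexp (- z) * Cexp z = 1.
Proof. by rewrite -CexpD addNr Cexp0. Qed.

Definition cder y t l :=
  is_derive t 1 (RE \o y) (RE l) /\ is_derive t 1 (IM \o y) (IM l).

Lemma cder_eq y t l k : cder y t l -> l = k -> cder y t k.
Proof. by move=> + <-. Qed.

Lemma cder_cst l t : cder (fun=> l) t 0.
Proof. by split; exact: is_derive_cst. Qed.

Lemma cderD y q t l k : cder y t l -> cder q t k -> cder (fun t => y t + q t) t (l + k).
Proof.
move=> [ry iy] [rq iq]; split.
  rewrite (_ : RE \o _ = (RE \o y) + (RE \o q)); last by apply/funext => s; exact: Re_add.
  by rewrite Re_add; exact: is_deriveD.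
rewrite (_ : IM \o _ = (IM \o y) + (IM \o q)); last by apply/funext => s; exact: Im_add.
by rewrite Im_add; exact: is_deriveD.
Qed.

Lemma cderM y q t l k : cder y t l -> cder q t k ->
  cder (fun t => y t * q t) t (y t * k + l * q t).
Proof.
move=> [ry iy] [rq iq]; split.
  rewrite (_ : RE \o _ = (RE \o y) * (RE \o q) - (IM \o y) * (IM \o q)); last first.
    by apply/funext => s; exact: Re_mul.
  have H := is_deriveB (is_deriveM ry rq) (is_deriveM iy iq).
  apply: (@is_derive_eq _ _ _ _ _ _ _ _ H).
  rewrite Re_add !Re_mul /GRing.scale /=.
  by move: (RE (y t)) (RE (q t)) (IM (y t)) (IM (q t)) => a b a' b'; ring.
rewrite (_ : IM \o _ = (RE \o y) * (IM \o q) + (IM \o y) * (RE \o q)); last first.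
  by apply/funext => s; exact: Im_mul.
have H := is_deriveD (is_deriveM ry iq) (is_deriveM iy rq).
apply: (@is_derive_eq _ _ _ _ _ _ _ _ H).
rewrite Im_add !Im_mul /GRing.scale /=.
by move: (RE (y t)) (RE (q t)) (IM (y t)) (IM (q t)) => a b a' b'; ring.
Qed.

Lemma cderZ y t l k : cder y t l -> cder (fun t => k * y t) t (k * l).
Proof. by move=> h; apply: cder_eq (cderM (cder_cst k t) h) _; rewrite mul0r addr0. Qed.

Lemma cder_sum I (r : seq I) (ys : I -> R -> R[i]) (ls : I -> R[i]) t :
  (forall i, cder (ys i) t (ls i)) ->
  cder (fun t => \sum_(i <- r) ys i t) t (\sum_(i <- r) ls i).
Proof.
move=> h; elim: r => [|i r IH].
  by under eq_fun do rewrite big_nil; rewrite big_nil; exact: cder_cst.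
by under eq_fun do rewrite big_cons; rewrite big_cons; exact: cderD.
Qed.

Lemma cder_id t : cder (fun t => t%:C) t 1.
Proof. by split; [exact: (@is_derive_id R _ t 1)|exact: is_derive_cst]. Qed.

Lemma cder_exp l t : cder (fun t => Cexp (t%:C * l)) t (l * Cexp (t%:C * l)).
Proof.
case: l => a b.
have da (c : R) : is_derive t (1 : R) (fun t => t * c) c.
  by apply: is_derive_eq; rewrite /GRing.scale /= ?mulr0 ?add0r ?mulr1 ?addr0.
have de : is_derive t (1 : R) (expR \o (fun t => t * a)) (expR (t * a) * a).
  exact: is_derive1_comp.
have dc : is_derive t (1 : R) (cos \o (fun t => t * b)) (- sin (t * b) * b).
  exact: is_derive1_comp.
have ds : is_derive t (1 : R) (sin \o (fun t => t * b)) (cos (t * b) * b).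
  exact: is_derive1_comp.
have ra s : RE (s%:C * (a +i* b)) = s * a by rewrite Re_mul /= mul0r subr0.
have ia s : IM (s%:C * (a +i* b)) = s * b by rewrite Im_mul /= mul0r addr0.
split.
  rewrite (_ : RE \o _ = (expR \o (fun t => t * a)) * (cos \o (fun t => t * b))); last first.
    apply/funext => s.
  transitivity (expR (RE (s%:C * (a +i* b))) * cos (IM (s%:C * (a +i* b)))) => //.
    by rewrite ra ia.
  apply: (@is_derive_eq _ _ _ _ _ _ _ _ (is_deriveM de dc)).
  by rewrite Re_mul /Cexp ra ia /GRing.scale /=; ring.
rewrite (_ : IM \o _ = (expR \o (fun t => t * a)) * (sin \o (fun t => t * b))); last first.
  apply/funext => s.
  transitivity (expR (RE (s%:C * (a +i* b))) * sin (IM (s%:C * (a +i* b)))) => //.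
  by rewrite ra ia.
apply: (@is_derive_eq _ _ _ _ _ _ _ _ (is_deriveM de ds)).
by rewrite Im_mul /Cexp ra ia /GRing.scale /=; ring.
Qed.

Lemma cder_exprn n t : cder (fun t => t%:C ^+ n) t (n%:R * t%:C ^+ n.-1).
Proof.
elim: n => [|n IH]; first by rewrite mul0r; exact: cder_cst.
under eq_fun do rewrite exprS.
apply: cder_eq (cderM (cder_id t) IH) _.
case: n {IH} => [|n] /=; first by rewrite mul0r mulr0 add0r.
by rewrite mulrCA -exprS -mulrDl natr1.
Qed.

Lemma cder0_cst y : (forall t, cder y t 0) -> forall t, y t = y 0.
Proof.
move=> h t; apply: complex_ext.
  by apply: (@is_derive_0_is_cst R (RE \o y)) => x; case: (h x).
by apply: (@is_derive_0_is_cst R (IM \o y)) => x; case: (h x).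
Qed.

(** The span is defined inductively so that the search for particular solutions reduces to single
    monomials. *)
Inductive exppoly1 : (R -> R[i]) -> Prop :=
| exppoly1_0 : exppoly1 (fun=> 0)
| exppoly1_lin c y q : exppoly1 y -> exppoly1 q -> exppoly1 (fun t => c * y t + q t)
| exppoly1_mono k l : exppoly1 (fun t => t%:C ^+ k * Cexp (t%:C * l)).

Lemma exppoly1Z c y : exppoly1 y -> exppoly1 (fun t => c * y t).
Proof.
move=> hy; have := exppoly1_lin c hy exppoly1_0.
by under eq_fun do rewrite addr0.
Qed.

Lemma cder_mono k l t : cder (fun t => t%:C ^+ k * Cexp (t%:C * l)) t
  (l * (t%:C ^+ k * Cexp (t%:C * l)) + k%:R * (t%:C ^+ k.-1 * Cexp (t%:C * l))).
Proof.
apply: cder_eq (cderM (cder_exprn k t) (cder_exp l t)) _.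
by rewrite mulrCA -mulrA.
Qed.

(** By linearity only [t^k e^(m t)] matters. In the resonant case [m = l] the solution has degree
    one higher. Otherwise [t^k e^(m t) / (m - l)] is a solution up to a multiple of
    [t^(k-1) e^(m t)], which the induction on [k] removes. *)
Lemma exppoly1_particular l q : exppoly1 q ->
  exists2 z, exppoly1 z & forall t, cder z t (l * z t + q t).
Proof.
elim => {q} [|c y q _ [z1 e1 h1] _ [z2 e2 h2]|k m].
- by exists (fun=> 0); [exact: exppoly1_0|move=> t; rewrite mulr0 addr0; exact: cder_cst].
- exists (fun t => c * z1 t + z2 t); first exact: exppoly1_lin.
  by move=> t; apply: cder_eq (cderD (cderZ c (h1 t)) (h2 t)) _; ring.
have [->|ml] := eqVneq m l.
  exists (fun t => (k.+1%:R)^-1 * (t%:C ^+ k.+1 * Cexp (t%:C * l))).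
    by apply: exppoly1Z; exact: exppoly1_mono.
  move=> t; apply: cder_eq (cderZ _ (cder_mono k.+1 l t)) _.
  by rewrite mulrDr [X in _ + X]mulrA mulVf ?pnatr_eq0// mul1r mulrCA.
have mln0 : m - l != 0 by rewrite subr_eq0.
elim: k => [|k [z ez hz]].
  exists (fun t => (m - l)^-1 * (t%:C ^+ 0 * Cexp (t%:C * m))).
    by apply: exppoly1Z; exact: exppoly1_mono.
  by move=> t; apply: cder_eq (cderZ _ (cder_mono 0 m t)) _; field.
exists (fun t => (- (k.+1%:R / (m - l))) * z t + (m - l)^-1 * (t%:C ^+ k.+1 * Cexp (t%:C * m))).
  by apply: exppoly1_lin => //; apply: exppoly1Z; exact: exppoly1_mono.
move=> t; apply: cder_eq (cderD (cderZ _ (hz t)) (cderZ _ (cder_mono k.+1 m t))) _.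
rewrite /=; move: (t%:C ^+ k * _) (t%:C ^+ k.+1 * _) (z t) => u v w; by field.
Qed.

(** The difference from a particular solution, multiplied by [e^(- l t)], has derivative zero; so
    [y] is that solution plus a constant multiple of [e^(l t)]. *)
Lemma exppoly1_ode l y q : exppoly1 q -> (forall t, cder y t (l * y t + q t)) -> exppoly1 y.
Proof.
move=> /(exppoly1_particular l)[z ez hz] hy.
pose w t := (y t + - 1 * z t) * Cexp (t%:C * - l).
have w0 : forall t, w t = w 0.
  apply: cder0_cst => t.
  apply: cder_eq (cderM (cderD (hy t) (cderZ (- 1) (hz t))) (cder_exp (- l) t)) _.
  by move: (Cexp _) => u; ring.
have := exppoly1_lin (w 0) (exppoly1_mono 0 l) ez.
congr exppoly1; apply/funext => t; rewrite expr0 mul1r -(w0 t) /w mulrN -mulrA CexpNK.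
by ring.
Qed.

(** If a row [xi] is killed by a product of factors [B - z], then [y = xi A] satisfies
    [y' = z y + q] with [q = xi (B - z) A], and the row [xi (B - z)] is killed by the remaining
    factors. The induction starts at the zero row; the characteristic polynomial splits over the
    complex numbers and kills every row. *)
Lemma one_param_exppoly1 m (A : R -> 'M[R[i]]_m) (B : 'M[R[i]]_m) :
  (forall s t, A (s + t) = A s *m A t) ->
  (forall j k, cder (fun t => A t j k) 0 (B j k)) ->
  forall j k, exppoly1 (fun t => A t j k).
Proof.
(* Evaluating polynomials at a matrix requires positive size. *)
case: m A B => [|m] A B Aadd AB j k; first by case: j.
(* The derivative at [t] is the derivative at 0 of [s |-> A (s + t) = A s *m A t]. *)
have dA t i : cder (fun t => A t i k) t ((B *m A t) i k).
  have h : cder (fun s => A (s + t) i k) 0 ((B *m A t) i k).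
    under eq_fun do rewrite Aadd mxE; rewrite mxE; apply: cder_sum => l.
    by apply: cder_eq (cderM (AB i l) (cder_cst (A t l k) 0)) _; rewrite mulr0 add0r.
  case: h => /is_derive_epsP h1 /is_derive_epsP h2; split; apply/is_derive_epsP => e e0.
    have [de de0 H] := h1 e e0; exists de => // s /H.
    by rewrite /= !add0r [_ + t]addrC.
  have [de de0 H] := h2 e e0; exists de => // s /H.
  by rewrite /= !add0r [_ + t]addrC.
have key s : forall xi : 'rV[R[i]]_m.+1,
    xi *m horner_mx B (\prod_(z <- s) ('X - z%:P)) = 0 ->
    exppoly1 (fun t => (xi *m A t) 0 k).
  elim: s => [|z s IH] xi.
    rewrite big_nil rmorph1 mulmx1 => ->.
    by under eq_fun do rewrite mul0mx mxE; exact: exppoly1_0.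
  rewrite big_cons rmorphM /= rmorphB /= horner_mx_X horner_mx_C -[_ * _]/(_ *m _) mulmxA => h.
  apply: (@exppoly1_ode z _ _ (IH _ h)) => t.
  have -> : z * (xi *m A t) 0 k + (xi *m (B - z%:M) *m A t) 0 k = (xi *m (B *m A t)) 0 k.
    rewrite mulmxBr mul_mx_scalar mulmxBl -scalemxAl -mulmxA [X in _ + X]mxE.
    by rewrite [X in _ + (_ + X)]mxE [X in _ + (_ - X)]mxE addrC subrK.
  under eq_fun do rewrite mxE; rewrite mxE; apply: cder_sum => i.
  exact/cderZ/dA.
have [r hr] := closed_field_poly_normal (char_poly B).
have := Cayley_Hamilton B; rewrite hr (monicP (char_poly_monic B)) scale1r => CH.
have := key r (delta_mx 0 j); rewrite CH mulmx0 => /(_ erefl).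
by under eq_fun do rewrite -rowE mxE.
Qed.

End ComplexExponential.

Section ExponentialPolynomials.
Context {R : realType} {d : nat}.
Implicit Types (p q : 'rV[R]_d -> R[i]).

Lemma exp_polynomial0 : exp_polynomial (fun _ : 'rV[R]_d => 0).
Proof.
exists 0%N, (fun=> 0), (fun _ _ => 0%N), (fun _ _ => 0) => x.
by rewrite big_ord0.
Qed.

Lemma exp_polynomial_monomial al la : exp_polynomial (@exp_monomial R d al la).
Proof. by exists 1%N, (fun=> 1), (fun=> al), (fun=> la) => x; rewrite big_ord1 mul1r. Qed.

Lemma exp_polynomialD p q : exp_polynomial p -> exp_polynomial q ->
  exp_polynomial (fun x => p x + q x).
Proof.
move=> [m [c [al [la hp]]]] [m' [c' [al' [la' hq]]]].
exists (m + m')%N, (fun k => match fintype.split k with inl i => c i | inr j => c' j end),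
  (fun k => match fintype.split k with inl i => al i | inr j => al' j end),
  (fun k => match fintype.split k with inl i => la i | inr j => la' j end) => x.
rewrite big_split_ord /= hp hq; congr (_ + _); apply: eq_bigr => i _.
  by rewrite (unsplitK (inl i)).
by rewrite (unsplitK (inr i)).
Qed.

Lemma exp_polynomialZ (a : R[i]) p : exp_polynomial p -> exp_polynomial (fun x => a * p x).
Proof.
move=> [m [c [al [la hp]]]]; exists m, (fun k => a * c k), al, la => x.
by rewrite hp mulr_sumr; apply: eq_bigr => i _; rewrite mulrA.
Qed.

Lemma exp_polynomial_sum I (r : seq I) (ps : I -> 'rV[R]_d -> R[i]) :
  (forall i, exp_polynomial (ps i)) -> exp_polynomial (fun x => \sum_(i <- r) ps i x).
Proof.
move=> h; elim: r => [|i r IH].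
  by under eq_fun do rewrite big_nil; exact: exp_polynomial0.
by under eq_fun do rewrite big_cons; exact: exp_polynomialD.
Qed.

Lemma exp_monomialM al la al' la' x : @exp_monomial R d al la x * exp_monomial al' la' x =
  exp_monomial (fun j => al j + al' j)%N (fun j => la j + la' j) x.
Proof.
rewrite /exp_monomial mulrACA -CexpD -big_split -big_split /=.
congr (_ * Cexp _); apply: eq_bigr => j _; first by rewrite exprD.
by rewrite mulrDr.
Qed.

Lemma exp_polynomialM p q : exp_polynomial p -> exp_polynomial q ->
  exp_polynomial (fun x => p x * q x).
Proof.
move=> [m [c [al [la hp]]]] [m' [c' [al' [la' hq]]]].
rewrite (_ : (fun _ => _) = fun x => \sum_i \sum_j (c i * c' j) *
   exp_monomial (fun k => al i k + al' j k)%N (fun k => la i k + la' j k) x).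
  apply: exp_polynomial_sum => i; apply: exp_polynomial_sum => j.
  exact/exp_polynomialZ/exp_polynomial_monomial.
apply/funext => x; rewrite hp hq mulr_suml; apply: eq_bigr => i _.
rewrite mulr_sumr; apply: eq_bigr => j _.
by rewrite -exp_monomialM mulrACA.
Qed.

Lemma exppoly1_coord (y : R -> R[i]) (i : 'I_d) : exppoly1 y ->
  exp_polynomial (fun x : 'rV[R]_d => y (x 0 i)).
Proof.
elim => {y} [|c y q _ IHy _ IHq|k l].
- exact: exp_polynomial0.
- by apply: exp_polynomialD => //; exact: exp_polynomialZ.
have := exp_polynomial_monomial (fun j => if j == i then k else 0%N)
  (fun j => if j == i then l else 0).
congr exp_polynomial; apply/funext => x; rewrite /exp_monomial; congr (_ * Cexp _).
  by rewrite (bigD1 i)//= eqxx big1 ?mulr1// => j /negbTE ->.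
by rewrite (bigD1 i)//= eqxx big1 ?addr0// => j /negbTE ->; rewrite mulr0.
Qed.

End ExponentialPolynomials.

(** * The translates of f *)

Section FiniteSpan.
Context {K : fieldType} {V : lmodType K}.

(** [lspan] over any finite index type: the spanning families built below are indexed by products of
    types. *)
Definition fspan (I : finType) (b : I -> V) : set V :=
  [set v | exists c : I -> K, v = \sum_i c i *: b i].

Lemma fspan_gen (I : finType) (b : I -> V) i : fspan b (b i).
Proof.
exists (fun j => (j == i)%:R); rewrite (bigD1 i)//= eqxx scale1r big1 ?addr0//.
by move=> j /negbTE ->; rewrite scale0r.
Qed.

Lemma fspan0 (I : finType) (b : I -> V) : fspan b 0.
Proof. by exists (fun=> 0); rewrite big1// => i _; rewrite scale0r. Qed.

Lemma fspanZ (I : finType) (b : I -> V) a v : fspan b v -> fspan b (a *: v).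
Proof.
move=> [c ->]; exists (fun i => a * c i); rewrite scaler_sumr.
by apply: eq_bigr => i _; rewrite scalerA.
Qed.

Lemma fspanD (I : finType) (b : I -> V) v w : fspan b v -> fspan b w -> fspan b (v + w).
Proof.
move=> [c ->] [c' ->]; exists (fun i => c i + c' i); rewrite -big_split.
by apply: eq_bigr => i _; rewrite scalerDl.
Qed.

Lemma fspan_sum (I : finType) (b : I -> V) J (r : seq J) (P : pred J) (F : J -> V) :
  (forall j, P j -> fspan b (F j)) -> fspan b (\sum_(j <- r | P j) F j).
Proof. by move=> h; elim/big_ind: _ => //; [exact: fspan0|exact: fspanD]. Qed.

(** The coefficients form a matrix with more rows than columns, and a nonzero row of its left kernel
    is a linear relation. *)
Lemma span_dependent (I : finType) (b : I -> V) n (v : 'I_n -> V) :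
  (forall k, fspan b (v k)) -> (#|I| < n)%N ->
  exists2 c : 'I_n -> K, \sum_k c k *: v k = 0 & exists k, c k != 0.
Proof.
move=> bv In; have [M hM] := choice bv.
pose N := \matrix_(k < n, j < #|I|) M k (enum_val j).
have : kermx N != 0.
  rewrite kermx_eq0 /row_free; apply/eqP => rN.
  by have := rank_leq_col N; rewrite rN leqNgt In.
move/matrix0Pn => [i [k0 ck0]].
exists (fun k => kermx N i k); last by exists k0.
have kN : row i (kermx N) *m N = 0.
  by rewrite -row_mul mulmx_ker row0.
under eq_bigr do rewrite hM scaler_sumr.
rewrite exchange_big /= big1// => j _.
under eq_bigr do rewrite scalerA.
rewrite -scaler_suml; have := congr1 (fun A : 'M[K]_(1, #|I|) => A 0 (enum_rank j)) kN.
rewrite !mxE => h.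
suff -> : \sum_(k < n) kermx N i k * M k j = 0 by rewrite scale0r.
by rewrite -[RHS]h; apply: eq_bigr => k _; rewrite !mxE enum_rankK.
Qed.

Lemma lfree_extend m (b : 'I_m -> V) v : lfree b -> ~ lspan b v ->
  lfree (fun k : 'I_m.+1 => if unlift ord0 k is Some j then b j else v).
Proof.
move=> fb bv c; rewrite big_ord_recl unlift_none => h.
have {}h : c ord0 *: v + \sum_i c (lift ord0 i) *: b i = 0.
  by rewrite -[RHS]h; congr (_ + _); apply: eq_bigr => i _; rewrite liftK.
have c0 : c ord0 = 0.
  apply/eqP; apply: contra_notT bv => c0; exists (fun i => - (c ord0)^-1 * c (lift ord0 i)).
  move/eqP: h; rewrite addr_eq0 => /eqP h.
  apply: (scalerI c0); rewrite h scaler_sumr -sumrN; apply: eq_bigr => i _.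
  by rewrite scalerA mulNr mulrN mulrA mulfV// mul1r scaleNr.
move: h; rewrite c0 scale0r add0r => /fb h k.
by case: (unliftP ord0 k) => [j|] ->.
Qed.

(** [span_dependent] bounds the length of free families, so a longest one exists, and [lfree_extend]
    shows that it spans. Its members are values of [g] and not mere combinations of them, which is
    what makes the span of translates stable under the group. *)
Lemma maximal_free (X : Type) (S : set X) (g : X -> V) (I : finType) (b : I -> V) :
  (forall x, S x -> fspan b (g x)) ->
  exists m (x : 'I_m -> X), [/\ forall k, S (x k), lfree (g \o x) &
    forall y, S y -> lspan (g \o x) (g y)].
Proof.
move=> gb.
pose P m := `[< exists x : 'I_m -> X, (forall k, S (x k)) /\ lfree (g \o x) >].
have P0 : exists m, P m.
  exists 0%N; apply/asboolP.
  have x0 : 'I_0 -> X by case.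
  by exists x0; split=> [[]//|c _ []].
have Pb m : P m -> (m <= #|I|)%N.
  move=> /asboolP[x [Sx fx]]; rewrite leqNgt; apply/negP => Im.
  have [c c0 [k ck]] := span_dependent (fun k => gb _ (Sx k)) Im.
  by move: ck; rewrite (fx c c0) eqxx.
have [m /asboolP[x [Sx fx]] mmax] := ex_maxnP P0 Pb.
exists m, x; split=> // y Sy; apply: contrapT => ny.
suff /mmax : P m.+1 by rewrite ltnn.
apply/asboolP.
exists (fun k => if unlift ord0 k is Some j then x j else y); split.
  by move=> k; case: unlift.
have := lfree_extend fx ny; congr lfree; apply/funext => k /=.
by case: unlift.
Qed.

Lemma recurrence_span (u : int -> V) n (c : 'I_n -> K) :
  (exists k, c k != 0) -> (forall k : int, \sum_(j < n) c j *: u (k + j%:Z) = 0) ->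
  exists D, forall k, fspan (fun j : 'I_D => u j%:Z) (u k).
Proof.
move=> cn0 cu.
(* For [D] minimal both extreme coefficients are nonzero, so that the recurrence
   can be run forwards and backwards. *)
pose P D := `[< exists c : 'I_D.+1 -> K, (exists k, c k != 0) /\
  forall k : int, \sum_(j < D.+1) c j *: u (k + j%:Z) = 0 >].
have : exists D, P D.
  case: n c cn0 cu => [|n] c cn0 cu; first by case: cn0 => -[].
  by exists n; apply/asboolP; exists c.
move=> /ex_minnP[D /asboolP[{cn0 cu}c [cn0 cu]] Dmin]; exists D.
have c0 : c ord0 != 0.
  apply/eqP => c0; case: D c cn0 cu Dmin c0 => [|D] c cn0 cu Dmin c0.
    by case: cn0 => k; rewrite ord1 c0 eqxx.
  suff /Dmin : P D by rewrite ltnn.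
  apply/asboolP.
  exists (fun j => c (lift ord0 j)); split.
    by case: cn0 => k; case: (unliftP ord0 k) => [j ->|->]; [exists j|rewrite c0 eqxx].
  move=> k; rewrite -[RHS](cu (k - 1)) [RHS]big_ord_recl c0 scale0r add0r.
  apply: eq_bigr => j _; congr (_ *: u _).
  by rewrite lift0 -(add1n j) PoszD addrA subrK.
have cD : c ord_max != 0.
  apply/eqP => c1; case: D c cn0 cu Dmin c1 {c0} => [|D] c cn0 cu Dmin c1.
    by case: cn0 => k; rewrite ord1 -[0](ord1 ord_max) c1 eqxx.
  suff /Dmin : P D by rewrite ltnn.
  apply/asboolP.
  exists (fun j => c (lift ord_max j)); split.
    by case: cn0 => k; case: (unliftP ord_max k) => [j ->|->]; [exists j|rewrite c1 eqxx].
  move=> k; rewrite -[RHS](cu k) [RHS]big_ord_recr /= c1 scale0r addr0.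
  apply: eq_bigr => j _; congr (c _ *: _).
  by apply: val_inj; exact: lift_max.
pose S := fspan (fun j : 'I_D => u j%:Z).
(* A window of [D] consecutive terms. Solving the relation for its last or its first term slides the
   window by one in either direction, so that from 0 it reaches every integer. *)
pose W (k : int) := forall j : nat, (j < D)%N -> S (u (k + j%:Z)).
have hi k : W k -> S (u (k + D%:Z)).
  move=> Wk; have := cu k; rewrite big_ord_recr /= addrC => /eqP.
  rewrite addr_eq0 => /eqP h.
  rewrite -[u _](scalerK cD) h; apply/fspanZ; rewrite -scaleN1r.
  by apply/fspanZ/fspan_sum => j _; apply/fspanZ/Wk.
have lo k : W k -> S (u (k - 1)).
  move=> Wk; have := cu (k - 1); rewrite big_ord_recl /= addr0 => /eqP.
  rewrite addr_eq0 => /eqP h.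
  rewrite -[u _](scalerK c0) h; apply/fspanZ; rewrite -scaleN1r.
  apply/fspanZ/fspan_sum => j _; apply/fspanZ.
  by rewrite /bump leq0n PoszD addrA subrK; exact: Wk.
have up k : W k -> W (k + 1).
  move=> Wk j jD; rewrite -addrA -PoszD add1n.
  have [->|jD'] := eqVneq j.+1 D; first exact: hi.
  by apply: Wk; rewrite ltn_neqAle jD' jD.
have down k : W k -> W (k - 1).
  move=> Wk [|j] jD; first by rewrite addr0; exact: lo.
  by rewrite -add1n PoszD addrA subrK; apply: Wk; exact: ltnW.
have W0 : W 0 by move=> j jD; rewrite add0r; exact: (fspan_gen _ (Ordinal jD)).
have Wpos (m : nat) : W m%:Z.
  by elim: m => // m /up; rewrite -PoszD addn1.
have Wneg (m : nat) : W (- m%:Z).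
  by elim: m => [|m /down]; rewrite ?oppr0// -opprD -PoszD addn1.
(* For [D = 0] the window at [k] is empty and says nothing about [u k]. The term is read off as the
   one just below the window at [k + 1], uniformly in [D]. *)
move=> k; rewrite -[k](addrK 1); apply: lo; apply: up.
by case: k => m; [exact: Wpos|rewrite NegzE; exact: Wneg].
Qed.

End FiniteSpan.

Section Translates.
Context {R : realType} {d : nat}.
Local Notation test := (testfun R d).
Local Notation C := R[i].
Implicit Types (u v : distr R d) (phi psi : test) (x y : 'rV[R]_d).

Lemma distrP u v : (forall phi, u phi = v phi) -> u = v.
Proof. by move=> h; apply: val_inj; apply/funext. Qed.

Lemma distr_sumE I (r : seq I) (c : I -> C) (b : I -> distr R d) phi :
  (\sum_(i <- r) c i *: b i) phi = \sum_(i <- r) c i * b i phi.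
Proof. by elim: r => [|i r IH]; rewrite ?big_nil// !big_cons -IH. Qed.

Lemma translate0 u : translate 0 u = u.
Proof.
apply: distrP => phi; rewrite translateE; congr (u _); apply: val_inj.
by apply/funext => x /=; rewrite /shift_fun oppr0 addr0.
Qed.

Lemma shift_testD x y phi : shift_test x (shift_test y phi) = shift_test (x + y) phi.
Proof. by apply: val_inj; apply/funext => z; rewrite /= /shift_fun addrA. Qed.

Lemma translateD x y u : translate x (translate y u) = translate (x + y) u.
Proof.
apply: distrP => phi; rewrite !translateE shift_testD; congr (u (shift_test _ _)).
by rewrite opprD addrC.
Qed.

Lemma iter_translate k x u : iter k (translate x) u = translate (x *+ k) u.
Proof.
elim: k => [|k IH]; first by rewrite mulr0n translate0.
by rewrite iterS IH translateD mulrS.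
Qed.

Lemma translate_sum x I (r : seq I) (c : I -> C) (b : I -> distr R d) :
  translate x (\sum_(i <- r) c i *: b i) = \sum_(i <- r) c i *: translate x (b i).
Proof. by apply: distrP => phi; rewrite translateE !distr_sumE. Qed.

Lemma lspan_fspan (K : fieldType) (V : lmodType K) m (b : 'I_m -> V) : lspan b = fspan b.
Proof. by []. Qed.

(** The [n + 1] iterates lie in a space of dimension at most [n] and so satisfy a relation.
    Translating it by [x *~ k] makes it a recurrence valid at every integer [k], negative ones
    included. *)
Lemma translates_recurrence x u n :
  dim_le (lspan (fun k : 'I_n.+1 => iter k (translate x) u)) n ->
  exists D, forall k : int,
    fspan (fun j : 'I_D => translate (x *~ j%:Z) u) (translate (x *~ k) u).
Proof.
move=> [m mn [b [_ hb]]].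
have hk (k : 'I_n.+1) : fspan b (iter k (translate x) u).
  rewrite -lspan_fspan hb lspan_fspan.
  exact: (fspan_gen (fun k : 'I_n.+1 => iter k (translate x) u)).
have [|c c0 cn0] := span_dependent hk; first by rewrite card_ord ltnS.
apply: (@recurrence_span _ _ (fun k => translate (x *~ k) u) _ c cn0) => k.
transitivity (translate (x *~ k) (\sum_(j < n.+1) c j *: iter j (translate x) u)); last first.
  by rewrite c0; apply: distrP => phi; rewrite translateE.
rewrite translate_sum; apply: eq_bigr => j _.
by rewrite iter_translate translateD mulrzDr -pmulrn.
Qed.

(** Induction on the generators: translations commute, so the multiple of [h i] is first reduced to
    a window on [u] itself, and the remaining generators are handled on each term. Hence the product
    of index types. *)
Lemma zspan_translates s (h : 'I_s -> 'rV[R]_d) u (n : 'I_s -> nat)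
  (hn : forall i, dim_le (lspan (fun k : 'I_(n i).+1 => iter k (translate (h i)) u)) (n i)) :
  exists (I : finType) (b : I -> distr R d),
    forall x, zspan h x -> fspan b (translate x u).
Proof.
suff [I [b hb]] : exists (I : finType) (b : I -> distr R d),
    forall k : 'I_s -> int, fspan b (translate (\sum_(i <- index_enum 'I_s) h i *~ k i) u).
  by exists I, b => _ [k _ <-].
elim: (index_enum _) => [|i r [I [b hb]]].
  exists unit, (fun=> u) => k; rewrite big_nil translate0.
  exact: (fspan_gen _ tt).
have [D hD] := translates_recurrence (hn i).
exists ('I_D * I)%type, (fun p : 'I_D * I => translate (h i *~ p.1%:Z) (b p.2)) => k.
rewrite big_cons addrC -translateD; have [c ->] := hD (k i).
rewrite translate_sum; apply: fspan_sum => j _; apply: fspanZ.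
rewrite translateD addrC -translateD; have [c' ->] := hb k.
rewrite translate_sum; apply: fspan_sum => l _; apply: fspanZ.
exact: (fspan_gen _ (j, l)).
Qed.

Lemma zspan0 s (h : 'I_s -> 'rV[R]_d) : zspan h 0.
Proof. by exists (fun=> 0) => //; rewrite big1// => i _; rewrite mulr0z. Qed.

Lemma zspanD s (h : 'I_s -> 'rV[R]_d) x y : zspan h x -> zspan h y -> zspan h (x + y).
Proof.
move=> [k _ <-] [l _ <-]; exists (fun i => k i + l i) => //.
by rewrite -big_split; apply: eq_bigr => i _; rewrite mulrzDr.
Qed.

(** Test functions are added one at a time, keeping the rows of values [b i (psi k)] independent.
    With fewer than [m] rows some nonzero [w] is orthogonal to all of them; by freeness the
    combination of the [b i] with coefficients [w] is not the zero distribution, and a test function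
    on which it is nonzero gives the next row. Inverting the final square matrix produces the dual
    family. *)
Lemma dual_tests m (b : 'I_m -> distr R d) : lfree b ->
  exists phi : 'I_m -> test, forall i k, b i (phi k) = (i == k)%:R.
Proof.
move=> fb.
have H n : (n <= m)%N -> exists psi : 'I_n -> test,
    row_free (\matrix_(k < n, i < m) (b i (psi k) : C)).
  elim: n => [_|n IH nm].
    by exists (fun=> 0); rewrite /row_free; apply/eqP; rewrite flatmx0 mxrank0.
  have [psi fpsi] := IH (ltnW nm).
  set N := \matrix_(k, i) _ in fpsi.
  have : kermx N^T != 0.
    rewrite kermx_eq0 /row_free mxrank_tr; apply/eqP => h.
    by move: fpsi; rewrite /row_free h => /eqP h'; rewrite h' ltnn in nm.
  move/matrix0Pn => [i0 [k0 wk0]].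
  pose w : 'rV_m := row i0 (kermx N^T).
  have wN : w *m N^T = 0 by rewrite -row_mul mulmx_ker row0.
  have [phi hphi] : exists phi, \sum_i w 0 i * b i phi != 0.
    apply: contrapT => /forallNP h.
    have : \sum_i w 0 i *: b i = 0.
      apply: distrP => phi; rewrite distr_sumE; apply/eqP.
      by have /negP := h phi; rewrite negbK.
    move=> /fb/(_ k0); rewrite mxE => e.
    by rewrite e eqxx in wk0.
  exists (fun k => if unlift ord0 k is Some j then psi j else phi).
  apply: inj_row_free => v hv.
  (* Multiplication by the transpose of [w] kills the old rows and isolates the coefficient of the
     new one. *)
  have v0 : v 0 ord0 = 0.
    have : (v *m \matrix_(k < n.+1, i < m)
        (b i (if unlift ord0 k is Some j then psi j else phi) : C)) *m w^T = 0.
      by rewrite hv mul0mx.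
    move=> /matrixP/(_ 0 0); rewrite -mulmxA mxE big_ord_recl.
    rewrite big1 ?addr0 => [|j _]; last first.
      have /matrixP/(_ 0 j) := wN; rewrite !mxE => h.
      rewrite -[RHS](mulr0 (v 0 (lift ord0 j))); congr (_ * _); rewrite -[RHS]h.
      by apply: eq_bigr => l _; rewrite !mxE liftK mulrC.
    rewrite !mxE => /eqP; rewrite mulf_eq0 => /orP[/eqP//|/eqP h].
    case/negP: hphi; apply/eqP; rewrite -[RHS]h; apply: eq_bigr => l _.
    by rewrite !mxE unlift_none mulrC.
  have vr : (\row_j v 0 (lift ord0 j)) *m N = 0.
    rewrite -[RHS]hv; apply/rowP => l; rewrite !mxE [RHS]big_ord_recl v0 mul0r add0r.
    by apply: eq_bigr => j _; rewrite !mxE liftK.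
  have /rowP vr0 : \row_j v 0 (lift ord0 j) = 0.
    by apply/eqP; rewrite -(mulmx_free_eq0 _ fpsi); apply/eqP.
  apply/rowP => k; rewrite [RHS]mxE; case: (unliftP ord0 k) => [j|] -> //.
  by have := vr0 j; rewrite !mxE.
have [psi] := H m (leqnn m); set N := \matrix_(k, i) _; rewrite row_free_unit => uN.
exists (fun k => \sum_l invmx N k l *: psi l) => i k.
rewrite distr_sum; under eq_bigr do rewrite distrZ.
have /matrixP/(_ k i) := mulVmx uN; rewrite !mxE eq_sym => <-.
by apply: eq_bigr => l _; rewrite !mxE.
Qed.

End Translates.

Lemma cderiv_line (R : realType) (d : nat) (F : 'rV[R]_d -> R[i]) e l :
  cderiv F e 0 l -> cder (fun t => F (t *: basis_vec e)) 0 l.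
Proof.
move=> /cderivP[/is_derive_epsP h1 /is_derive_epsP h2].
have E (t : R) : (0 + t *: (1 : R)) *: @basis_vec R d e = 0 + t *: basis_vec e.
  by rewrite !add0r [t *: 1]mulr1.
split; apply/is_derive_epsP => eps e0.
  by have [de de0 H] := h1 _ e0; exists de => // t /H; rewrite /= E scale0r.
by have [de de0 H] := h2 _ e0; exists de => // t /H; rewrite /= E scale0r.
Qed.

(** * The matrix cocycle of the translations *)

Section Cocycle.
Context {R : realType} {d : nat}.
Local Notation C := R[i].
Local Notation mu := (@lebesgue_rV R d).
Context (m : nat) (b : 'I_m -> distr R d) (phi : 'I_m -> testfun R d).
Context (G : set 'rV[R]_d).
Hypothesis b_dual : forall i k, b i (phi k) = (i == k)%:R.
Hypothesis G_dense : dense G.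
Hypothesis G_span : forall x i, G x -> lspan b (translate x (b i)).

Definition cocycle (x : 'rV[R]_d) : 'M[C]_m := \matrix_(i, j) translate x (b i) (phi j).

Lemma cocycle_ccont i j : ccont (fun x => cocycle x i j).
Proof. by under eq_fun do rewrite mxE; exact: translate_ccont. Qed.

Lemma dense_ccont0 (F : 'rV[R]_d -> C) : ccont F -> (forall x, G x -> F x = 0) -> forall x, F x = 0.
Proof.
move=> cF FG x; apply: cmod_small => e e0.
have /nbhs_ballP[de /= de0 hde] := (ccontP F).1 cF x e e0.
have oB : open (ball x de) by rewrite ball_obox//; exact: open_obox.
have [|y [xy Gy]] := G_dense (O := ball x de) _ oB.
  by exists x; exact: ballxx.
by have := hde y xy; rewrite FG// sub0r cmodN.
Qed.

(** On [G] the coefficients are read off by evaluation on the dual family; density concludes, both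
    sides being continuous in [x]. *)
Lemma translate_cocycle x i psi : translate x (b i) psi = \sum_j cocycle x i j * b j psi.
Proof.
apply/eqP; rewrite -subr_eq0; apply/eqP.
apply: (dense_ccont0 (F := fun x => translate x (b i) psi - \sum_j cocycle x i j * b j psi)).
  apply: ccontB; first exact: translate_ccont.
  by apply: ccont_sum => j; apply: ccontM; [exact: cocycle_ccont|exact: ccont_cst].
move=> y Gy; have [c hc] := G_span i Gy.
have cE j : c j = cocycle y i j.
  rewrite mxE hc distr_sumE (bigD1 j)//= b_dual eqxx mulr1 big1 ?addr0// => k kj.
  by rewrite b_dual (negbTE kj) mulr0.
by rewrite hc distr_sumE; under eq_bigr do rewrite cE; rewrite subrr.
Qed.

(** This is [translate_cocycle] for [x], evaluated at the test function
    [shift_test (- y) (phi k)]. *)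
Lemma cocycleD x y : cocycle (x + y) = cocycle x *m cocycle y.
Proof.
apply/matrixP => i k; rewrite !mxE addrC -translateD translateE translate_cocycle.
by apply: eq_bigr => j _; rewrite [cocycle y j k]mxE translateE.
Qed.

Lemma cocycle0 : cocycle 0 = 1%:M.
Proof. by apply/matrixP => i k; rewrite !mxE translate0 b_dual. Qed.

Definition mean (rho : testfun R d) : 'M[C]_m :=
  \matrix_(i, j) Cintegral (fun x => cocycle x i j * rho x).

Lemma cocycle_test_integrable i j (rho : testfun R d) :
  Cintegrable (fun x => cocycle x i j * rho x).
Proof.
have [r _ vr] := test_vanish (testP rho); have vr0 : vanish_out r rho := vr [::].
apply: (@Cintegrable_cont _ _ r); last by move=> x xr; rewrite vr0// mulr0.
by apply: ccontM; [exact: cocycle_ccont|exact/test_ccont/testP].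
Qed.

(** Both sides are [b i] applied to the convolution of [rho] and [psi]: [distr_conv] computes the
    integral of [translate x (b i) psi] against [rho], and [translate_cocycle] expands its
    integrand. *)
Lemma mean_sym (rho psi : testfun R d) i :
  \sum_j mean rho i j * b j psi = \sum_j mean psi i j * b j rho.
Proof.
have H (f g : testfun R d) : \sum_j mean f i j * b j g = b i (conv_testfun g f).
  rewrite -distr_conv; under [in RHS]eq_fun do rewrite -translateE translate_cocycle mulr_suml.
  rewrite Cintegral_sum => [|j].
    apply: eq_bigr => j _; rewrite mxE mulrC -CintegralZ; last exact: cocycle_test_integrable.
    by congr Cintegral; apply/funext => x; rewrite mulrA [b j g * _]mulrC.
  under eq_fun do rewrite [cocycle _ _ _ * _]mulrC -mulrA.
  by apply: CintegrableZ; exact: cocycle_test_integrable.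
by rewrite !H conv_testfunC.
Qed.

(** Multiplicativity makes the left side the integral of [cocycle (x + y)] against [rho y]. A shift
    of the variable produces [rho (y - x)], which evenness turns into the convolution kernel
    [rho (x - y)]. *)
Lemma cocycle_mean (rho : testfun R d) x i k : (forall y, rho (- y) = rho y) ->
  (cocycle x *m mean rho) i k = convol rho (fun y => cocycle y i k) x.
Proof.
move=> ev; have [r _ vr] := test_vanish (testP rho); have vr0 : vanish_out r rho := vr [::].
rewrite /convol -(@Cintegral_shift _ _ _ (r + `|x|) x); last 2 first.
- exact: conv_integrand_ccont (test_ccont (testP rho)) (cocycle_ccont _ _).
- exact: conv_integrand_vanish.
under [in RHS]eq_fun do rewrite opprD addrA addrAC subrr add0r ev addrC cocycleD mxE mulr_sumr.
rewrite Cintegral_sum => [|j]; last first.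
  under eq_fun do rewrite mulrCA [rho _ * _]mulrC.
  by apply: CintegrableZ; exact: cocycle_test_integrable.
rewrite [LHS]mxE; apply: eq_bigr => j _; rewrite [mean rho j k]mxE.
rewrite -CintegralZ; last exact: cocycle_test_integrable.
by congr Cintegral; apply/funext => y; rewrite [RHS]mulrC mulrA.
Qed.

Definition cube_bump (c : R) n : testfun R d := bump_testfun (fun=> - c) (fun=> c) n.

Lemma cube_bumpE c n x : cube_bump c n x = (box_bump (fun=> - c) (fun=> c) n x)%:C.
Proof. by []. Qed.

Lemma cube_bump_even c n x : cube_bump c n (- x) = cube_bump c n x.
Proof.
rewrite !cube_bumpE; congr (_%:C); apply: eq_bigr => i _.
by rewrite mulrC !mxE; congr (flat 1 (_ * _) * flat 1 (_ * _)); ring.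
Qed.

Lemma bump_integrable aa bb n : mu.-integrable setT (EFin \o (@box_bump R d aa bb n)).
Proof.
have [r r0 hr] := bump_cube aa bb.
apply: (@bounded_integrable _ _ _ r 1); first exact: bump_measurable.
  by move=> x; rewrite ger0_norm ?bump_ge0// bump_le1.
by move=> x; exact: hr.
Qed.

Lemma vol_gt0 (c : R) : 0 < c -> 0 < @vol R d c.
Proof.
move=> c0; rewrite /vol lebesgue_obox.
have -> : (\prod_(i < d) @lebesgue_measure R `](- c)%R, c[ = (\prod_(i < d) (2 * c)%R)%:E)%E.
  rewrite -prodEFin; apply: eq_bigr => i _.
  rewrite lebesgue_measure_itv/= lte_fin -EFinB.
  have -> : - c < c by lra.
  by congr (_%:E); ring.
by apply: prodr_gt0 => i _; rewrite mulr_gt0.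
Qed.

(** The masses tend to the volume of the cube, which is positive, so they cannot all be zero. *)
Lemma cube_bump_mass c : 0 < c ->
  exists n, 0 < \int[mu]_x (@box_bump R d (fun=> - c) (fun=> c) n x).
Proof.
move=> c0; apply: contrapT => /forallNP h.
have l1 : loc_int_real (fun _ : 'rV[R]_d => 1 : R).
  split; first exact: measurable_cst.
  move=> K cK; apply: integrable_cst_fin; first exact: compact_measurable_rV.
  have [r r0 Kr] := compact_cube cK.
  apply: le_lt_trans (cube_lty r); apply: le_measure; rewrite ?inE//.
    exact: compact_measurable_rV.
  exact: measurable_obox.
have := @bump_integral_cvg R d _ (fun=> - c) (fun=> c) l1.
rewrite (_ : (fun n => _) = cst 0); last first.
  apply/funext => n /=; under eq_Rintegral do rewrite mul1r.
  apply/eqP; rewrite eq_le; apply/andP; split.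
    by rewrite leNgt; apply/negP; exact: h.
  by apply: Rintegral_ge0 => x _; exact: bump_ge0.
move=> /(cvg_lim (@norm_hausdorff _ _)); rewrite lim_cst; last exact: norm_hausdorff.
rewrite Rintegral_cst ?mul1r; last exact: measurable_obox.
by move=> e; have := vol_gt0 c0; rewrite /vol -e ltxx.
Qed.

Lemma Cintegral_dominated F (f : 'rV[R]_d -> R) : Cintegrable F ->
  mu.-integrable setT (EFin \o f) -> (forall x, cmod (F x) <= f x) ->
  cmod (Cintegral F) <= 2 * \int[mu]_x f x.
Proof.
move=> [rF iF] fi Ff; apply: le_trans (cmod_le _) _; rewrite mulr2n mulrDl mul1r.
have H g : mu.-integrable setT (EFin \o g) -> (forall x, `|g x| <= f x) ->
    `|\int[mu]_x g x| <= \int[mu]_x f x.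
  move=> gi gf; apply: le_trans (le_normr_Rintegral measurableT gi) _.
  by apply: le_Rintegral => //; exact: (integrable_norm gi).
apply: lerD.
  by apply: (H (RE \o F)) => // x; apply: le_trans (Ff x); exact: Re_le_cmod.
by apply: (H (IM \o F)) => // x; apply: le_trans (Ff x); exact: Im_le_cmod.
Qed.

Lemma mean_unit : exists2 rho : testfun R d, (forall y, rho (- y) = rho y) & mean rho \in unitmx.
Proof.
(* [mean rho] is, up to the factor [\int rho], so close to the identity that
   [xi *m mean rho = 0] gives [|xi| <= |xi| / 2] for the sum norm. *)
pose eta : R := (4 * m.+1%:R)^-1.
have eta0 : 0 < eta by rewrite invr_gt0 mulr_gt0.
have : \forall x \near (0 : 'rV[R]_d), forall i j, cmod (cocycle x i j - (i == j)%:R) <= eta.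
  apply: (@filter_forall _ _ (fun i x => forall j, cmod (cocycle x i j - (i == j)%:R) <= eta)
    (nbhs (0 : 'rV[R]_d)) _) => i.
  apply: (@filter_forall _ _ (fun j x => cmod (cocycle x i j - (i == j)%:R) <= eta)
    (nbhs (0 : 'rV[R]_d)) _) => j.
  have := (ccontP _).1 (cocycle_ccont i j) 0 eta eta0.
  by rewrite cocycle0 mxE.
move=> /nbhs_ballP[c /= c0 hc].
have [n mass] := cube_bump_mass c0.
pose rho := cube_bump c n; exists rho; first exact: cube_bump_even.
pose I0 := \int[mu]_x (@box_bump R d (fun=> - c) (fun=> c) n x).
have bi := bump_integrable (fun=> - c) (fun=> c) n.
have CI : Cintegral rho = I0%:C.
  apply: complex_ext => //=; rewrite /Cintegral /=.
  by rewrite Rintegral_cst// mul0r.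
have ci : Cintegrable rho.
  by split; [exact: bi|exact: (integrable0 mu setT)].
have close i j : cmod (mean rho i j - (i == j)%:R * I0%:C) <= 2 * (eta * I0).
  rewrite mxE -CI -CintegralZ// -CintegralB; [|exact: cocycle_test_integrable|exact: CintegrableZ].
  rewrite /I0 -RintegralZl//.
  apply: Cintegral_dominated.
  - by apply: CintegrableB; [exact: cocycle_test_integrable|exact: CintegrableZ].
  - rewrite (_ : _ \o _ = (fun x => eta%:E * (box_bump (fun=> - c) (fun=> c) n x)%:E)%E)//.
    exact: (integrableZl _ _ bi).
  move=> x; rewrite -mulrBl cmodM /rho cube_bumpE cmod_real ger0_norm ?bump_ge0//.
  have [xc|xc] := pselect (cube c x).
    apply: ler_wpM2r; first exact: bump_ge0.
    apply: hc; rewrite ball_obox// => k; rewrite mxE sub0r add0r; exact: xc.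
  by rewrite bump_out// !mulr0.
rewrite -row_free_unit; apply: inj_row_free => xi hxi.
pose S := \sum_j cmod (xi 0 j).
have S0 : 0 <= S by apply: sumr_ge0 => j _; exact: cmod_ge0.
(* Entry [j] of [xi *m mean rho] being zero, [- xi 0 j * I0] is the sum over [i] of [xi 0 i] times
   the deviation of [mean rho] from [I0] times the identity. *)
have each j : cmod (xi 0 j) <= 2 * eta * S.
  rewrite -(ler_pM2r mass) -/I0.
  have -> : cmod (xi 0 j) * I0 = cmod (\sum_i xi 0 i * (mean rho i j - (i == j)%:R * I0%:C)).
    under eq_bigr do rewrite mulrBr.
    rewrite sumrB; have /matrixP/(_ 0 j) := hxi; rewrite mxE [X in _ = X]mxE => ->.
    rewrite sub0r cmodN (bigD1 j)//= eqxx mul1r big1 ?addr0 => [|i /negbTE ->].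
      by rewrite cmodM cmod_real ger0_norm// ltW.
    by rewrite mul0r mulr0.
  apply: le_trans (cmod_sum _ _ _) _.
  rewrite mulrAC /S mulr_sumr; apply: ler_sum => i _.
  by rewrite cmodM [leRHS]mulrC; apply: ler_wpM2l; [exact: cmod_ge0|rewrite -mulrA; exact: close].
(* Summation over the [m] columns gives [2 m eta S], the 2 coming from [Cintegral_dominated]. With
   [eta = 1 / (4 (m + 1))] this is at most [S / 2], also for [m = 0]. *)
have SS : S <= S / 2.
  have : S <= \sum_(j < m) (2 * eta * S) by apply: ler_sum => j _; exact: each.
  rewrite sumr_const card_ord => h; apply: le_trans h _.
  rewrite -[leLHS]mulr_natl mulrA [leRHS]mulrC; apply: ler_wpM2r => //.
  rewrite /eta mulrCA -[leRHS]mulr1 -[2^-1 * 1]/(2^-1 * 1).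
  have m1 : (0 : R) < m.+1%:R by [].
  have -> : 2 * (m%:R * (4 * m.+1%:R)^-1) = 2^-1 * (m%:R / m.+1%:R) :> R.
    by field; rewrite gt_eqF.
  by apply: ler_wpM2l; rewrite ?invr_ge0// ler_pdivrMr// mul1r ler_nat.
have S00 : S = 0 by lra.
apply/rowP => j; rewrite mxE; apply: cmod_eq0; apply/eqP.
have := psumr_eq0P (fun j _ => cmod_ge0 (xi 0 j)) S00.
by move=> /(_ j isT) ->.
Qed.

(** Splitting [x] into its components along the axes makes [cocycle x] a product of one-parameter
    groups, each depending on a single coordinate. The derivative at 0 that [one_param_exppoly1]
    asks for comes from [cocycle_mean], multiplied on the right by the inverse of [mean rho]. *)
Lemma cocycle_exp_polynomial i j : exp_polynomial (fun x => cocycle x i j).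
Proof.
have [rho ev um] := mean_unit.
have dA l k e : cderiv (fun x => cocycle x l k) e 0
    (\sum_t convol (partial e rho) (fun y => cocycle y l t) 0 * invmx (mean rho) t k).
  have -> : (fun x => cocycle x l k) =
      fun x => \sum_t convol rho (fun y => cocycle y l t) x * invmx (mean rho) t k.
    apply/funext => x; under eq_bigr do rewrite -cocycle_mean//.
    by rewrite -[in LHS](mulmxK um (cocycle x)) mxE.
  apply: cderiv_sum => t.
  have := cderivM (conv_cderiv e 0 (testP rho) (cocycle_ccont l t))
    (cderiv_cst (invmx (mean rho) t k) e 0).
  by rewrite mulr0 add0r.
have line e l k : exppoly1 (fun t : R => cocycle (t *: basis_vec e) l k).
  apply: (@one_param_exppoly1 _ _ (fun t => cocycle (t *: basis_vec e)) (\matrix_(l, k)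
    (\sum_t convol (partial e rho) (fun y => cocycle y l t) 0 * invmx (mean rho) t k))).
    by move=> s t; rewrite scalerDl cocycleD.
  by move=> l' k'; rewrite mxE; exact: (cderiv_line (dA l' k' e)).
have H r l k :
    exp_polynomial (fun x : 'rV[R]_d => cocycle (\sum_(e <- r) x 0 e *: basis_vec e) l k).
  elim: r l k => [|e r IH] l k.
    under eq_fun do rewrite big_nil cocycle0.
    have := exp_polynomialZ ((1%:M : 'M[C]_m) l k)
      (@exp_polynomial_monomial R d (fun=> 0%N) (fun=> 0)).
    congr exp_polynomial; apply/funext => x; rewrite /exp_monomial big1// mul1r.
    by rewrite big1 ?Cexp0 ?mulr1// => t _; rewrite mulr0.
  under eq_fun do rewrite big_cons cocycleD mxE.
  apply: exp_polynomial_sum => t; apply: exp_polynomialM => //.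
  exact: exppoly1_coord (line e l t).
have := H (index_enum 'I_d) i j; congr exp_polynomial; apply/funext => x.
by rewrite -row_sum_delta.
Qed.

End Cocycle.

(** * Functions representing a distribution *)

Section LocallyIntegrable.
Context {R : realType} {d : nat}.
Implicit Types (g p : 'rV[R]_d -> R[i]).
Local Notation mu := (@lebesgue_rV R d).

Lemma ccont_loc_integrable p : ccont p -> loc_integrable p.
Proof.
move=> cp; have [rp ip] := cp; split; [exact: continuous_measurable_rV..|].
move=> K cK; have mK := compact_measurable_rV cK.
have [r r0 Kr] := compact_cube cK.
have Koo : (mu K < +oo)%E.
  apply: le_lt_trans (cube_lty r); apply: le_measure; rewrite ?inE//.
  exact: measurable_obox.
have [M M0 hM] := ccont_bounded cp cK.
have H f : continuous f -> (forall x, K x -> `|f x| <= M) -> mu.-integrable K (EFin \o f).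
  move=> cf fM; apply: measurable_bounded_integrable => //.
    by apply: measurable_funTS; exact: continuous_measurable_rV.
  exists M; split; first exact: num_real.
  by move=> y My x Kx; apply: (le_trans (fM x Kx)); exact: ltW.
split; apply: H => // x Kx; apply: le_trans (hM x Kx).
  exact: Re_le_cmod.
exact: Im_le_cmod.
Qed.

(** Bumps are real-valued, so equality of the complex integrals against them splits into real and
    imaginary parts, to which [bump_separates] applies. *)
Lemma is_function_unique (f : distr R d) g p : is_function f g -> is_function f p ->
  {ae mu, forall x, g x = p x}.
Proof.
move=> [[mrg mig lg] hg] [[mrp mip lp] hp].
have e a b n : Cintegral (fun x => g x * (box_bump a b n x)%:C) =
    Cintegral (fun x => p x * (box_bump a b n x)%:C).
  by have := hg (bump_testfun a b n); rewrite hp => /esym.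
have reE (q : 'rV[R]_d -> R[i]) (c : 'rV[R]_d -> R) :
    RE (Cintegral (fun x => q x * (c x)%:C)) = \int[mu]_x ((RE \o q) x * c x).
  by apply: eq_Rintegral => x _; rewrite Re_mul mulr0 subr0.
have imE (q : 'rV[R]_d -> R[i]) (c : 'rV[R]_d -> R) :
    IM (Cintegral (fun x => q x * (c x)%:C)) = \int[mu]_x ((IM \o q) x * c x).
  by apply: eq_Rintegral => x _; rewrite Im_mul mulr0 add0r.
have r1 : loc_int_real (RE \o g) by split=> // K /lg[].
have r2 : loc_int_real (RE \o p) by split=> // K /lp[].
have i1 : loc_int_real (IM \o g) by split=> // K /lg[].
have i2 : loc_int_real (IM \o p) by split=> // K /lp[].
have hr := bump_separates r1 r2 (fun a b n =>
  etrans (esym (reE g _)) (etrans (congr1 _ (e a b n)) (reE p _))).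
have hi := bump_separates i1 i2 (fun a b n =>
  etrans (esym (imE g _)) (etrans (congr1 _ (e a b n)) (imE p _))).
by apply: filterS2 hr hi => x; exact: complex_ext.
Qed.

End LocallyIntegrable.

Theorem theorem2p1 (R : realType) (d : nat) (d_gt0 : (0 < d)%N)
    (s : nat) (h : 'I_s -> 'rV[R]_d) (h_dense : dense (zspan h))
    (f : distr R d) (n : 'I_s -> nat)
    (hn : forall i : 'I_s,
      dim_le (lspan (fun k : 'I_(n i).+1 => iter k (translate (h i)) f)) (n i)) :
  exists p : 'rV[R]_d -> R[i],
    [/\ exp_polynomial p, is_function f p &
      forall g : 'rV[R]_d -> R[i], is_function f g ->
        {ae lebesgue_rV d, forall x, g x = p x}].
Proof.
have [I [b0 hb0]] := zspan_translates hn.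
(* The basis consists of translates of [f] by elements of the group: translating one of them gives
   another translate, whence [G_span], and [f] itself is the translate by 0. *)
have [m [x [Gx free_b span_b]]] := @maximal_free _ _ _ (zspan h) (fun x => translate x f) I b0 hb0.
set b : 'I_m -> distr R d := _ \o x in free_b span_b.
have [phi b_dual] := dual_tests free_b.
have G_span y i : zspan h y -> lspan b (translate y (b i)).
  by move=> Gy; rewrite /b /= translateD; apply: span_b; exact: zspanD.
have [c fc] : lspan b f by rewrite -(translate0 f); exact: span_b (zspan0 h).
pose A := cocycle b phi.
have [rho _ um] := mean_unit b_dual.
(* With [c] the coordinates of [f], [f = c b = xi A(rho) b], and [mean_sym] replaces [A(rho) b(psi)]
   by [A(psi) b(rho)]. The numbers [b j rho] do not depend on [psi], so [f psi] is the integral of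
   [psi] against [p]. *)
pose xi : 'rV[R[i]]_m := (\row_i c i) *m invmx (mean b phi rho).
pose p (y : 'rV[R]_d) := \sum_i \sum_j (xi 0 i * b j rho) * A y i j.
have f_eq psi : f psi = \sum_i xi 0 i * \sum_j mean b phi psi i j * b j rho.
  under eq_bigr do rewrite -(mean_sym b_dual h_dense G_span).
  have -> : f psi = ((\row_i c i) *m (\col_j b j psi)) 0 0.
    by rewrite fc distr_sumE mxE; apply: eq_bigr => i _; rewrite !mxE.
  rewrite -[\row_i c i](mulmxKV um) -/xi -mulmxA mxE; apply: eq_bigr => i _.
  by congr (_ * _); rewrite mxE; apply: eq_bigr => j _; rewrite [X in _ * X]mxE.
have pexp : exp_polynomial p.
  apply: exp_polynomial_sum => i; apply: exp_polynomial_sum => j.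
  apply: exp_polynomialZ; exact: (cocycle_exp_polynomial b_dual h_dense G_span).
have pcont : ccont p.
  apply: ccont_sum => i; apply: ccont_sum => j; apply: ccontZ; exact: cocycle_ccont.
have fp : is_function f p.
  split; first exact: ccont_loc_integrable.
  move=> psi; rewrite f_eq /p.
  under [in RHS]eq_fun do rewrite mulr_suml.
  rewrite Cintegral_sum => [|i]; last first.
    under eq_fun do rewrite mulr_suml; apply: Cintegrable_sum => j.
    under eq_fun do rewrite -mulrA; apply: CintegrableZ.
    exact: cocycle_test_integrable.
  apply: eq_bigr => i _; rewrite mulr_sumr.
  under [in RHS]eq_fun do rewrite mulr_suml.
  rewrite Cintegral_sum => [|j]; last first.
    under eq_fun do rewrite -mulrA; apply: CintegrableZ.
    exact: cocycle_test_integrable.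
  apply: eq_bigr => j _; under [in RHS]eq_fun do rewrite -mulrA.
  rewrite CintegralZ; last exact: cocycle_test_integrable.
  by rewrite [mean _ _ _ _ _]mxE [_ * b j rho]mulrC mulrA.
exists p; split=> // g fg; exact: is_function_unique fg fp.
Qed.
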